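(* Let $G$ be a discrete Cayley graph, $\mathcal P$ a spin model on its vertex set $V$ and $\xi_1,\dots,\xi_k$ score functions such that one of the following two conditions holds: 1. $G$ is $b$-amenable; $\mathcal P$ is a clustering spin model whose clustering function $\phi$ is summable in $G$; and $\xi_1,\dots,\xi_k$ are all local score functions. 2. $G$ has polynomial growth; $\mathcal P$ is an exponentially clustering spin model; $\xi_1,\dots,\xi_k$ are all exponentially quasi-local score functions on $\mathcal P$ satisfying the exponential growth condition, and each $(\xi_i,\mathcal P)$ satisfies the $p$-moment condition for all $p\ge1$. Set $H_n^{\xi_i}=\sum_{x\in\mathcal P_n}\xi_i(x,\mathcal P_n)$ and $\bar H_n=(H_n^{\xi_1},\dots,H_n^{\xi_k})$. Then as $n\to\infty$, $$\frac{\bar H_n-\mathbb E(\bar H_n)}{\sqrt{w_n}}\stackrel{d}{\Rightarrow}N(0,\Sigma),$$ where $\Sigma=(\Sigma(i,j))_{1\le i,j\le k}$ is the covariance matrix defined by $$\Sigma(i,j)=\sum_{z\in V}\operatorname{Cov}\bigl(\xi_i(O,\mathcal P),\xi_j(z,\mathcal P)\bigr)\in\mathbb R.$$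
   Context: **Cayley graphs.** $(V,+)$ is a countably infinite group (not necessarily commutative) with identity $O$, generated by a finite symmetric set $S$ ($h\in S\iff -h\in S$) with $O\notin S$. The discrete Cayley graph $G=(V,E)$ has $(g_1,g_2)\in E$ iff $-g_1+g_2\in S$. $d$ is the graph distance, $|x|=d(O,x)$, so $d(x,y)=|-x+y|$; $d(A,B)=\min_{x\in A,y\in B}d(x,y)$. $W_r(x)=\{y:d(x,y)\le r\}$, $W_r=W_r(O)$, $W_\infty=V$, $w_n=|W_n|$. $\partial A=\{x\in A:\exists y\notin A,\ (x,y)\in E\}$. $G$ is $b$-amenable if $|\partial W_n|/|W_n|\to0$ as $n\to\infty$; $G$ has polynomial growth if $|W_n|=O(n^{d_2})$ for some $d_2>0$. The Gaussian limit $N(0,\Sigma)$ may be degenerate. **Spin models.** $\mathcal N=\{0,1\}^V$; $\mu\in\mathcal N$ is identified with the subset $\{x:\mu_x=1\}$ of $V$. A spin model is an $\mathcal N$-valued random variable $\mathcal P$; $\mathcal P_n=\mathcal P\cap W_n$, $\mathcal P_\infty=\mathcal P$. $\mathcal P$ is stationary if $y+\mathcal P\stackrel d=\mathcal P$ for all $y\in V$, non-degenerate if $\mathbb P(O\in\mathcal P)\in(0,1)$. A function $\phi:[0,\infty)\to[0,\infty)$ is fast decreasing if $\phi\le1$, $\phi$ is decreasing and $\lim_{s\to\infty}s^m\phi(s)=0$ for all $m\ge1$. A stationary non-degenerate $\mathcal P$ is a clustering spin model if there are constants $C_k,c_k\in(0,\infty)$ ($C_k$ non-decreasing, $c_k$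 non-increasing in $k$) and a fast decreasing $\phi$ (the clustering function) such that for all $p,q\ge1$ and distinct $x_1,\dots,x_{p+q}\in V$, $$|\mathbb P(\{x_1,\dots,x_{p+q}\}\subset\mathcal P)-\mathbb P(\{x_1,\dots,x_p\}\subset\mathcal P)\mathbb P(\{x_{p+1},\dots,x_{p+q}\}\subset\mathcal P)|\le C_{p+q}\phi(c_{p+q}s),$$ $s=d(\{x_1,\dots,x_p\},\{x_{p+1},\dots,x_{p+q}\})$. It is exponentially clustering if moreover $c_k\ge c>0$ for all $k$, $C_k=O(k^{ak})$ for some $a\in[0,1)$ and $\limsup_{t\to\infty}\log\phi(t)/t^b<0$ for some $b\in(0,\infty)$. A fast decreasing $\phi$ is summable in $G$ if $\sum_{x\in V}\phi^{1/p}(c|x|)<\infty$ for all $c>0$, $p\ge1$. **Score functions.** A score function is a measurable $\xi:V\times\mathcal N\to\mathbb R$ that is translation-invariant, $\xi(y+x,y+\mu)=\xi(x,\mu)$, with the convention $\xi(x,\mu)=0$ if $x\notin\mu$. It is local if there is $r>0$ such that $\xi(O,\mu)$ depends only on $\mu\cap W_r$ for every $\mu$. The radius of stabilisation is $R(O,\mu)=\inf\{r>0,\ r\in\mathbb N:\xi(O,\mu)=\xi(O,\mu')\ \forall\mu'\in\mathcal N\text{ with }\mu'\cap W_r=\mu\cap W_r\}$ and $R(x,\mu)=R(O,-x+\mu)$. $\xi$ is exponentially quasi-local on $\mathcal P$ if there are $A>0$ and a function $\varphi(t)\downarrow0$ with $\sup_{1\le n\le\infty}\sup_{x\in W_n}\mathbb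 P(R(x,\mathcal P_n)\ge t)\le A\varphi(t)$ for all $t$ and $\limsup_{t\to\infty}\log\varphi(t)/t^c<0$ for some $c\in(0,\infty)$. Exponential growth condition: for some $\kappa\in[0,\infty)$ and constant $c_*<\infty$, $|\xi(O,\mu\cap W_t)|\le e^{c_*t^\kappa}$ for all $t>0$, $\mu\in\mathcal N$. $p$-moment condition: $\sup_{1\le n\le\infty}\sup_{x\in W_n}\mathbb E(\max\{|\xi(x,\mathcal P_n)|,1\}^p)<\infty$. *)

(* Defs.v *)
From HB Require Import structures.
From mathcomp Require Import all_boot all_order all_algebra finmap.
From mathcomp Require Import all_classical all_reals all_analysis.

Set Implicit Arguments.
Unset Strict Implicit.
Unset Printing Implicit Defensive.

Import Order.TTheory GRing.Theory Num.Theory.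
Import numFieldNormedType.Exports.

Local Open Scope classical_set_scope.
Local Open Scope card_scope.
Local Open Scope ring_scope.

(* The group (V, +), not necessarily commutative, is a [groupType] and is
   therefore written multiplicatively: x + y is (x * y)%g, -x is x^-1%g and
   O is 1%g. *)

Section CayleyGraph.
Variable V : groupType.
Variable S : {fset V}.

Definition generates : Prop :=
  forall H : set V,
    H 1%g ->
    (forall x y, H x -> H y -> H (x * y)%g) ->
    (forall x, H x -> H (x^-1)%g) ->
    (forall x, x \in S -> H x) ->
    H = [set: V].

Definition cayley_graph : Prop :=
  [/\ [set: V] #= [set: nat],
      (forall h, (h \in S) = ((h^-1)%g \in S)),
      1%g \notin S
    & generates].

Definition cayley_edge : rel V := fun g1 g2 => (g1^-1 * g2)%g \in S.

(* The least element of Q; 0 when Q is empty. *)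
Definition min_nat (Q : set nat) : nat :=
  if pselect (exists n, `[< Q n >]) is left exQ then ex_minn exQ else 0%N.

Definition gdist (x y : V) : nat :=
  min_nat [set size p | p in
    [set p | path cayley_edge x p && (last x p == y)]].

Definition set_dist (A B : set V) : nat :=
  min_nat [set gdist x y | x in A & y in B].

Definition inner_boundary (A : set V) : set V :=
  [set x | A x /\ exists2 y, ~ A y & cayley_edge x y].

Variable R : realType.

(* Radii are extended reals, so that W x +oo is the whole of V. *)
Definition W (x : V) (r : \bar R) : set V :=
  [set y | ((gdist x y)%:R%:E <= r)%E].

Definition Wn (n : nat) : set V := W 1%g n%:R%:E.

(* Cardinality as a real number, meaningful for finite A. *)
Definition card (A : set V) : R := #|` fset_set A|%:R.

Definition w (n : nat) : R := card (Wn n).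

Definition b_amenable : Prop :=
  card (inner_boundary (Wn n)) / w n @[n --> \oo] --> (0 : R).

Definition polynomial_growth : Prop :=
  exists2 d2 : R, 0 < d2 & w =O_\oo (fun n => n%:R `^ d2).

End CayleyGraph.

Section Decay.
Variable R : realType.
Implicit Types phi : R -> R.

(* Functions on [0, +oo[ are represented by functions on R whose values at
   negative reals are irrelevant; "decreasing" is understood as nonincreasing. *)
Definition nonincreasing_nneg phi : Prop :=
  forall s t, 0 <= s -> s <= t -> phi t <= phi s.

Definition fast_decreasing phi : Prop :=
  [/\ (forall s, 0 <= s -> 0 <= phi s <= 1),
      nonincreasing_nneg phi
    & forall m : nat, (1 <= m)%N -> s ^+ m * phi s @[s --> +oo] --> (0 : R)].

(* limsup_(t -> oo) log phi(t) / t^b < 0, where log 0 = -oo. *)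
Definition stretched_exp_decay phi (b : R) : Prop :=
  (limf_esup (fun t : R => lne (phi t)%:E * ((t `^ b)^-1)%:E) (pinfty_nbhs R)
     < 0)%E.

Definition summable_in (V : groupType) (S : {fset V}) phi : Prop :=
  forall c p : R, 0 < c -> 1 <= p ->
    summable [set: V] (fun x => ((phi (c * (gdist S 1%g x)%:R)) `^ p^-1)%:E).

End Decay.

Section Configurations.
Variable V : groupType.

(* {0,1}^V with its product sigma-algebra. *)
Definition coordinate_sets : set (set (V -> bool)) :=
  [set [set mu : V -> bool | mu x] | x in [set: V]].

Definition config := g_sigma_algebraType coordinate_sets.

Definition shift (y : V) (mu : config) : config := fun x => mu (y^-1 * x)%g.

Definition restrict (mu : config) (A : set V) : config :=
  fun x => mu x && (x \in A).

End Configurations.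

Section SpinModels.
Variables (R : realType) (V : groupType) (S : {fset V}).
Variables (d : measure_display) (Omega : measurableType d).
Variables (P : probability Omega R) (X : Omega -> config V).

Definition stationary : Prop :=
  forall (y : V) (A : set (config V)), measurable A ->
    P [set om | A (shift y (X om))] = P [set om | A (X om)].

Definition non_degenerate : Prop :=
  (0 < P [set om | X om 1%g] < 1)%E.

Definition contains (xs : seq V) : set Omega := [set om | all (X om) xs].

Definition clustering (C c : nat -> R) (phi : R -> R) : Prop :=
  [/\ stationary /\ non_degenerate,
      (forall k, 0 < C k) /\ {homo C : k l / (k <= l)%N >-> k <= l},
      (forall k, 0 < c k) /\ {homo c : k l / (k <= l)%N >-> l <= k},
      fast_decreasing phi
    & forall xs ys : seq V, (1 <= size xs)%N -> (1 <= size ys)%N ->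
        uniq (xs ++ ys) ->
        (`|P (contains (xs ++ ys)) - P (contains xs) * P (contains ys)| <=
         (C (size xs + size ys)%N *
          phi (c (size xs + size ys)%N *
               (set_dist S [set` xs] [set` ys])%:R))%:E)%E].

Definition exponentially_clustering : Prop :=
  exists (C c : nat -> R) (phi : R -> R),
    [/\ clustering C c phi,
        (exists2 c0, 0 < c0 & forall k, c0 <= c k),
        (exists2 a : R, 0 <= a < 1 & C =O_\oo (fun k => k%:R `^ (a * k%:R)))
      & exists2 b : R, 0 < b & stretched_exp_decay phi b].

End SpinModels.

Section ScoreFunctions.
Variables (R : realType) (V : groupType) (S : {fset V}).
Implicit Types (xi : V -> config V -> R) (mu : config V) (r : \bar R).

(* V is countable and discrete, so measurability on V x {0,1}^V is
   measurability of every section. *)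
Definition score_function xi : Prop :=
  [/\ (forall x, measurable_fun [set: config V] (xi x)),
      (forall y x mu, xi (y * x)%g (shift y mu) = xi x mu)
    & (forall x mu, ~~ mu x -> xi x mu = 0)].

Definition local_score xi : Prop :=
  exists2 r : R, 0 < r & forall mu mu',
    restrict mu (W S 1%g r%:E) = restrict mu' (W S 1%g r%:E) ->
    xi 1%g mu = xi 1%g mu'.

(* The infimum of the empty set is +oo. *)
Definition stab_radius0 xi mu : \bar R :=
  ereal_inf [set r%:R%:E | r in [set r : nat | (0 < r)%N /\ forall mu',
    restrict mu' (W S 1%g (r%:R%:E : \bar R)) =
      restrict mu (W S 1%g (r%:R%:E : \bar R)) ->
    xi 1%g mu = xi 1%g mu']].

Definition stab_radius xi (x : V) mu : \bar R :=
  stab_radius0 xi (shift (x^-1)%g mu).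

Definition exponential_growth xi : Prop :=
  exists kappa cstar : R, 0 <= kappa /\ forall (t : R) mu, 0 < t ->
    `|xi 1%g (restrict mu (W S 1%g t%:E))| <= expR (cstar * t `^ kappa).

(* The indices 1 <= n <= oo of the windows W_n. *)
Definition window_indices : set (\bar R) :=
  [set n%:R%:E | n in [set n : nat | (1 <= n)%N]] `|` [set +oo%E].

Variables (d : measure_display) (Omega : measurableType d).
Variables (P : probability Omega R) (X : Omega -> config V).

Definition windowed r (om : Omega) : config V := restrict (X om) (W S 1%g r).

Definition exponentially_quasi_local xi : Prop :=
  exists (A : R) (phi : R -> R),
    [/\ 0 < A,
        nonincreasing_nneg phi /\ phi t @[t --> +oo] --> (0 : R),
        (forall t : R, 0 <= t ->
           (ereal_sup [set ereal_sup
              [set P [set om | (t%:E <= stab_radius xi x (windowed n om))%E]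
              | x in W S 1%g n] | n in window_indices] <= (A * phi t)%:E)%E)
      & exists2 c : R, 0 < c & stretched_exp_decay phi c].

Definition moment_condition xi (p : R) : Prop :=
  (ereal_sup [set ereal_sup
     [set 'E_P[(fun om => Num.max `|xi x (windowed n om)| 1 `^ p)%R]
     | x in W S 1%g n] | n in window_indices] < +oo)%E.

Definition H xi (n : nat) (om : Omega) : R :=
  \sum_(x \in [set x | windowed n%:R%:E om x])
    xi x (windowed n%:R%:E om).

Definition normalized_H k (xi : 'I_k -> V -> config V -> R) (n : nat)
    (om : Omega) : 'rV[R]_k :=
  \row_i ((H (xi i) n om - fine 'E_P[H (xi i) n]) / Num.sqrt (w S R n)).

Definition score_cov (xi xi' : V -> config V -> R) (z : V) : \bar R :=
  covariance P (fun om => xi 1%g (X om)) (fun om => xi' z (X om)).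

(* The sum over V of the (absolutely summable) covariances. *)
Definition limit_cov k (xi : 'I_k -> V -> config V -> R) : 'M[R]_k :=
  \matrix_(i, j) fine
    (\esum_(z in [set: V]) (score_cov (xi i) (xi j))^\+ z -
     \esum_(z in [set: V]) (score_cov (xi i) (xi j))^\- z)%E.

End ScoreFunctions.

Section Gaussian.
Variables (R : realType) (k : nat).

Definition borel_rV := g_sigma_algebraType (@open 'rV[R]_k).

(* One-dimensional normal law of mean m and variance v >= 0. *)
Definition normal_law (m v : R) (A : set R) : \bar R :=
  if v == 0 then \d_m A else normal_prob m (Num.sqrt v) A.

(* N(0, Sigma), possibly degenerate: every linear functional <t, .> is
   distributed as N(0, <t, Sigma t>). *)
Definition is_gaussian (Sigma : 'M[R]_k) (nu : probability borel_rV R) : Prop :=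
  [/\ Sigma^T = Sigma,
      (forall t : 'rV[R]_k, 0 <= (t *m Sigma *m t^T) 0 0)
    & forall (t : 'rV[R]_k) (A : set R), measurable A ->
        nu [set x : 'rV[R]_k | A ((x *m t^T) 0 0)] =
        normal_law 0 ((t *m Sigma *m t^T) 0 0) A].

Definition cvg_in_distribution (d : measure_display) (Omega : measurableType d)
    (P : probability Omega R) (Y : nat -> Omega -> 'rV[R]_k)
    (nu : probability borel_rV R) : Prop :=
  forall f : 'rV[R]_k -> R, continuous f ->
    (exists M : R, forall x, `|f x| <= M) ->
    'E_P[f \o Y n]%E @[n --> \oo] --> (\int[nu]_x (f x)%:E)%E.

End Gaussian.

(* Main.v *)
(* The proof is by the method of moments.  Under either condition the scores
   are, up to an error smaller than any negative power of the volume of the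
   ball of radius s, bounded functions of the spins within distance s / 2, so
   that clustering makes the covariance of products of scores at distance s
   from each other smaller than any negative power of that volume.  Expand the
   (m+2)-nd moment of a centred linear combination of the scores summed over
   W_n over the configurations of m+2 points.  A configuration with an isolated
   point is negligible, one in which the first point forms an isolated pair
   with another one factorises, and all the other ones form at most (m+1)/2
   clusters, hence are too few to contribute.  After normalisation this is
   M_(m+2) = (m+1) M_2 M_m + o(1), the recursion of the Gaussian moments; the
   second moments converge because b-amenability (a consequence of polynomial
   growth) makes boundary effects negligible.  A Gaussian law with the limiting
   covariance is built as a sum of independent rank-one Gaussian vectors.  It
   is determined by its moments: these give the expectations of cosines by
   Taylor expansion, and those of all bounded continuous functions by
   trigonometric approximation. *)

Require Import Defs.
From HB Require Import structures.
From mathcomp Require Import all_boot all_order all_algebra finmap.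
From mathcomp Require Import all_classical all_reals all_analysis.
From mathcomp Require Import measurable_realfun.
From mathcomp Require Import zify ring lra.

Set Implicit Arguments.
Unset Strict Implicit.
Unset Printing Implicit Defensive.

Import Order.TTheory GRing.Theory Num.Theory.
Import numFieldNormedType.Exports.

Local Open Scope classical_set_scope.
Local Open Scope ring_scope.

(** * Balls and boundary layers of a Cayley graph *)

Section MinNat.

(** Errors are measured in negative powers of ball volumes rather than of distances, the common
    currency of the two conditions: under the first one the growth may be faster than polynomial.
    The obstacle to decorrelation is the price of locality. Clustering concerns only the events that
    given sites are occupied; expanding a function of [j] spins in these events costs a factor
    [3 ^ j], and the constants [C j] grow as well. For local scores [j] stays bounded. For
    quasi-local ones the radius [t] of dependence has to grow with the separation [s], and it is
    kept near a small power of [s], so that clustering across [s] outweighs the price of a ball of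
    radius [t]. In the moment expansion the separation is tied to the window in the same spirit:
    [vol s] is a fixed small power of [vol n], large enough for mixing to beat the number of all
    configurations and small enough for a cluster of points to count as little more than one free
    point. Windows destroy stationarity near their boundary, hence window covariances are compared
    with those of the full model at interior points only. *)

Lemma min_natP (Q : set nat) n : Q n -> Q (min_nat Q) /\ (min_nat Q <= n)%N.
Proof.
move=> Qn; rewrite /min_nat; case: pselect => [exQ|[]]; last by exists n; exact/asboolP.
by case: ex_minnP => m /asboolP Qm mle; split => //; apply/mle/asboolP.
Qed.

Lemma min_nat_le (Q : set nat) n : Q n -> (min_nat Q <= n)%N.
Proof. by move=> /min_natP[]. Qed.

End MinNat.

Section Graph.
Variables (V : groupType) (S : {fset V}).
Hypothesis cayleyS : cayley_graph S.

Let symS h : h \in S -> (h^-1)%g \in S.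
Proof. by case: cayleyS => _ sS _ _; rewrite -sS. Qed.

(** Balls grown generator by generator are finite by construction, which gives access to
    cardinalities and finite sums; [mem_ball] identifies them with the metric balls. *)
Fixpoint ball (n : nat) : {fset V} :=
  if n is m.+1 then (ball m `|` [fset (x * h)%g | x in ball m, h in S])%fset
  else [fset 1%g]%fset.

Arguments ball : simpl never.

Lemma ballSP n x :
  reflect (x \in ball n \/ exists2 y, y \in ball n & (y^-1 * x)%g \in S)
    (x \in ball n.+1).
Proof.
rewrite [ball _]/= inE; apply: (iffP orP) => -[]; [by left| | by left |].
  by case/imfset2P => y /= yb [h /= hS ->]; right; exists y => //; rewrite mulKg.
case=> y yb hS; right; apply/imfset2P; exists y => //.
by exists (y^-1 * x)%g => //; rewrite mulVKg.
Qed.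

Lemma ball_path n x : x \in ball n ->
  exists2 p, (size p <= n)%N & path (cayley_edge S) 1%g p && (last 1%g p == x).
Proof.
elim: n x => [|n ih] x.
  by rewrite inE => /eqP ->; exists [::] => //=; rewrite eqxx.
move=> /ballSP [/ih [p ps pp]|[y /ih [p ps /andP[pp /eqP py]] yx]].
  by exists p => //; rewrite ltnW.
by exists (rcons p x); rewrite ?size_rcons // rcons_path last_rcons eqxx pp py /cayley_edge yx.
Qed.

Lemma path_ball p x : path (cayley_edge S) 1%g p -> last 1%g p = x ->
  x \in ball (size p).
Proof.
elim/last_ind: p x => [|p y ih] x /=; first by move=> _ <-; rewrite inE.
rewrite rcons_path last_rcons size_rcons => /andP[pp yx] <-.
by apply/ballSP; right; exists (last 1%g p) => //; exact: ih.
Qed.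

Lemma ball_le m n : (m <= n)%N -> {subset ball m <= ball n}.
Proof.
elim: n m => [|n ih] m; first by rewrite leqn0 => /eqP ->.
by rewrite leq_eqVlt => /predU1P[-> //|mn] x xm; apply/ballSP; left; exact: ih xm.
Qed.

Lemma ball1 n : 1%g \in ball n.
Proof. by apply: (@ball_le 0) => //; rewrite inE. Qed.

Lemma ballM m n x y : x \in ball m -> y \in ball n -> (x * y)%g \in ball (m + n).
Proof.
move=> xm; elim: n y => [|n ih] y; first by rewrite inE addn0 => /eqP ->; rewrite mulg1.
rewrite addnS => /ballSP[yn|[z zn zy]]; apply/ballSP; first by left; exact: ih.
by right; exists (x * z)%g; [exact: ih|rewrite invgM mulgA mulgVK].
Qed.

Lemma ballV n x : x \in ball n -> (x^-1)%g \in ball n.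
Proof.
elim: n x => [|n ih] x; first by rewrite !inE => /eqP ->; rewrite invg1.
move=> /ballSP[yn|[z zn /symS zy]]; first by apply/ballSP; left; exact: ih.
have -> : (x^-1 = (z^-1 * x)^-1 * z^-1)%g by rewrite invgM invgK mulgK.
rewrite -add1n; apply: ballM (ih _ zn).
by apply/ballSP; right; exists 1%g; rewrite ?inE// invg1 mul1g.
Qed.

Lemma ball_cover x : exists n, x \in ball n.
Proof.
case: cayleyS => _ _ _ gen.
suff : [set x | exists n, x \in ball n] x by [].
(* The union of all balls is a subgroup containing the generators. *)
rewrite (gen [set x | exists n, x \in ball n]) //.
- by exists 0%N; rewrite ball1.
- by move=> a b [m am] [n bn]; exists (m + n)%N; exact: ballM.
- by move=> a [m am]; exists m; exact: ballV.
- move=> a aS; exists 1%N; apply/ballSP; right; exists 1%g; rewrite ?inE//.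
  by rewrite invg1 mul1g.
Qed.

Definition len (x : V) : nat := gdist S 1%g x.

Lemma len_ball x : x \in ball (len x).
Proof.
have [n /ball_path [p _ pp]] := ball_cover x.
rewrite /len /gdist.
have [[q /= /andP[qq /eqP qx] <-] _] :=
  @min_natP [set size p | p in [set p | path (cayley_edge S) 1%g p && (last 1%g p == x)]]
    (size p) (ex_intro2 _ _ p pp erefl).
exact: path_ball.
Qed.

Lemma mem_ball n x : (x \in ball n) = (len x <= n)%N.
Proof.
apply/idP/idP => [|ln]; last exact: ball_le ln _ (len_ball x).
case/ball_path => p ps pp; apply: leq_trans ps.
by apply: min_nat_le; exists p.
Qed.

Lemma len1 : len 1%g = 0%N.
Proof. by apply/eqP; rewrite -leqn0 -mem_ball ball1. Qed.

Lemma lenM x y : (len (x * y)%g <= len x + len y)%N.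
Proof. by rewrite -mem_ball ballM// len_ball. Qed.

Lemma lenV x : len (x^-1)%g = len x.
Proof.
have le y : (len (y^-1)%g <= len y)%N by rewrite -mem_ball ballV// len_ball.
by apply/eqP; rewrite eqn_leq le -{1}(invgK x) le.
Qed.

Lemma len0 x : len x = 0%N -> x = 1%g.
Proof. by move=> x0; have := len_ball x; rewrite x0 inE => /eqP. Qed.

(** Edges only involve [g1^-1 * g2], so left translations are graph automorphisms and carry paths to
    paths. *)
Lemma gdistE x y : gdist S x y = len (x^-1 * y)%g.
Proof.
have path_mul z a p : path (cayley_edge S) (z * a)%g (map (fun u => z * u)%g p) =
    path (cayley_edge S) a p.
  elim: p a => //= b p ih a; rewrite ih; congr (_ && _).
  by rewrite /cayley_edge invgM -mulgA mulKg.
rewrite /len /gdist; congr min_nat; apply/seteqP; split => k /= [p /andP[pp /eqP lp] <-].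
  exists (map (fun u => x^-1 * u)%g p); last by rewrite size_map.
  have := path_mul (x^-1)%g x p; rewrite mulVg => ->; rewrite pp.
  by rewrite -[1%g](mulVg x) last_map lp eqxx.
exists (map (fun u => x * u)%g p); last by rewrite size_map.
have := path_mul x 1%g p; rewrite mulg1 => ->; rewrite pp.
by rewrite -[x in last x]mulg1 last_map lp mulVKg eqxx.
Qed.

Lemma gdistC x y : gdist S x y = gdist S y x.
Proof. by rewrite !gdistE -lenV invgM invgK. Qed.

Lemma gdist_triangle y x z : (gdist S x z <= gdist S x y + gdist S y z)%N.
Proof.
by rewrite !gdistE (_ : x^-1 * z = x^-1 * y * (y^-1 * z))%g ?lenM// mulgA mulgK.
Qed.

Lemma gdistxx x : gdist S x x = 0%N.
Proof. by rewrite gdistE mulVg len1. Qed.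

(** A shortest path from the identity visits every intermediate radius. This gives the
    submultiplicativity [volD] and the inward moves in [annulus_shrink]. *)
Lemma geodesic x k : (k <= len x)%N ->
  exists2 y, len y = k & gdist S y x = (len x - k)%N.
Proof.
move: {2}(len x) (erefl (len x)) => n; elim: n x k => [|n ih] x k xn.
  rewrite xn leqn0 => /eqP ->; exists x; rewrite ?gdistxx ?xn//.
rewrite leq_eqVlt => /predU1P[->|]; first by exists x; rewrite ?gdistxx ?subnn.
rewrite xn ltnS => kn; have := len_ball x; rewrite xn => /ballSP[|[z]].
  by rewrite mem_ball xn ltnn.
rewrite mem_ball => zn zx.
have zx1 : (gdist S z x <= 1)%N.
  rewrite gdistE -mem_ball; apply/ballSP; right; exists 1%g; rewrite ?inE//.
  by rewrite invg1 mul1g.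
have lzx y : (len x <= len y + gdist S y x)%N := gdist_triangle y 1%g x.
have zn' : len z = n by have := lzx z; lia.
have [|y yk yz] := ih z k zn'; first by rewrite zn'.
exists y => //; have := lzx y; have := gdist_triangle z y x; lia.
Qed.

Definition vol (n : nat) : nat := #|` ball n|.

Lemma vol_gt0 n : (0 < vol n)%N.
Proof. by rewrite cardfs_gt0; apply/fset0Pn; exists 1%g; rewrite ball1. Qed.

Lemma vol_le m n : (m <= n)%N -> (vol m <= vol n)%N.
Proof. by move=> mn; apply: fsubset_leq_card; apply/fsubsetP/ball_le. Qed.

Lemma volD m n : (vol (m + n) <= vol m * vol n)%N.
Proof.
rewrite /vol; apply: leq_trans (_ : (#|` [fset (x * y)%g | x in ball m, y in ball n]%fset| <= _)%N).
  apply: fsubset_leq_card; apply/fsubsetP => x; rewrite mem_ball => xmn.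
  have [xm|mx] := leqP (len x) m.
    by apply/imfset2P; exists x; rewrite /= ?mem_ball//; exists 1%g; rewrite /= ?ball1 ?mulg1.
  have [y ym yx] := geodesic (ltnW mx).
  apply/imfset2P; exists y; rewrite /= ?mem_ball ?ym//.
  by exists (y^-1 * x)%g; rewrite /= ?mem_ball ?mulVKg// -gdistE yx; lia.
rewrite -(size_allpairs (fun x y => x * y)%g).
have /uniq_leq_size := fset_uniq [fset (x * y)%g | x in ball m, y in ball n]%fset.
apply => z /imfset2P [x /= xm [y /= yn ->]].
by apply/allpairsP; exists (x, y).
Qed.

Lemma vol_mul m k : (vol (m * k) <= vol k ^ m)%N.
Proof.
elim: m => [|m ih]; first by rewrite mul0n /vol /= cardfs1.
by rewrite mulSn expnS (leq_trans (volD _ _))// leq_mul2l ih orbT.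
Qed.

(** If two consecutive balls agreed, no later ball could grow and the group would be finite. *)
Lemma vol_mono n : (vol n < vol n.+1)%N.
Proof.
rewrite ltn_neqAle vol_le// andbT; apply/eqP => eqv.
have beq : ball n = ball n.+1.
  by apply/eqP; rewrite eqEfcard -[X in (X <= _)%N]/(vol _) -eqv leqnn andbT; apply/fsubsetP/ball_le.
have bT k : {subset ball (n + k) <= ball n}.
  elim: k => [|k ih] x; first by rewrite addn0.
  rewrite addnS => /ballSP[/ih //|[y /ih yn yx]].
  by rewrite beq; apply/ballSP; right; exists y.
have infV : infinite_set [set: V].
  case: cayleyS => VN _ _ _.
  by rewrite (eq_finite_set VN); exact: infinite_nat.
apply: infV; apply: (sub_finite_set (B := [set` ball n])); last exact: finite_fset.
by move=> x _ /=; apply: (bT (len x)); rewrite mem_ball leq_addl.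
Qed.

Lemma vol_ge n : (n < vol n)%N.
Proof. by elim: n => [|n ih]; [exact: vol_gt0|exact: leq_ltn_trans ih (vol_mono n)]. Qed.

Section Windows.
Variable R : realType.

Lemma WnE n : Wn S R n = [set` ball n].
Proof.
by apply/seteqP; split => x; rewrite /Wn /W /= lee_fin ler_nat mem_ball.
Qed.

Lemma wE n : w S R n = (vol n)%:R.
Proof. by rewrite /w /Defs.card WnE set_fsetK. Qed.

End Windows.

Definition collar (n m : nat) : {fset V} :=
  [fset x in ball n | `[< exists2 y, y \notin ball n & (gdist S x y <= m)%N >]]%fset.

(** A path of length at most [m] leading out of the ball leaves it through the inner boundary, so
    balls of radius [m] around boundary points cover the collar. *)
Lemma collar_inner_boundary n m :
  (#|` collar n m| <= #|` fset_set (inner_boundary S [set` ball n])| * vol m)%N.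
Proof.
set B := fset_set _.
rewrite -(size_allpairs (fun x y => x * y)%g).
apply: uniq_leq_size; first exact: fset_uniq.
have bB b : (b \in B) = (b \in inner_boundary S [set` ball n]).
  by rewrite in_fset_set//; apply: (sub_finite_set (B := [set` ball n])) => // ? [].
move=> x; rewrite !inE => /andP[xn /asboolP[y ny xy]].
have [p pm pp] : exists2 p, (size p <= m)%N & path (cayley_edge S) x p && (last x p == y).
  move: xy; rewrite gdistE -mem_ball => /ball_path [p pm /andP[pp /eqP py]].
  exists (map (fun u => x * u)%g p); first by rewrite size_map.
  rewrite -[x in path _ x]mulg1 -[x in last x]mulg1 last_map py mulVKg eqxx andbT.
  elim: p 1%g pp {pm py} => //= b p ih a /andP[ab /ih ->]; rewrite andbT.
  by rewrite /cayley_edge invgM -mulgA mulKg.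
have [b [bb xb]] : exists b, b \in B /\ (gdist S b x <= m)%N.
  elim: p m x xn pm pp {xy} => [|z p ih] m' x xn /=.
    by move=> _ /eqP xy; move: ny; rewrite -xy xn.
  case: m' => // m'; rewrite ltnS => pm; rewrite -andbA => /andP[xz pp].
  have [zn|nz] := boolP (z \in ball n).
    have [b [bb zb]] := ih m' z zn pm pp; exists b; split => //.
    apply: leq_trans (gdist_triangle z b x) _; rewrite -addn1 leq_add//.
    rewrite gdistC gdistE -mem_ball; apply/ballSP; right; exists 1%g; rewrite ?inE//.
    by rewrite invg1 mul1g.
  exists x; split; last by rewrite gdistxx.
  by rewrite bB inE; split => //; exists z => //; exact/negP.
apply/allpairsP; exists (b, (b^-1 * x)%g); split => //=; last by rewrite mulVKg.
by rewrite mem_ball -gdistE.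
Qed.

Lemma inner_boundary_sphere n :
  (#|` fset_set (inner_boundary S [set` ball n.+1])| <= vol n.+1 - vol n)%N.
Proof.
rewrite -cardfsDS; last by apply/fsubsetP/ball_le.
apply: fsubset_leq_card; apply/fsubsetP => x.
rewrite in_fset_set; last first.
  by apply: (sub_finite_set (B := [set` ball n.+1])) => // ? [].
rewrite inE => -[/= xn [y /negP ny xy]]; rewrite in_fsetD xn andbT.
by apply: contra ny => xn'; apply/ballSP; right; exists x.
Qed.

(* [y] is obtained by moving [2 r] steps from [x] towards the centre: its
   [r]-ball lies in the larger annulus but not in the smaller one. *)
Lemma annulus_shrink n r K : (4 * r <= n)%N -> (0 < r)%N -> (vol (4 * r) <= K * vol r)%N ->
  ((vol n - vol (n - r)) * K.+1 <= (vol n - vol (n - 4 * r)) * K)%N.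
Proof.
move=> rn r0 rK.
pose A m := (ball n `\` ball (n - m))%fset.
have cA m : #|` A m| = (vol n - vol (n - m))%N.
  by rewrite cardfsDS//; apply/fsubsetP/ball_le; rewrite leq_subr.
have mA m x : (x \in A m) = ((n - m < len x) && (len x <= n))%N.
  by rewrite !inE !mem_ball -ltnNge.
pose inner y := ((n - 3 * r < len y) && (len y <= n - 2 * r))%N.
pose sep (Y : {fset V}) := `[< forall y z, y \in Y -> z \in Y -> y != z -> (2 * r < gdist S y z)%N >].
pose good (Y : {fset V}) := all inner Y && sep Y.
(* A maximal family of points of a middle layer at mutual distances above [2 * r]: its [r]-balls are
   disjoint ([lower]), and its [4 * r]-balls cover the outer annulus ([upper]). *)
have [Y gY maxY] : exists2 Y, good Y & forall y, inner y -> y \notin Y ->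
    exists2 z, z \in Y & (gdist S z y <= 2 * r)%N.
  pose bounded k := `[< exists Y, good Y /\ #|` Y| = k >].
  have b0 : exists k, bounded k.
    by exists 0%N; apply/asboolP; exists fset0; split; [rewrite /good /=; apply/asboolP|rewrite cardfs0].
  have bb k : bounded k -> (k <= vol n)%N.
    move=> /asboolP[Y [/andP[/allP iY _] <-]]; apply: fsubset_leq_card; apply/fsubsetP => y /iY.
    by rewrite mem_ball /inner; lia.
  case: (ex_maxnP b0 bb) => k /asboolP[Y [gY Yk]] maxk; exists Y => // y iy ny.
  apply: contrapT => nz.
  have /maxk : bounded k.+1.
    apply/asboolP; exists (y |` Y)%fset; split; last by rewrite cardfsU1 ny Yk.
    move/andP: gY => [/allP iY /asboolP sY]; apply/andP; split.
      by apply/allP => z; rewrite !inE => /predU1P[->|/iY].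
    apply/asboolP => a b; rewrite !inE => /predU1P[->|aY] /predU1P[->|bY].
    - by rewrite eqxx.
    - by move=> _; rewrite ltnNge; apply/negP => ab; apply: nz; exists b => //; rewrite gdistC.
    - by move=> _; rewrite ltnNge; apply/negP => ab; apply: nz; exists a.
    - exact: sY.
  by rewrite ltnn.
have upper : (#|` A r| <= #|` Y| * vol (4 * r))%N.
  rewrite -(size_allpairs (fun x y => x * y)%g).
  apply: uniq_leq_size; first exact: fset_uniq.
  move=> x; rewrite mA => /andP[xr xn].
  have [|y yl yx] := @geodesic x (len x - 2 * r); first lia.
  have iy : inner y by rewrite /inner; lia.
  have [z zY zy] : exists2 z, z \in Y & (gdist S z y <= 2 * r)%N.
    have [yY|] := boolP (y \in Y); last exact: maxY.
    by exists y; rewrite ?gdistxx.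
  apply/allpairsP; exists (z, (z^-1 * x)%g); split => //=; last by rewrite mulVKg.
  by rewrite mem_ball -gdistE; have := gdist_triangle y z x; lia.
have lower : (#|` Y| * vol r <= #|` (A (4 * r)%N `\` A r)%fset|)%N.
  rewrite -(size_allpairs (fun x y => x * y)%g).
  apply: uniq_leq_size; last first.
    move=> x /allpairsP[[y z] [/= yY zr ->]].
    move: zr gY; rewrite mem_ball => zr /andP[/allP/(_ _ yY) + _]; rewrite /inner => iy.
    rewrite in_fsetD !mA; have := lenM y z; have := lenM (y * z)%g (z^-1)%g.
    rewrite mulgK lenV => h1 h2.
    move: rn zr iy h1 h2; clear; move: (len y) (len z) (len (y * z)) => a b c; lia.
  apply: allpairs_uniq; [exact: fset_uniq|exact: fset_uniq|].
  move=> [y z] [y' z'] /allpairsP[[a b] [/= yY zr [ya zb]]].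
  move=> /allpairsP[[a' b'] [/= yY' zr' [ya' zb']]] /= e; subst a b a' b'.
  move/andP: gY => [_ /asboolP sY].
  have yy : y = y'.
    apply: contrapT => /eqP /(sY _ _ yY yY'); rewrite ltnNge => /negP; apply.
    move: zr zr'; rewrite !mem_ball => zr zr'.
    rewrite gdistE (_ : y^-1 * y' = z * z'^-1)%g.
      by rewrite (leq_trans (lenM _ _))// lenV mul2n -addnn leq_add.
    by rewrite -[y'](mulgK z') -e !mulgA mulVg mul1g.
  by subst y'; congr pair; move: e => /(congr1 (fun u => y^-1 * u)%g); rewrite !mulKg.
have AA : (A r `<=` A (4 * r)%N)%fset.
  by apply/fsubsetP => x; rewrite !mA; lia.
move: upper lower; rewrite cardfsDS//; rewrite !cA.
have := fsubset_leq_card AA; rewrite !cA.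
move: (vol n - vol (n - r))%N (vol n - vol (n - 4 * r))%N => a b ab aY Yb.
have : (#|` Y| * vol (4 * r) <= #|` Y| * (K * vol r))%N by rewrite leq_mul2l rK orbT.
by nia.
Qed.

(** * Polynomial growth and the share of the outermost shell *)

Section PolynomialGrowth.
Variables (C D : nat).
Hypothesis growth : forall n, (0 < n)%N -> (vol n <= C * n ^ D)%N.

Let K := (4 ^ D.+1)%N.

(** Were the ratio above [K = 4 ^ D.+1] at every scale from [J] on, volumes would grow with exponent
    [D + 1] along the powers of 4, against [growth]. *)
Lemma good_scale J : exists2 j, (J <= j)%N & (vol (4 * 4 ^ j) <= K * vol (4 ^ j))%N.
Proof.
apply: contrapT => bad.
have step i : (K ^ i <= vol (4 ^ (J + i)))%N.
  elim: i => [|i ih]; first by rewrite expn0 vol_gt0.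
  rewrite expnS addnS expnS; have [//|] := leqP (K * K ^ i) (vol (4 * 4 ^ (J + i))).
  move=> h; exfalso; apply: bad; exists (J + i)%N; first by rewrite leq_addr.
  by apply: leq_trans (ltnW h) _; rewrite leq_mul2l ih orbT.
(* After cancellation the bounds read [4 ^ i <= C * 4 ^ (J * D)], which fails when [i] is the
   right-hand side itself. *)
pose i := (C * 4 ^ (J * D))%N.
have := leq_trans (step i) (growth _).
rewrite expn_gt0 => /(_ isT); rewrite /K -!expnM mulSn addnC expnD mulnDl expnD mulnA mulnC.
rewrite [(i * D)%N]mulnC leq_pmul2r ?expn_gt0//.
by rewrite leqNgt ltn_expl.
Qed.

(** Each further good scale, taken beyond the previous width, gains a factor [K / K.+1] by
    [annulus_shrink]; hence the share of the unit shell becomes arbitrarily small. *)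
Lemma annulus_decay c : exists R, forall n, (R <= n)%N ->
  ((vol n - vol (n - 1)) * K.+1 ^ c <= (vol n - vol (n - R)) * K ^ c)%N.
Proof.
elim: c => [|c [R ih]].
  by exists 1%N => n n1; rewrite !expn0.
have [j Rj jK] := good_scale R.
exists (4 * 4 ^ j)%N => n n4.
have Rr : (R <= 4 ^ j)%N by apply: leq_trans Rj _; rewrite ltnW// ltn_expl.
have {}ih := ih n; have := annulus_shrink n4 _ jK; rewrite expn_gt0 => /(_ isT).
have {ih} := ih (leq_trans Rr _); rewrite (leq_trans _ n4) ?leq_pmull// => /(_ isT).
have : (vol (n - 4 ^ j) <= vol (n - R))%N by apply: vol_le; rewrite leq_sub2l.
rewrite !expnS; move: (vol (n - 4 ^ j)) (vol (n - R)) (K ^ c)%N (K.+1 ^ c)%N => x y a b xy h1 h2.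
have h3 : ((vol n - y) * a <= (vol n - x) * a)%N by rewrite leq_mul2r leq_sub2l ?orbT.
rewrite mulnCA mulnA -[X in (_ <= X)%N]mulnCA.
by nia.
Qed.

End PolynomialGrowth.

(** * Amenability and the density of collars *)

Section Amenability.
Variable R : realType.

Lemma b_amenableE : b_amenable S R =
  ((#|` fset_set (inner_boundary S [set` ball n])|%:R / (vol n)%:R : R) @[n --> \oo] --> (0 : R)).
Proof.
rewrite /b_amenable; under eq_fun do rewrite wE WnE.
by [].
Qed.

Lemma collar_cvg m : b_amenable S R ->
  ((#|` collar n m|%:R / (vol n)%:R : R) @[n --> \oo] --> (0 : R)).
Proof.
rewrite b_amenableE => h.
have := cvgMr_tmp (b := (vol m)%:R) h; rewrite mul0r => {}h.
apply: squeeze_cvgr (h _); last exact: (cvg_cst (0 : R)).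
apply: nearW => n; rewrite divr_ge0//= mulrAC ler_wpM2r ?invr_ge0//.
by rewrite -natrM ler_nat collar_inner_boundary.
Qed.

Lemma cvgn_distP (u : nat -> R) (l : R) : (u n @[n --> \oo] --> l) <->
  (forall e, 0 < e -> exists N, forall n, (N <= n)%N -> `|u n - l| < e).
Proof.
split.
  move=> /cvgrPdist_lt h e e0; have [N _ hN] := h e e0; exists N => n Nn.
  by rewrite distrC; exact: hN.
move=> h; apply/cvgrPdist_lt => e e0; have [N hN] := h e e0; exists N => // n Nn.
by rewrite distrC; exact: hN.
Qed.

Lemma geometric_lt (q e : R) : 0 <= q < 1 -> 0 < e -> exists c, q ^+ c < e.
Proof.
move=> /andP[q0 q1] e0.
have : `|q| < 1 by rewrite ger0_norm.
move=> /cvg_expr/cvgn_distP/(_ _ e0)[N /(_ N (leqnn _))].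
by rewrite subr0 normrX ger0_norm// => ?; exists N.
Qed.

(** The real exponent is rounded up, and the finitely many radii not covered by the asymptotic bound
    go into the constant. *)
Lemma polynomial_growthP : polynomial_growth S R ->
  exists C D, forall n, (0 < n)%N -> (vol n <= C * n ^ D)%N.
Proof.
move=> [d2 d20] /eqO_exP [k k0 [N _ hN]].
pose D := `|Num.ceil d2|%N.
pose C := (`|Num.ceil k| + vol N)%N; exists C, D => n n0.
have d2D : d2 <= D%:R.
  by rewrite natr_absz ger0_norm ?ceil_ge// ?ceil_ge0 // (lt_trans _ d20)// ltrN10.
have [nN|Nn] := leqP n N.
  rewrite (leq_trans (vol_le nN))// -[X in (X <= _)%N]muln1.
  by rewrite leq_mul// ?leq_addl// expn_gt0 n0.
have := hN n (ltnW Nn); rewrite /= wE normr_nat ger0_norm ?powR_ge0// => h.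
rewrite -(ler_nat R); apply: le_trans h _; rewrite natrM ler_pM ?powR_ge0 ?(ltW k0)//.
  rewrite natrD natr_absz ger0_norm ?ceil_ge0 ?(lt_trans _ k0)//.
  by rewrite (le_trans (ceil_ge _))// lerDl.
by rewrite natrX -powR_mulrn// ler_powR// ler1n.
Qed.

(** The inner boundary lies in the outermost sphere, whose share of the ball is at most
    [(K / K.+1) ^ c] for large radii by [annulus_decay]. *)
Lemma polynomial_growth_amenable : polynomial_growth S R -> b_amenable S R.
Proof.
move=> /polynomial_growthP[C [D growth]]; rewrite b_amenableE.
apply/cvgn_distP => e e0; set K := (4 ^ D.+1)%N.
have [c hc] : exists c, (K%:R / K.+1%:R : R) ^+ c < e.
  apply: geometric_lt => //; rewrite divr_ge0//= ltr_pdivrMr ?ltr0n// mul1r.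
  by rewrite ltr_nat.
have [r hr] := annulus_decay growth c; exists r.+1 => -[//|n] rn.
rewrite subr0 ger0_norm ?divr_ge0//; apply: le_lt_trans hc.
rewrite expr_div_n ler_pdivrMr ?ltr0n ?vol_gt0// mulrAC ler_pdivlMr ?exprn_gt0 ?ltr0n//.
rewrite -!natrX -!natrM ler_nat.
have := hr n.+1 (ltnW rn); rewrite subn1 /= => h.
rewrite (leq_trans (leq_mul (inner_boundary_sphere n) (leqnn _)))//.
by rewrite (leq_trans h)// mulnC leq_mul2l leq_subr orbT.
Qed.

End Amenability.
End Graph.

(** * Random variables with all moments *)

Section Mean.
Context {d : measure_display} {T : measurableType d} {R : realType}.
Variable P : probability T R.
Implicit Types f g : T -> R.

Definition mean f : R := \int[P]_x f x.

(* Random variables all of whose moments are finite: a class closed under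
   sums and products on which [mean] is linear without side conditions. *)
Definition fmom f : Prop := measurable_fun setT f /\
  forall p : nat, P.-integrable setT (fun x => (`|f x| ^+ p)%:E).

Lemma meanE f : mean f = fine 'E_P[f].
Proof. by rewrite unlock. Qed.

Lemma fmom_le f g : measurable_fun setT f -> (forall x, `|f x| <= `|g x|) ->
  fmom g -> fmom f.
Proof.
move=> mf fg [mg gp]; split => // p; apply: le_integrable (gp p) => //.
  by apply/measurable_EFinP/measurable_funX; exact: measurableT_comp.
by move=> x _; rewrite /= lee_fin !normrX !normr_id lerXn2r ?nnegrE.
Qed.

Lemma fmom_cst c : fmom (fun _ => c).
Proof.
split; first exact: measurable_cst.
by move=> p; exact: finite_measure_integrable_cst.
Qed.

Lemma fmom_bounded f c : measurable_fun setT f -> (forall x, `|f x| <= c) -> fmom f.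
Proof.
move=> mf fc; apply: (fmom_le mf _ (fmom_cst c)) => x.
exact: le_trans (fc x) (ler_norm _).
Qed.

Lemma fmom_abs f : fmom f -> fmom (fun x => `|f x|).
Proof.
move=> fm; apply: (fmom_le _ _ fm); last by move=> x; rewrite normr_id.
by apply: measurableT_comp => //; case: fm.
Qed.

Lemma fmom_int f : fmom f -> P.-integrable setT (EFin \o f).
Proof.
move=> [mf /(_ 1%N) h]; apply: le_integrable h => //; first exact/measurable_EFinP.
by move=> x _; rewrite /= lee_fin expr1 normr_id.
Qed.

Lemma fmomD f g : fmom f -> fmom g -> fmom (fun x => f x + g x).
Proof.
move=> [mf fp] [mg gp]; split => [|p]; first exact: measurable_funD.
have hi : P.-integrable setT (fun x => (2 ^+ p * (`|f x| ^+ p + `|g x| ^+ p))%:E).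
  under eq_fun do rewrite EFinM EFinD.
  by apply: integrableZl => //; apply: integrableD.
apply: le_integrable hi => //.
  by apply/measurable_EFinP/measurable_funX/measurableT_comp => //; exact: measurable_funD.
move=> x _; rewrite /= lee_fin normrX normr_id [leRHS]ger0_norm; last first.
  by rewrite mulr_ge0 ?addr_ge0 ?exprn_ge0.
rewrite (@le_trans _ _ ((2 * Num.max `|f x| `|g x|) ^+ p))//.
  rewrite lerXn2r ?nnegrE ?mulr_ge0 ?le_max ?normr_ge0//.
  rewrite (le_trans (ler_normD _ _))// mulr2n mulrDl mul1r lerD// le_max lexx ?orbT//.
rewrite exprMn ler_wpM2l ?exprn_ge0//.
by case: (leP `|f x| `|g x|) => _; rewrite ?lerDl ?lerDr ?exprn_ge0.
Qed.

Lemma fmomM f g : fmom f -> fmom g -> fmom (fun x => f x * g x).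
Proof.
move=> [mf fp] [mg gp]; split => [|p]; first exact: measurable_funM.
have hi : P.-integrable setT (fun x => (`|f x| ^+ (p * 2) + `|g x| ^+ (p * 2))%:E).
  by under eq_fun do rewrite EFinD; apply: integrableD.
apply: le_integrable hi => //.
  by apply/measurable_EFinP/measurable_funX/measurableT_comp => //; exact: measurable_funM.
move=> x _; rewrite /= lee_fin normrX normr_id [leRHS]ger0_norm; last by rewrite addr_ge0 ?exprn_ge0.
rewrite normrM exprMn !exprM.
by have := sqr_ge0 (`|f x| ^+ p - `|g x| ^+ p);
  have := exprn_ge0 p (normr_ge0 (f x)); have := exprn_ge0 p (normr_ge0 (g x)); nra.
Qed.

Lemma fmomZ c f : fmom f -> fmom (fun x => c * f x).
Proof. by move=> ff; apply: fmomM ff; exact: fmom_cst. Qed.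

Lemma fmomN f : fmom f -> fmom (fun x => - f x).
Proof.
move=> ff; have := fmomZ (-1) ff.
by congr fmom; apply/funext => x; rewrite mulN1r.
Qed.

Lemma fmomB f g : fmom f -> fmom g -> fmom (fun x => f x - g x).
Proof. by move=> ff fg; apply: fmomD ff _; exact: fmomN. Qed.

Lemma fmomX f n : fmom f -> fmom (fun x => f x ^+ n).
Proof.
move=> ff; elim: n => [|n ih]; first exact: fmom_cst.
by under eq_fun do rewrite exprS; exact: fmomM.
Qed.

Lemma fmom_sum (I : Type) (r : seq I) (Q : pred I) (F : I -> T -> R) :
  (forall i, Q i -> fmom (F i)) -> fmom (fun x => \sum_(i <- r | Q i) F i x).
Proof.
move=> h; elim: r => [|i r ih]; first by under eq_fun do rewrite big_nil; exact: fmom_cst.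
under eq_fun do rewrite big_cons.
case Qi: (Q i) => //; apply: fmomD => //; exact: h.
Qed.

Lemma fmom_prod (I : Type) (r : seq I) (Q : pred I) (F : I -> T -> R) :
  (forall i, Q i -> fmom (F i)) -> fmom (fun x => \prod_(i <- r | Q i) F i x).
Proof.
move=> h; elim: r => [|i r ih]; first by under eq_fun do rewrite big_nil; exact: fmom_cst.
under eq_fun do rewrite big_cons.
case Qi: (Q i) => //; apply: fmomM => //; exact: h.
Qed.

Lemma mean_cst c : mean (fun _ => c) = c.
Proof. by rewrite /mean Rintegral_cst//= probability_setT mulr1. Qed.

Lemma meanD f g : fmom f -> fmom g -> mean (fun x => f x + g x) = mean f + mean g.
Proof. by move=> ff fg; apply: RintegralD => //; exact: fmom_int. Qed.

Lemma meanB f g : fmom f -> fmom g -> mean (fun x => f x - g x) = mean f - mean g.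
Proof. by move=> ff fg; apply: RintegralB => //; exact: fmom_int. Qed.

Lemma meanZ c f : fmom f -> mean (fun x => c * f x) = c * mean f.
Proof. by move=> ff; apply: RintegralZl => //; exact: fmom_int. Qed.

Lemma mean_sum (I : Type) (r : seq I) (Q : pred I) (F : I -> T -> R) :
  (forall i, Q i -> fmom (F i)) ->
  mean (fun x => \sum_(i <- r | Q i) F i x) = \sum_(i <- r | Q i) mean (F i).
Proof.
move=> h; elim: r => [|i r ih].
  by under eq_fun do rewrite big_nil; rewrite mean_cst big_nil.
under eq_fun do rewrite big_cons; rewrite big_cons -ih.
case Qi: (Q i) => //; rewrite meanD//; [exact: h|exact: fmom_sum].
Qed.

Lemma mean_sum_seq (I : eqType) (r : seq I) (F : I -> T -> R) :
  (forall i, i \in r -> fmom (F i)) ->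
  mean (fun x => \sum_(i <- r) F i x) = \sum_(i <- r) mean (F i).
Proof.
by move=> h; under eq_fun do rewrite big_seq; rewrite mean_sum// -big_seq.
Qed.

Lemma mean_le f g : fmom f -> fmom g -> (forall x, f x <= g x) -> mean f <= mean g.
Proof. by move=> ff fg h; apply: le_Rintegral => //; exact: fmom_int. Qed.

Lemma mean_ge0 f : (forall x, 0 <= f x) -> 0 <= mean f.
Proof. by move=> h; exact: Rintegral_ge0. Qed.

Lemma mean_abs f : fmom f -> `|mean f| <= mean (fun x => `|f x|).
Proof. by move=> ff; apply: le_normr_Rintegral => //; exact: fmom_int. Qed.

Lemma mean_abs_le f g : fmom f -> fmom g -> (forall x, `|f x| <= g x) -> `|mean f| <= mean g.
Proof.
by move=> ff fg h; rewrite (le_trans (mean_abs ff))// mean_le//; exact: fmom_abs.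
Qed.

Lemma mean_abs_bound f c : measurable_fun setT f -> (forall x, `|f x| <= c) -> `|mean f| <= c.
Proof.
move=> mf fc; rewrite -(mean_cst c); apply: mean_abs_le => //; last exact: fmom_cst.
exact: fmom_bounded fc.
Qed.

Lemma fmom_bool (b : T -> bool) : measurable_fun setT b -> fmom (fun x => (b x)%:R).
Proof.
move=> mb; apply: (@fmom_bounded _ 1); last by move=> x; case: (b x); rewrite ?normr0 ?normr1.
have -> : (fun x => (b x)%:R : R) = (fun x => if b x then 1 else 0).
  by apply/funext => x; case: (b x).
by apply: measurable_fun_ifT.
Qed.

Lemma mean_bool (b : T -> bool) : measurable_fun setT b ->
  (mean (fun x => (b x)%:R))%:E = P [set x | b x].
Proof.
move=> mb; have mB : measurable [set x | b x].
  by have := mb measurableT [set true] I; rewrite setTI; congr measurable; apply/seteqP; split.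
rewrite -(setIT [set x | b x]) -integral_indic// /mean /Rintegral fineK.
  by apply: eq_integral => x _; rewrite indicE mem_setE.
by apply: integrable_fin_num => //; exact: fmom_int (fmom_bool mb).
Qed.

(* A cheap substitute for the Cauchy-Schwarz inequality. *)
Lemma mean_on_bad f (b : T -> bool) lam : fmom f -> measurable_fun setT b -> 0 < lam ->
  mean (fun x => `|f x| * (b x)%:R) <=
    lam * mean (fun x => f x ^+ 2) + lam^-1 * mean (fun x => (b x)%:R).
Proof.
move=> ff mb lam0; have fb := fmom_bool mb.
have f2 := fmomX 2 ff.
rewrite -!meanZ// -meanD; [|exact: fmomZ..].
apply: mean_le; [by apply: fmomM => //; exact: fmom_abs|by apply: fmomD; exact: fmomZ|].
move=> x; case: (b x); rewrite ?mulr0 ?mulr1 ?addr0; last by rewrite mulr_ge0 ?sqr_ge0// ltW.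
rewrite -(ler_pM2l lam0) mulrDr mulfV ?gt_eqF// -real_normK ?num_real//.
by have := sqr_ge0 (lam * `|f x| - 1); have := mulr_ge0 (ltW lam0) (normr_ge0 (f x)); nra.
Qed.

Definition cov f g : R := mean (fun x => f x * g x) - mean f * mean g.

Lemma covDl f g h : fmom f -> fmom g -> fmom h ->
  cov (fun x => f x + g x) h = cov f h + cov g h.
Proof.
move=> ff fg fh; rewrite /cov meanD//; under eq_fun do rewrite mulrDl.
by rewrite meanD; [ring|exact: fmomM..].
Qed.

Lemma covZl c f h : fmom f -> fmom h -> cov (fun x => c * f x) h = c * cov f h.
Proof.
move=> ff fh; rewrite /cov meanZ//; under eq_fun do rewrite -mulrA.
by rewrite meanZ; [ring|exact: fmomM].
Qed.

Lemma covC f g : cov f g = cov g f.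
Proof. by rewrite /cov mulrC; under eq_fun do rewrite mulrC. Qed.

Lemma cov_center f g : fmom f -> fmom g ->
  cov f g = mean (fun x => (f x - mean f) * (g x - mean g)).
Proof.
move=> ff fg; rewrite /cov.
have -> : (fun x => (f x - mean f) * (g x - mean g)) =
   (fun x => f x * g x - mean g * f x - mean f * g x + mean f * mean g).
  by apply/funext => x; ring.
rewrite meanD ?meanB ?meanZ ?mean_cst//; first by ring.
all: by do ?[apply: fmomB|apply: fmomM|apply: fmomZ|apply: fmom_cst].
Qed.

Lemma covarianceE_fmom f g : fmom f -> fmom g -> covariance P f g = (cov f g)%:E.
Proof.
move=> ff fg; rewrite cov_center// covariance.unlock unlock /mean /Rintegral fineK.
  by [].
apply: integrable_fin_num => //; apply: fmom_int.
by apply: fmomM; apply: fmomB => //; exact: fmom_cst.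
Qed.

End Mean.

(** * Local functions of a clustering spin model *)

Section Config.
Variables (V : groupType).
Implicit Types (mu : config V) (A : seq V).

Lemma measurable_config (d : measure_display) (T : measurableType d) (f : T -> config V) :
  (forall x, measurable_fun setT (fun t => f t x)) -> measurable_fun setT f.
Proof.
move=> fm; apply: (@measurability _ _ T (config V) setT f (@coordinate_sets V)) => //.
move=> _ [_ [x _ <-] <-].
by have := fm x measurableT [set true] I; congr measurable; apply/seteqP; split => t.
Qed.

Lemma measurable_coord x : measurable_fun setT (fun mu : config V => mu x).
Proof.
apply: (measurable_fun_bool true).
rewrite setTI; apply: sub_sigma_algebra; by exists x.
Qed.

Definition upd mu x b : config V := fun y => if y == x then b else mu y.

Definition depends_on (U : Type) A (h : config V -> U) :=
  forall mu mu', (forall x, x \in A -> mu x = mu' x) -> h mu = h mu'.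

Lemma depends_on_upd (U : Type) A x b (h : config V -> U) :
  depends_on (x :: A) h -> depends_on A (fun mu => h (upd mu x b)).
Proof.
move=> dh mu mu' e; apply: dh => y; rewrite inE /upd; case: eqP => // _ /= yA.
exact: e.
Qed.

(** Expansion in a single spin. Iterated over a finite list of sites it reduces local functions to
    constants: for measurability, for boundedness and for covariances. *)
Lemma upd_split (U : Type) (h : config V -> U) mu x :
  h mu = if mu x then h (upd mu x true) else h (upd mu x false).
Proof.
have e b : mu x = b -> h mu = h (upd mu x b).
  by move=> <-; congr h; apply/funext => y; rewrite /upd; case: eqP => [->|].
by case E : (mu x); exact: e.
Qed.

Lemma depends_on_measurable (d : measure_display) (T : measurableType d) A (h : config V -> T) :
  depends_on A h -> measurable_fun setT h.
Proof.
elim: A h => [|x A ih] h dh.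
  have -> : h = cst (h (fun _ => false)) by apply/funext => mu; exact: dh.
  exact: measurable_cst.
have -> : h = (fun mu => if mu x then h (upd mu x true) else h (upd mu x false)).
  by apply/funext => mu; exact: upd_split.
by apply: measurable_fun_ifT; [exact: measurable_coord|apply: ih; exact: depends_on_upd..].
Qed.

End Config.

Section LocalCovariance.
Variables (R : realType) (V : groupType) (S : {fset V}).
Hypothesis cayleyS : cayley_graph S.
Variables (d : measure_display) (Omega : measurableType d).
Variables (P : probability Omega R) (X : {RV P >-> config V}).

(* The windows [W_n] with [None] standing for [n = oo]. *)
Definition inw (n : option nat) (x : V) : bool :=
  if n is Some m then x \in ball S m else true.

Definition win (n : option nat) (om : Omega) : config V := fun x => X om x && inw n x.

Lemma windowed_Some n : windowed S X (n%:R%:E : \bar R) = win (Some n).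
Proof.
apply/funext => om; apply/funext => x; rewrite /windowed /win /restrict; congr andb.
rewrite -[W _ _ _]/(Wn S R n) WnE//.
by apply/idP/idP => [/set_mem //|xn]; exact/mem_set.
Qed.

Lemma windowed_None : windowed S X (+oo%E : \bar R) = win None.
Proof.
apply/funext => om; apply/funext => x; rewrite /windowed /win /restrict; congr andb.
by apply/mem_set; rewrite /W /= leey.
Qed.

Lemma win_None om : win None om = X om.
Proof. by apply/funext => x; rewrite /win andbT. Qed.

Lemma measurable_win n : measurable_fun setT (win n).
Proof.
apply: measurable_config => x; rewrite /win.
apply: measurable_and; last exact: measurable_cst.
by apply: (measurableT_comp (measurable_coord x)); exact: measurable_funPT.
Qed.

Lemma measurable_all_win n xs : measurable_fun setT (fun om => all (win n om) xs).
Proof.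
apply: (measurableT_comp (f := fun mu : config V => all mu xs)) (measurable_win n).
apply: (@depends_on_measurable _ _ _ xs) => mu mu' e.
by apply: eq_in_all.
Qed.

Lemma fmom_dep n A (f : config V -> R) (b : R) : depends_on A f -> (forall mu, `|f mu| <= b) ->
  fmom P (fun om => f (win n om)).
Proof.
move=> df fb; apply: (@fmom_bounded _ _ _ _ _ b) => //.
exact: measurableT_comp (depends_on_measurable df) (measurable_win n).
Qed.

(** These monomials in the spins are the events that clustering controls, and they span the
    functions of finitely many spins. *)
Definition ind n (a : seq V) (om : Omega) : R := (all (win n om) a)%:R.

Lemma fmom_ind n a : fmom P (ind n a).
Proof. exact: fmom_bool (measurable_all_win _ _). Qed.

(** In one spin, [f] is [f0] plus the spin times the difference [f1]. Their bounds [b] and [2 * b]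
    add up to the factor 3 per site; [a0] collects the spins already factored out, so that the
    induction ends at the monomials [ind]. *)
Lemma cov_local_one n (h : Omega -> R) (eps : R) A a0 (f : config V -> R) (b : R) :
  fmom P h -> 0 <= b -> depends_on A f -> (forall mu, `|f mu| <= b) ->
  (forall a, {subset a <= A} -> `|cov P (ind n (a0 ++ a)) h| <= eps) ->
  `|cov P (fun om => ind n a0 om * f (win n om)) h| <= 3 ^+ size A * b * eps.
Proof.
move=> fh; elim: A a0 f b => [|x A ih] a0 f b b0 df fb heps.
  have -> : (fun om => ind n a0 om * f (win n om)) =
      (fun om => f (fun _ => false) * ind n a0 om).
    by apply/funext => om; rewrite mulrC; congr (_ * _); exact: df.
  rewrite covZl//; last exact: fmom_ind.
  rewrite normrM mul1r ler_pM//.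
  by have := heps [::]; rewrite cats0; apply.
pose f0 mu := f (upd mu x false); pose f1 mu := f (upd mu x true) - f0 mu.
have df0 : depends_on A f0 by exact: depends_on_upd.
have df1 : depends_on A f1.
  by move=> mu mu' e; rewrite /f1 (df0 _ _ e) (@depends_on_upd _ _ _ _ true _ df _ _ e).
have f0b mu : `|f0 mu| <= b by exact: fb.
have f1b mu : `|f1 mu| <= b + b by rewrite (le_trans (ler_normB _ _))// lerD.
have -> : (fun om => ind n a0 om * f (win n om)) =
    (fun om => ind n a0 om * f0 (win n om) + ind n (x :: a0) om * f1 (win n om)).
  apply/funext => om; rewrite /ind /= (upd_split f (win n om) x) /f1 /f0.
  by case: (win n om x); rewrite /= ?mul0r ?addr0// -mulrDr addrCA subrr addr0.
rewrite covDl//; last 2 first.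
- by apply: fmomM; [exact: fmom_ind|exact: fmom_dep df0 f0b].
- by apply: fmomM; [exact: fmom_ind|exact: fmom_dep df1 f1b].
have h0 := ih a0 f0 b b0 df0 f0b _.
have h1 := ih (x :: a0) f1 (b + b) (addr_ge0 b0 b0) df1 f1b _.
rewrite (le_trans (ler_normD _ _))// exprS.
rewrite (le_trans (lerD (h0 _) (h1 _)))//.
- move=> a sa; apply: heps => y /sa; rewrite inE => ->; exact: orbT.
- move=> a sa; have -> : ind n ((x :: a0) ++ a) = ind n (a0 ++ x :: a).
    by apply/funext => om; rewrite /ind /= !all_cat /= andbCA.
  apply: heps => y; rewrite !inE => /predU1P[->|/sa ->]; rewrite ?eqxx ?orbT//.
- by rewrite -subr_ge0 (_ : _ - _ = 0)//; ring.
Qed.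

Lemma cov_local n (eps : R) A B (f g : config V -> R) (bf bg : R) :
  0 <= bf -> 0 <= bg -> depends_on A f -> depends_on B g ->
  (forall mu, `|f mu| <= bf) -> (forall mu, `|g mu| <= bg) ->
  (forall a b, {subset a <= A} -> {subset b <= B} -> `|cov P (ind n a) (ind n b)| <= eps) ->
  `|cov P (fun om => f (win n om)) (fun om => g (win n om))| <=
     3 ^+ (size A + size B) * bf * bg * eps.
Proof.
move=> bf0 bg0 df dg fb gb heps.
have mg : fmom P (fun om => g (win n om)) by exact: fmom_dep dg gb.
have := @cov_local_one n (fun om => g (win n om)) (3 ^+ size B * bg * eps) A [::] f bf
  mg bf0 df fb.
have -> : (fun om => ind n [::] om * f (win n om)) = (fun om => f (win n om)).
  by apply/funext => om; rewrite mul1r.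
rewrite exprD; set q := cov _ _ _.
have -> : 3 ^+ size A * 3 ^+ size B * bf * bg * eps =
  3 ^+ size A * bf * (3 ^+ size B * bg * eps) by ring.
apply => a sa; rewrite cat0s covC.
have := @cov_local_one n (ind n a) eps B [::] g bg (fmom_ind _ _) bg0 dg gb.
have -> : (fun om => ind n [::] om * g (win n om)) = (fun om => g (win n om)).
  by apply/funext => om; rewrite mul1r.
by apply => b sb; rewrite cat0s covC; exact: heps.
Qed.

(** At sites of the window [win] and the full configuration agree, so clustering applies once
    repetitions are removed; [0 < u] makes the two lists disjoint. *)
Lemma cov_contains (C c : nat -> R) phi n (A B : seq V) u k :
  clustering S P X C c phi -> (0 < u)%N ->
  (forall x y, x \in A -> y \in B -> (u <= gdist S x y)%N) ->
  (size A + size B <= k)%N ->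
  forall a b, {subset a <= A} -> {subset b <= B} ->
  `|cov P (ind n a) (ind n b)| <= C k * phi (c k * u%:R).
Proof.
move=> [_ [C0 Cm] [c0 cm] [phi01 phim _] clus] u0 AB k_ge a b sa sb.
have c_ge0 i : 0 <= c i by exact: ltW.
have err0 : 0 <= C k * phi (c k * u%:R).
  rewrite mulr_ge0 ?(ltW (C0 _))//.
  by have /andP[] := phi01 _ (mulr_ge0 (c_ge0 k) (ler0n _ u)).
have ind_undup e : ind n e = ind n (undup e).
  apply/funext => om; rewrite /ind; congr (nat_of_bool _)%:R.
  by apply/allP/allP => h x; rewrite ?mem_undup => xe; apply: h; rewrite ?mem_undup.
(* An empty list gives the constant 1 and a site outside the window the constant 0; neither has any
   covariance. *)
have cov0 e h : fmom P h -> e = [::] \/ ~~ all (inw n) e -> cov P (ind n e) h = 0.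
  move=> fh [->|ne].
    rewrite /cov; have -> : ind n [::] = (fun _ => 1) by apply/funext.
    by rewrite mean_cst; under eq_fun do rewrite mul1r; rewrite mul1r subrr.
  rewrite /cov; have -> : ind n e = (fun _ => 0).
    apply/funext => om; rewrite /ind; case: allP => // hh; move/negP: ne; case.
    by apply/allP => x /hh /andP[].
  by rewrite mean_cst; under eq_fun do rewrite mul0r; rewrite mul0r mean_cst subrr.
rewrite (ind_undup a) (ind_undup b); set a' := undup a; set b' := undup b.
have [/cov0 ->|aok] := pselect (a' = [::] \/ ~~ all (inw n) a'); first by rewrite normr0.
  exact: fmom_ind.
have [/cov0 h|bok] := pselect (b' = [::] \/ ~~ all (inw n) b').
  by rewrite covC h ?normr0//; exact: fmom_ind.
have ok e : ~ (e = [::] \/ ~~ all (inw n) e) -> (1 <= size e)%N /\ all (inw n) e.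
  move=> h; split; last by apply: contrapT => /negP nn; apply: h; right.
  by rewrite lt0n size_eq0; apply/eqP => nn; apply: h; left.
have [a1 aw] := ok _ aok; have [b1 bw] := ok _ bok.
have indE e : all (inw n) e -> ind n e = (fun om => (all (X om) e)%:R).
  move=> ew; apply/funext => om; rewrite /ind; congr (nat_of_bool _)%:R.
  apply: eq_in_all => x xe; rewrite /win; move/allP: ew => /(_ _ xe) ->.
  by rewrite andbT.
have mX e : measurable_fun setT (fun om => all (X om) e).
  have := measurable_all_win None e; congr measurable_fun.
  by apply/funext => om; rewrite win_None.
have ab_uniq : uniq (a' ++ b').
  rewrite cat_uniq !undup_uniq andbT /=; apply/hasPn => x; rewrite !mem_undup => xb.
  apply/negP => xa; have := AB _ _ (sa _ xa) (sb _ xb).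
  by rewrite gdistxx// leqNgt u0.
have := clus a' b' a1 b1 ab_uniq.
rewrite -!mean_bool// -EFinM -EFinB/= lee_fin.
set l := `| _ |; move=> clusab.
have -> : `|cov P (ind n a') (ind n b')| = l.
  rewrite /cov /l !indE//; congr (`| mean _ _ - _|); apply/funext => om.
  by rewrite all_cat; case: (all _ a'); rewrite ?mul1r ?mul0r.
apply: le_trans clusab _.
have szk : (size a' + size b' <= k)%N.
  apply: leq_trans k_ge; apply: leq_add; apply: uniq_leq_size; rewrite ?undup_uniq//.
    by move=> x; rewrite mem_undup => /sa.
  by move=> x; rewrite mem_undup => /sb.
have ud : (u <= set_dist S [set` a'] [set` b'])%N.
  have mem1 (e : seq V) : (1 <= size e)%N -> exists x, x \in e.
    by case: e => // x e _; exists x; rewrite mem_head.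
  have [x xa] := mem1 _ a1; have [y yb] := mem1 _ b1.
  have [] := @min_natP [set gdist S x y | x in [set` a'] & y in [set` b']] (gdist S x y); first by exists x => //; exists y.
  move=> [x' /= x'a [y' /= y'b e]] _; rewrite /set_dist -e; apply: AB.
    by apply: sa; rewrite -(mem_undup a).
  by apply: sb; rewrite -(mem_undup b).
apply: ler_pM => //; [exact: ltW| |exact: Cm|].
  by have /andP[] := phi01 _ (mulr_ge0 (c_ge0 (size a' + size b')%N) (ler0n _ (set_dist S [set` a'] [set` b']))).
apply: phim; first by rewrite mulr_ge0.
by rewrite ler_pM ?ler_nat// cm.
Qed.

End LocalCovariance.

(** * Mixing of almost local random variables *)

Section Products.
Variables (R : realDomainType) (I : Type).

Lemma bigmax_expr_le (r : seq I) (a : I -> R) p : (forall i, 1 <= a i) ->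
  (\big[Num.max/1]_(i <- r) a i) ^+ p <= 1 + \sum_(i <- r) a i ^+ p.
Proof.
move=> a1; elim: r => [|i r ih]; first by rewrite !big_nil expr1n addr0.
rewrite !big_cons addrCA.
have a0 j : 0 <= a j ^+ p by rewrite exprn_ge0// (le_trans _ (a1 j)).
case: (leP (a i) _) => _; first by rewrite (le_trans ih)// lerDr.
by rewrite lerDl addr_ge0// sumr_ge0.
Qed.

(** Bounding by a power of the maximum takes the place of Hoelder's inequality for products of up to
    [p] scores. *)
Lemma prod_le_sum (r : seq I) (a : I -> R) p : (forall i, 1 <= a i) -> (size r <= p)%N ->
  \prod_(i <- r) a i <= 1 + \sum_(i <- r) a i ^+ p.
Proof.
move=> a1 rp; apply: le_trans (bigmax_expr_le r p a1).
set m := \big[Num.max/1]_(i <- r) a i.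
have m1 : 1 <= m by rewrite /m; elim/big_ind: _ => // x y x1 y1; rewrite le_max x1.
apply: (@le_trans _ _ (m ^+ size r)); last by rewrite ler_weXn2l.
rewrite /m {m m1}; elim: r {rp} => [|i r ih]; first by rewrite !big_nil.
rewrite !big_cons /= exprS.
have m1 : 1 <= \big[Num.max/1]_(i <- r) a i.
  by elim/big_ind: _ => // x y x1 y1; rewrite le_max x1.
have a0 j : 0 <= a j by rewrite (le_trans _ (a1 j)).
apply: ler_pM => //; [by apply: prodr_ge0|by rewrite le_max lexx|].
apply: (le_trans ih); rewrite lerXn2r ?nnegrE ?le_max ?lexx ?orbT// ?(le_trans _ m1)//.
by rewrite orbT.
Qed.

Lemma has_natr_le (r : seq I) (b : I -> bool) : (has b r)%:R <= \sum_(i <- r) (b i)%:R :> R.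
Proof.
elim: r => [|i r ih]; first by rewrite big_nil.
rewrite big_cons /=; case: (b i); rewrite /= ?add0r// lerDl sumr_ge0//.
Qed.

Lemma prod_if (r : seq I) (b : I -> bool) (a : I -> R) :
  \prod_(i <- r) (if b i then a i else 0) = (all b r)%:R * \prod_(i <- r) a i.
Proof.
elim: r => [|i r ih]; first by rewrite !big_nil mul1r.
by rewrite !big_cons ih /=; case: (b i); rewrite /= ?mul0r// mulrCA.
Qed.

End Products.

Section Localization.
Variables (R : realType) (V : groupType) (S : {fset V}).
Hypothesis cayleyS : cayley_graph S.
Variables (d : measure_display) (Omega : measurableType d).
Variables (P : probability Omega R) (X : {RV P >-> config V}).

Definition nbh (x : V) (t : nat) : seq V := [seq (x * y)%g | y <- ball S t].

Lemma mem_nbh x t y : (y \in nbh x t) = (gdist S x y <= t)%N.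
Proof.
apply/mapP/idP => [[z zt ->]|xy].
  by rewrite gdistE// mulKg -mem_ball.
by exists (x^-1 * y)%g; rewrite ?mulVKg// mem_ball// -gdistE.
Qed.

Lemma size_nbh x t : size (nbh x t) = vol S t.
Proof. by rewrite size_map. Qed.

(* On an event of probability at least [1 - lam ^+ 2], decided by the spins
   within distance [t] of [x], [f] is a function of these spins bounded by [B]. *)
Definition localized n t (B lam : R) (x : V) (f : Omega -> R) : Prop :=
  exists (G : config V -> bool) (h : config V -> R),
  [/\ f = (fun om => h (win S X n om)),
      depends_on (nbh x t) G,
      depends_on (nbh x t) (fun mu => if G mu then h mu else 0),
      (forall mu, G mu -> `|h mu| <= B)
    & mean P (fun om => (~~ G (win S X n om))%:R) <= lam ^+ 2].

Lemma depends_on_sub (U : Type) (A B : seq V) (h : config V -> U) :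
  {subset A <= B} -> depends_on A h -> depends_on B h.
Proof. by move=> AB dh mu mu' e; apply: dh => x /AB; exact: e. Qed.

Lemma depends_on_prod (I : Type) (r : seq I) (A : I -> seq V) (h : I -> config V -> R) :
  (forall i, depends_on (A i) (h i)) ->
  depends_on (flatten [seq A i | i <- r]) (fun mu => \prod_(i <- r) h i mu).
Proof.
move=> dh mu mu'; elim: r => [|i r ih] e; first by rewrite !big_nil.
rewrite !big_cons; congr (_ * _).
  by apply: dh => x xA; apply: e; rewrite /= mem_cat xA.
by apply: ih => x xA; apply: e; rewrite /= mem_cat xA orbT.
Qed.

(** The first factor is the cost of truncating one product, from second moments and failure
    probabilities. The second accounts for the three truncations in a covariance, two of them
    weighted by the bound [2 + p%:R * M] on first absolute moments. *)
Definition loc_const (p : nat) (M : R) : R :=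
  (1 + p%:R * M + p%:R) * (1 + 2 * (2 + p%:R * M)).

Section Family.
Variables (I : eqType) (x_ : I -> V) (f_ : I -> Omega -> R).
Variables (n : option nat) (t p : nat) (B lam M : R).
Hypotheses (B1 : 1 <= B) (lam0 : 0 < lam).
Hypothesis (loc : forall i, localized n t B lam (x_ i) (f_ i)).
Hypothesis (ff : forall i, fmom P (f_ i)).
Hypothesis (fM : forall i, mean P (fun om => (1 + f_ i om ^+ 2) ^+ p) <= M).

Lemma prod_second_moment (r : seq I) : (size r <= p)%N ->
  mean P (fun om => (\prod_(i <- r) f_ i om) ^+ 2) <= 1 + (size r)%:R * M.
Proof.
move=> rp.
have fm i : fmom P (fun om => (1 + f_ i om ^+ 2) ^+ p).
  by apply/fmomX/fmomD; [exact: fmom_cst|exact: fmomX].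
apply: (@le_trans _ _ (mean P (fun om => 1 + \sum_(i <- r) (1 + f_ i om ^+ 2) ^+ p))).
  apply: mean_le.
  - by apply/fmomX/fmom_prod => i _.
  - by apply: fmomD; [exact: fmom_cst|apply: fmom_sum => i _; exact: fm].
  - move=> om; rewrite -prodrXl.
    have h i : 1 <= 1 + f_ i om ^+ 2 by rewrite lerDl sqr_ge0.
    apply: le_trans (prod_le_sum h rp).
    by apply: ler_prod => i _; rewrite sqr_ge0 lerDr ler01.
rewrite meanD; [|exact: fmom_cst|by apply: fmom_sum => i _; exact: fm].
rewrite mean_cst lerD2l mean_sum//.
by rewrite (le_trans (ler_sum _ (fun i _ => fM i)))// big_const_seq count_predT iter_addr addr0 mulr_natl.
Qed.

(** Setting each factor to 0 off its good event leaves bounded functions of at most [p * vol S t]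
    spins, to which [cov_local] and clustering apply. The means change by the order of [lam]: in
    [mean_on_bad] the failure probability, of order [lam ^ 2], is divided by [lam]. *)
Lemma localized_cov (C c : nat -> R) phi (ps qs : seq I) u :
  clustering S P X C c phi -> (0 < u)%N -> 0 <= M -> (size ps + size qs <= p)%N ->
  (forall i j, i \in ps -> j \in qs -> (2 * t + u <= gdist S (x_ i) (x_ j))%N) ->
  `|cov P (fun om => \prod_(i <- ps) f_ i om) (fun om => \prod_(j <- qs) f_ j om)| <=
    loc_const p M * lam +
    3 ^+ (p * vol S t) * B ^+ p * (C (p * vol S t)%N * phi (c (p * vol S t)%N * u%:R)).
Proof.
move=> clus u0 M0 szp sep.
have szps : (size ps <= p)%N by rewrite (leq_trans _ szp)// leq_addr.
have szqs : (size qs <= p)%N by rewrite (leq_trans _ szp)// leq_addl.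
have /choice [G /choice [h Gh]] := loc.
have fE i om : f_ i om = h i (win S X n om) by have [-> _ _ _ _] := Gh i.
have dG i : depends_on (nbh (x_ i) t) (G i) by have [] := Gh i.
pose ht i mu := if G i mu then h i mu else 0.
have dh i : depends_on (nbh (x_ i) t) (ht i) by have [] := Gh i.
have hB i mu : `|ht i mu| <= B.
  by rewrite /ht; case: ifP => [|_]; [have [_ _ _ + _] := Gh i; exact|rewrite normr0 (le_trans ler01)].
pose gd i om := G i (win S X n om).
have mgd i : measurable_fun setT (gd i).
  exact: measurableT_comp (depends_on_measurable (dG i)) (measurable_win _ _ _).
pose bad (r : seq I) om := has (fun i => ~~ gd i om) r.
have mbad r : measurable_fun setT (bad r).
  rewrite /bad; elim: r => [|i r ih] /=; first exact: measurable_cst.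
  by apply: measurable_or => //; exact: measurable_neg.
have Ebad r : (size r <= p)%N -> mean P (fun om => (bad r om)%:R) <= p%:R * lam ^+ 2.
  move=> rp.
  apply: (@le_trans _ _ (mean P (fun om => \sum_(i <- r) (~~ gd i om)%:R))).
    apply: mean_le; [exact: fmom_bool| |by move=> om; exact: has_natr_le].
    by apply: fmom_sum => i _; apply: fmom_bool; exact: measurable_neg.
  rewrite mean_sum; last by move=> i _; apply: fmom_bool; exact: measurable_neg.
  have hl i : mean P (fun om => (~~ gd i om)%:R) <= lam ^+ 2 by have [] := Gh i.
  rewrite (le_trans (ler_sum _ (fun i _ => hl i)))// big_const_seq count_predT iter_addr addr0.
  by rewrite -[leLHS]mulr_natl ler_wpM2r ?sqr_ge0// ler_nat.
pose F (r : seq I) om := \prod_(i <- r) f_ i om.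
pose Ft (r : seq I) mu := \prod_(i <- r) ht i mu.
have fF r : fmom P (F r) by apply: fmom_prod => i _.
have FtE r om : Ft r (win S X n om) = (~~ bad r om)%:R * F r om.
  rewrite /Ft /ht prod_if /bad -all_predC; congr (_%:R * _); first last.
    by apply: eq_bigr => i _; rewrite fE.
  by congr nat_of_bool; apply: eq_all => i /=; rewrite /gd negbK.
have fFt r : fmom P (fun om => Ft r (win S X n om)).
  under eq_fun do rewrite FtE; apply: fmomM => //; apply: fmom_bool; exact: measurable_neg.
have Ft_le r om : `|Ft r (win S X n om)| <= `|F r om|.
  by rewrite FtE normrM; case: (bad r om); rewrite /= ?normr0 ?mul0r// normr1 mul1r.
pose D := (1 + p%:R * M + p%:R) * lam.
have E2 r : (size r <= p)%N -> mean P (fun om => F r om ^+ 2) <= 1 + p%:R * M.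
  move=> rp; by rewrite (le_trans (prod_second_moment rp))// lerD2l ler_wpM2r// ler_nat.
have Ediff r : (size r <= p)%N -> `|mean P (F r) - mean P (fun om => Ft r (win S X n om))| <= D.
  move=> rp; rewrite -meanB//.
  apply: (@le_trans _ _ (mean P (fun om => `|F r om| * (bad r om)%:R))).
    apply: mean_abs_le; [exact: fmomB| |].
      by apply: fmomM; [exact: fmom_abs|exact: fmom_bool].
    move=> om; rewrite FtE; case: (bad r om); rewrite /= ?mul0r ?subr0 ?mulr1//.
    by rewrite mul1r subrr normr0 mulr0.
  rewrite (le_trans (mean_on_bad (fF r) (mbad r) lam0))//.
  rewrite /D mulrDl mulrC lerD// ?ler_wpM2r ?(ltW lam0) ?E2//.
  rewrite (le_trans (ler_wpM2l _ (Ebad r rp))) ?invr_ge0 ?(ltW lam0)//.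
  by rewrite mulrCA expr2 mulKf ?gt_eqF.
have Eabs r : (size r <= p)%N -> mean P (fun om => `|F r om|) <= 2 + p%:R * M.
  move=> rp; apply: (@le_trans _ _ (mean P (fun om => 1 + F r om ^+ 2))).
    apply: mean_le; [exact: fmom_abs|by apply: fmomD; [exact: fmom_cst|exact: fmomX]|].
    by move=> om; rewrite -real_normK ?num_real//; have := sqr_ge0 (`|F r om| - 1); nra.
  rewrite meanD ?mean_cst; [|exact: fmom_cst|exact: fmomX].
  by have := E2 r rp; lra.
have Fcat om : F (ps ++ qs) om = F ps om * F qs om by rewrite /F big_cat.
have Ftcat mu : Ft (ps ++ qs) mu = Ft ps mu * Ft qs mu by rewrite /Ft big_cat.
have szcat : (size (ps ++ qs) <= p)%N by rewrite size_cat.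
have main : `|cov P (fun om => Ft ps (win S X n om)) (fun om => Ft qs (win S X n om))| <=
   3 ^+ (p * vol S t) * B ^+ p * (C (p * vol S t)%N * phi (c (p * vol S t)%N * u%:R)).
  pose A (r : seq I) := flatten [seq nbh (x_ i) t | i <- r].
  have szA r : size (A r) = (size r * vol S t)%N.
    rewrite size_flatten /shape -map_comp sumnE big_map.
    rewrite (eq_bigr (fun _ => vol S t)) => [|i _]; last by rewrite /= size_nbh.
    by rewrite big_const_seq count_predT iter_addn_0 mulnC.
  have szAA : (size (A ps) + size (A qs) <= p * vol S t)%N.
    by rewrite !szA -mulnDl leq_mul2r szp orbT.
  have FtB r mu : `|Ft r mu| <= B ^+ size r.
    rewrite /Ft normr_prod; apply: (@le_trans _ _ (\prod_(i <- r) B)).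
      by apply: ler_prod => i _; rewrite normr_ge0 hB.
    by rewrite big_const_seq count_predT -Monoid.iteropE.
  have dF r : depends_on (A r) (Ft r) by exact: depends_on_prod.
  have AA y z : y \in A ps -> z \in A qs -> (u <= gdist S y z)%N.
    move=> /flattenP[_ /mapP[i ir ->]]; rewrite mem_nbh => yi.
    move=> /flattenP[_ /mapP[j jr ->]]; rewrite mem_nbh => zj.
    have := sep i j ir jr; have := gdist_triangle cayleyS y (x_ i) (x_ j).
    have := gdist_triangle cayleyS z y (x_ j); rewrite (gdistC cayleyS z (x_ j)) => h1 h2 h3.
    by rewrite -(leq_add2l (2 * t)) (leq_trans h3)// (leq_trans h2)// mul2n -addnn -addnA leq_add// addnC (leq_trans h1)// leq_add2l.
  have B0 : 0 <= B by rewrite (le_trans ler01).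
  have := cov_local (exprn_ge0 _ B0) (exprn_ge0 _ B0) (dF ps) (dF qs) (FtB ps) (FtB qs)
    (@cov_contains R V S cayleyS d Omega P X C c phi n _ _ u _ clus u0 AA szAA).
  move=> /le_trans; apply.
  rewrite -(mulrA (3 ^+ _)) -exprD; case: clus => _ [C0 _] [c0 _] [phi01 _ _] _.
  have e0 : 0 <= C (p * vol S t)%N * phi (c (p * vol S t)%N * u%:R).
    rewrite mulr_ge0 ?(ltW (C0 _))//.
    by have /andP[] := phi01 _ (mulr_ge0 (ltW (c0 (p * vol S t)%N)) (ler0n _ u)).
  apply: ler_wpM2r => //; apply: ler_pM; rewrite ?exprn_ge0//.
    by rewrite ler_weXn2l ?ler1n.
  by rewrite ler_weXn2l.
(* The covariance is telescoped into the truncated one, a truncation error of the joint mean and one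
   for each marginal. *)
rewrite (_ : cov _ _ _ = cov P (fun om => Ft ps (win S X n om)) (fun om => Ft qs (win S X n om)) +
  ((mean P (F (ps ++ qs)) - mean P (fun om => Ft (ps ++ qs) (win S X n om))) -
   ((mean P (F ps) - mean P (fun om => Ft ps (win S X n om))) * mean P (F qs) +
    mean P (fun om => Ft ps (win S X n om)) * (mean P (F qs) - mean P (fun om => Ft qs (win S X n om)))))); last first.
  rewrite /cov; have -> : F (ps ++ qs) = (fun om => F ps om * F qs om) by apply/funext.
  have -> : (fun om => Ft (ps ++ qs) (win S X n om)) = (fun om => Ft ps (win S X n om) * Ft qs (win S X n om)).
    by apply/funext => om; rewrite Ftcat.
  by rewrite /F; ring.
rewrite (le_trans (ler_normD _ _))// addrC lerD//.
rewrite (le_trans (ler_normB _ _))//.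
have -> : loc_const p M * lam = D + D * (2 + p%:R * M) + (2 + p%:R * M) * D.
  by rewrite /loc_const /D; ring.
rewrite -addrA lerD ?Ediff// (le_trans (ler_normD _ _))// !normrM lerD//.
  apply: ler_pM; rewrite ?normr_ge0 ?Ediff//.
  by rewrite (le_trans (mean_abs (fF qs)))// Eabs.
apply: ler_pM; rewrite ?normr_ge0 ?Ediff//.
rewrite (le_trans (mean_abs (fFt ps)))// (le_trans _ (Eabs ps szps))//.
by apply: mean_le => //; exact: fmom_abs.
Qed.

End Family.
End Localization.

(** * Moments of sums of mixing fields *)

Section Components.
Variables (m : nat) (e : rel 'I_m.+2).
Hypothesis symE : symmetric e.
Hypothesis no_isolated : forall i, exists2 j, j != i & e i j.
Hypothesis no_isolated_pair : forall j, j != ord0 ->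
  exists2 l, (l != ord0) && (l != j) & e ord0 l || e j l.

Let csym : connect_sym e. Proof. exact: sym_connect_sym. Qed.

(** Every component contains its root and a neighbour of it, and the component of [ord0] also a
    third point, since no pair with [ord0] is isolated. The extra 1 is what makes the clumped
    configurations too few. *)
Lemma roots_card : (2 * #|roots e| + 1 <= m.+2)%N.
Proof.
have /choice [b hb] : forall i, exists j, j != i /\ e i j.
  by move=> i; have [j] := no_isolated i; exists j.
have rb i : fingraph.root e (b i) = fingraph.root e i.
  by apply/esym/eqP; rewrite root_connect//; apply: connect1; have [] := hb i.
have rootsP i : reflect (fingraph.root e i = i) (i \in roots e) by exact: eqP.
have binj : {in roots e &, injective b}.
  by move=> i j /rootsP ri /rootsP rj ij; rewrite -ri -rj -(rb i) -(rb j) ij.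
pose B := [set b i | i in roots e]%SET.
have cB : #|B| = #|roots e| by rewrite card_in_imset.
pose Rt := [set i in roots e]%SET.
have dB : (Rt :&: B)%SET = finset.set0.
  apply/setP => i; rewrite !inE; apply/negbTE/negP => /andP[/rootsP ri /imsetP[j /rootsP rj ij]].
  have [ji _] := hb j; move: ji; rewrite -ij -ri ij rb rj => /eqP; by apply.
have [z zr zB] : exists2 z, z \notin roots e & z \notin B.
  have [j j0 ej] := no_isolated ord0.
  have [l /andP[l0 lj] el] := no_isolated_pair j0.
  have rj : fingraph.root e j = fingraph.root e ord0 by apply/esym/eqP; rewrite root_connect// connect1.
  have rl : fingraph.root e l = fingraph.root e ord0.
    by case/orP: el => h; [|rewrite -rj]; apply/esym/eqP; rewrite root_connect// connect1.
  have inB z : fingraph.root e z = fingraph.root e ord0 -> z \in B -> z = b (fingraph.root e ord0).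
    by move=> zr /imsetP[i /rootsP ri zi]; rewrite -zr zi rb ri.
  have inR z : fingraph.root e z = fingraph.root e ord0 -> z \in roots e -> z = fingraph.root e ord0.
    by move=> <- /rootsP.
  apply: contrapT => nz.
  have all3 z : fingraph.root e z = fingraph.root e ord0 -> z = fingraph.root e ord0 \/ z = b (fingraph.root e ord0).
    move=> zr; have [/inR|zR] := boolP (z \in roots e); first by left; auto.
    have [/inB|zB] := boolP (z \in B); first by right; auto.
    by exfalso; apply: nz; exists z.
  have := all3 ord0 erefl; have := all3 j rj; have := all3 l rl.
  move: j0 l0 lj; move: (fingraph.root e ord0) (b _) => u v.
  move=> j0 l0 lj [] hl [] hj [] h0; move: j0 l0 lj; rewrite ?hl ?hj ?{1}h0 ?eqxx//.
  all: try by rewrite -h0 eqxx.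
  all: try by rewrite h0 eqxx.
have : (#|(z |: (Rt :|: B))%SET| <= m.+2)%N.
  by rewrite -[X in (_ <= X)%N]card_ord max_card.
rewrite cardsU1 !inE negb_or zr zB /= cardsU dB cards0 subn0 cB.
by rewrite /Rt cardsE add1n addn1 mul2n addnn.
Qed.

Lemma card_roots_half : (#|roots e| <= m.+1./2)%N.
Proof. by have := roots_card; lia. Qed.

End Components.

(** * The moment recursion in one window *)

Section MomentRecursion.
Variables (R : realType) (V : groupType) (S : {fset V}).
Hypothesis cayleyS : cayley_graph S.
Variables (d : measure_display) (Omega : measurableType d) (P : probability Omega R).
Variables (Y : V -> Omega -> R) (n m s : nat) (Q delta : R).
Hypothesis fY : forall x, fmom P (Y x).
Hypothesis Y0 : forall x, x \in ball S n -> mean P (Y x) = 0.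
Hypothesis (Q1 : 1 <= Q) (delta0 : 0 <= delta).
Hypothesis momQ : forall r, (size r <= m.+2)%N -> {subset r <= ball S n} ->
  `|mean P (fun om => \prod_(x <- r) Y x om)| <= Q.
Hypothesis mixing : forall xs ys, (size xs + size ys <= m.+2)%N ->
  {subset xs <= ball S n} -> {subset ys <= ball S n} ->
  (forall x y, x \in xs -> y \in ys -> (s < gdist S x y)%N) ->
  `|cov P (fun om => \prod_(x <- xs) Y x om) (fun om => \prod_(y <- ys) Y y om)| <= delta.

Notation T := (ball S n).
Notation I := 'I_m.+2.

Definition total (om : Omega) : R := \sum_(x <- ball S n) Y x om.

Lemma fmom_total : fmom P total.
Proof. by apply: fmom_sum => x _; exact: fY. Qed.

Lemma totalE om : total om = \sum_(x : T) Y (val x) om.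
Proof. by rewrite /total big_seq_fsetE. Qed.

Definition pY (A : pred I) (x : {ffun I -> T}) (om : Omega) : R :=
  \prod_(i | A i) Y (val (x i)) om.

Lemma fmom_pY A x : fmom P (pY A x).
Proof. by apply: fmom_prod => i _; exact: fY. Qed.

Lemma pYE A x om : pY A x om = \prod_(y <- [seq val (x i) | i <- enum A]) Y y om.
Proof. by rewrite big_map big_enum /pY; apply: eq_bigl => i. Qed.

(** For two independent outcomes [om] and [om'] the sum over all configurations is a product over
    indices of sums over sites; the two means are then taken one after the other. *)
Lemma sum_mean_split (A : pred I) :
  \sum_(x : {ffun I -> T}) mean P (pY A x) * mean P (pY (predC A) x) =
  mean P (fun om => total om ^+ #|A|) * mean P (fun om => total om ^+ #|predC A|).
Proof.
have e om om' : \sum_(x : {ffun I -> T}) pY A x om * pY (predC A) x om' =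
    total om ^+ #|A| * total om' ^+ #|predC A|.
  transitivity (\prod_(i : I) \sum_(t : T) Y (val t) (if A i then om else om')).
    rewrite bigA_distr_bigA; apply: eq_bigr => x _.
    rewrite [RHS](bigID A)/= /pY; congr (_ * _); first by apply: eq_bigr => i ->.
    by apply: eq_bigr => i /negbTE ->.
  rewrite (bigID A)/= -!prodr_const; congr (_ * _).
    by apply: eq_big => [i|i ->]; rewrite ?inE// -totalE.
  by apply: eq_big => [i|i /negbTE ->]; rewrite ?inE// -totalE.
have step om : \sum_(x : {ffun I -> T}) pY A x om * mean P (pY (predC A) x) =
    total om ^+ #|A| * mean P (fun om => total om ^+ #|predC A|).
  rewrite -meanZ; last exact: fmomX fmom_total.
  rewrite -(eq_bigr _ (fun x _ => meanZ _ (fmom_pY _ x))) -mean_sum.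
    by congr mean; apply/funext => om'; exact: e.
  by move=> x _; apply: fmomZ; exact: fmom_pY.
rewrite -(eq_bigr _ (fun x _ => mulrC _ _)) -(eq_bigr _ (fun x _ => meanZ _ (fmom_pY _ x))).
rewrite -mean_sum; last by move=> x _; apply: fmomZ; exact: fmom_pY.
rewrite mulrC -meanZ; last exact: fmomX fmom_total.
congr mean; apply/funext => om; rewrite mulrC -step.
by apply: eq_bigr => x _; rewrite mulrC.
Qed.

Lemma sum_mean_all :
  \sum_(x : {ffun I -> T}) mean P (pY predT x) = mean P (fun om => total om ^+ m.+2).
Proof.
have := sum_mean_split predT.
have -> : #|predC (predT : pred I)| = 0%N by apply: eq_card0.
have -> : #|predT : pred I| = m.+2 by rewrite -[RHS]card_ord; apply: eq_card.
under [X in _ * mean P X]eq_fun do rewrite expr0.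
rewrite mean_cst mulr1 => <-; apply: eq_bigr => x _.
have -> : pY (predC predT) x = (fun _ => 1) by apply/funext => om; rewrite /pY big_pred0.
by rewrite mean_cst mulr1.
Qed.

Lemma pYU (A B : pred I) (x : {ffun I -> T}) om : (forall i, A i -> ~~ B i) ->
  pY (predU A B) x om = pY A x om * pY B x om.
Proof.
move=> dAB; rewrite /pY (bigID A)/=; congr (_ * _); apply: eq_bigl => i /=.
  by case: (A i); rewrite ?andbT ?andbF.
by have := dAB i; case: (A i); case: (B i) => // /(_ isT).
Qed.

Lemma total_mix (A B : pred I) (x : {ffun I -> T}) : (forall i, A i -> ~~ B i) ->
  (forall i j, A i -> B j -> (s < gdist S (val (x i)) (val (x j)))%N) ->
  `|mean P (pY (predU A B) x) - mean P (pY A x) * mean P (pY B x)| <= delta.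
Proof.
move=> dAB sep.
have sub (C : pred I) : {subset [seq val (x i) | i <- enum C] <= ball S n}.
  by move=> y /mapP[i _ ->]; exact: valP.
have := @mixing [seq val (x i) | i <- enum A] [seq val (x i) | i <- enum B].
rewrite !size_map -!cardE => /(_ _ (sub A) (sub B)) h.
have {h} := h _ _; rewrite /cov.
set F := (fun om => _ * _).
have -> : F = pY (predU A B) x by apply/funext => om; rewrite pYU// /F !pYE.
have -> : (fun om => \prod_(y <- [seq val (x i) | i <- enum A]) Y y om) = pY A x.
  by apply/funext => om; rewrite pYE.
have -> : (fun om => \prod_(y <- [seq val (x i) | i <- enum B]) Y y om) = pY B x.
  by apply/funext => om; rewrite pYE.
apply.
  have AB0 : #|[predI A & B]| = 0%N.
    by apply: eq_card0 => i; rewrite !inE; apply/negP => /andP[/dAB/negP].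
  rewrite -cardUI AB0 addn0 -[X in (_ <= X)%N]card_ord; exact: max_card.
move=> y z /mapP[i]; rewrite mem_enum => Ai -> /mapP[j]; rewrite mem_enum => Bj ->.
exact: sep.
Qed.

Lemma mean_pY_le A x : `|mean P (pY A x)| <= Q.
Proof.
have -> : pY A x = (fun om => \prod_(y <- [seq val (x i) | i <- enum A]) Y y om).
  by apply/funext => om; rewrite pYE.
apply: momQ; last by move=> y /mapP[i _ ->]; exact: valP.
by rewrite size_map -cardE -[X in (_ <= X)%N]card_ord max_card.
Qed.

Lemma isolated_small (A : pred I) l (x : {ffun I -> T}) : A l ->
  (forall j, j != l -> (s < gdist S (val (x l)) (val (x j)))%N) ->
  `|mean P (pY A x)| <= delta.
Proof.
move=> Al iso.
have := @total_mix (pred1 l) (predD1 A l) x.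
have -> : pY (predU (pred1 l) (predD1 A l)) x = pY A x.
  by apply/funext => om; apply: eq_bigl => i /=; case: eqP => [->|]; rewrite ?Al.
have -> : pY (pred1 l) x = Y (val (x l)) by apply/funext => om; rewrite /pY big_pred1_eq.
rewrite Y0 ?mul0r ?subr0; last exact: valP.
apply; last by move=> i j /= /eqP -> /andP[jl _]; exact: iso.
by move=> i /= /eqP ->; rewrite eqxx.
Qed.

Lemma card_neq_ord0 : #|(fun i : I => i != ord0)| = m.+1.
Proof. by transitivity #|predC1 (ord0 : I)|; [exact: eq_card|rewrite cardC1 card_ord]. Qed.

Definition pair (j : I) : pred I := pred2 ord0 j.

(** The product is compared with the Wick pairings of its first point; summed over all
    configurations this is the error in the Gaussian recursion. *)
Definition defect (x : {ffun I -> T}) : R :=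
  mean P (pY predT x) -
  \sum_(j | j != ord0) mean P (pY (pair j) x) * mean P (pY (predC (pair j)) x).

Lemma sum_defect : \sum_(x : {ffun I -> T}) defect x =
  mean P (fun om => total om ^+ m.+2) -
  m.+1%:R * (mean P (fun om => total om ^+ 2) * mean P (fun om => total om ^+ m)).
Proof.
rewrite /defect sumrB sum_mean_all; congr (_ - _).
rewrite exchange_big /= (eq_bigr (fun _ =>
  mean P (fun om => total om ^+ 2) * mean P (fun om => total om ^+ m))); last first.
  move=> j j0; rewrite sum_mean_split.
  have c2 : #|pair j| = 2%N by rewrite /pair card2 eq_sym j0.
  have e : (#|pair j| + #|predC (pair j)| = #|{: I}|)%N := cardC (pair j).
  by rewrite c2 card_ord in e; rewrite c2; have -> : #|predC (pair j)| = m by lia.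
by rewrite sumr_const card_neq_ord0 -[LHS]mulr_natl.
Qed.

Definition near (x : {ffun I -> T}) : rel I := fun i j => (gdist S (val (x i)) (val (x j)) <= s)%N.

(* In a configuration which is not clumped either some point is isolated at
   scale [s], or [x 0] and some [x j] form an isolated pair: by mixing the
   defect is then negligible.  In a clumped one the points form at most
   [m.+1./2] clusters. *)
Definition clumped (x : {ffun I -> T}) : bool :=
  [forall i, [exists j, (j != i) && near x i j]] &&
  [forall j, (j != ord0) ==> [exists l, [&& l != ord0, l != j & near x ord0 l || near x j l]]].

Lemma defect_small x : ~~ clumped x -> `|defect x| <= delta + m.+1%:R * (Q * delta).
Proof.
have Q0 : 0 <= Q by rewrite (le_trans ler01).
have sum_le (F : I -> R) : (forall j, j != ord0 -> `|F j| <= Q * delta) ->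
    `|\sum_(j | j != ord0) F j| <= m.+1%:R * (Q * delta).
  move=> h; rewrite (le_trans (ler_norm_sum _ _ _))// (le_trans (ler_sum _ h))//.
  rewrite sumr_const -[leLHS]mulr_natl ler_wpM2r ?mulr_ge0// ler_nat.
  by rewrite card_neq_ord0.
have gC i j : near x i j = near x j i by rewrite /near gdistC.
rewrite negb_and => /orP[/forallPn[l]|/forallPn[j0]].
  (* The isolated [l] belongs to the pair or to its complement; that factor is at most [delta], and
     the other one at most [Q]. *)
  rewrite negb_exists => /forallP iso.
  have {}iso j : j != l -> (s < gdist S (val (x l)) (val (x j)))%N.
    by move=> jl; have := iso j; rewrite jl /= -ltnNge.
  rewrite (le_trans (ler_normB _ _))// lerD//; first exact: (@isolated_small _ l).
  apply: sum_le => j j_0; rewrite normrM.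
  have [lp|lp] := boolP (pair j l).
    by rewrite mulrC ler_pM// ?mean_pY_le// (@isolated_small _ l).
  by rewrite ler_pM// ?mean_pY_le// (@isolated_small _ l).
rewrite negb_imply => /andP[j00]; rewrite negb_exists => /forallP iso.
have {}iso l : l != ord0 -> l != j0 -> ~~ near x ord0 l && ~~ near x j0 l.
  by move=> l0 lj; have := iso l; rewrite l0 lj /= negb_or.
(* The term of [j0] cancels the full mean up to [delta]. In any other term [ord0] and [j] are far
   apart, so the mean over the pair is itself at most [delta]. *)
rewrite /defect (bigD1 j0)//= opprD addrA (le_trans (ler_normB _ _))//.
apply: lerD.
  have := @total_mix (pair j0) (predC (pair j0)) x.
  have -> : pY (predU (pair j0) (predC (pair j0))) x = pY predT x.
    by apply/funext => om; apply: eq_bigl => i /=; rewrite orbN.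
  apply; first by move=> i /= ->.
  move=> i l /= ip; rewrite negb_or => /andP[l0 lj].
  by have /andP[h1 h2] := iso l l0 lj; case/orP: ip => /eqP ->; rewrite ltnNge.
rewrite (le_trans (ler_norm_sum _ _ _))//.
rewrite (@le_trans _ _ (\sum_(j | j != (ord0 : I)) Q * delta))//; last first.
  rewrite sumr_const -[leLHS]mulr_natl ler_wpM2r ?mulr_ge0// ler_nat.
  by rewrite card_neq_ord0.
rewrite [leRHS](bigD1 j0)//= -[leLHS]add0r lerD ?mulr_ge0//.
apply: ler_sum => j /andP[j_0 jj]; rewrite normrM mulrC ler_pM// ?mean_pY_le//.
have := @total_mix (pred1 ord0) (pred1 j) x.
have -> : pY (predU (pred1 ord0) (pred1 j)) x = pY (pair j) x by [].
have -> : pY (pred1 (ord0 : I)) x = Y (val (x ord0)) by apply/funext => om; rewrite /pY big_pred1_eq.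
rewrite Y0 ?mul0r ?subr0; last exact: valP.
apply; first by move=> i /= /eqP ->; rewrite eq_sym.
move=> i l /= /eqP -> /eqP ->.
by have /andP[] := iso j j_0 jj; rewrite /near -ltnNge.
Qed.

Lemma defect_le x : `|defect x| <= Q + m.+1%:R * (Q * Q).
Proof.
have Q0 : 0 <= Q by rewrite (le_trans ler01).
rewrite (le_trans (ler_normB _ _))// lerD ?mean_pY_le//.
rewrite (le_trans (ler_norm_sum _ _ _))//.
rewrite (@le_trans _ _ (\sum_(j | j != (ord0 : I)) Q * Q))//.
  by apply: ler_sum => j _; rewrite normrM ler_pM ?mean_pY_le.
rewrite sumr_const -[leLHS]mulr_natl ler_wpM2r ?mulr_ge0// ler_nat.
by rewrite card_neq_ord0.
Qed.

(** A clumped configuration is recovered from the component of each point, the sites of the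
    component roots and the displacement of each point from its root, which a simple path bounds by
    [m.+2 * s]. *)
Lemma clumped_card :
  (#|clumped| <= m.+1./2 ^ m.+2 * (vol S n ^ m.+1./2 * vol S (m.+2 * s) ^ m.+2))%N.
Proof.
pose D := (m.+2 * s)%N.
pose r := m.+1./2.
have t0 : T by exists 1%g; exact: ball1.
pose Psi (q : {ffun I -> 'I_r} * ({ffun 'I_r -> T} * {ffun I -> ball S D})) : {ffun I -> T} :=
  [ffun i => insubd t0 (val (q.2.1 (q.1 i)) * val (q.2.2 i))%g].
have cT k : #|{: ball S k}| = vol S k by rewrite -cardfE.
have -> : (m.+1./2 ^ m.+2 * (vol S n ^ m.+1./2 * vol S (m.+2 * s) ^ m.+2) =
  #|{: {ffun I -> 'I_r} * ({ffun 'I_r -> T} * {ffun I -> ball S D})}|)%N.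
  by rewrite !card_prod !card_ffun !cT !card_ord.
apply: leq_trans (leq_image_card Psi predT) => /=.
apply: fintype.subset_leq_card; apply/fintype.subsetP => x /andP[/forallP h1 /forallP h2].
have gC i j : near x i j = near x j i by rewrite /near gdistC.
have cr := @card_roots_half m (near x) gC.
have {}cr : (#|roots (near x)| <= r)%N.
  apply: cr => [i|j j0].
    by have /existsP[j /andP[]] := h1 i; exists j.
  have := h2 j; rewrite j0 /= => /existsP[l /and3P[l0 lj nl]]; exists l => //.
  by rewrite l0 lj.
have csym : connect_sym (near x) by exact: sym_connect_sym.
have gi i : (index (fingraph.root (near x) i) (enum (roots (near x))) < r)%N.
  apply: leq_trans cr; rewrite cardE index_mem mem_enum; exact: roots_root.
have dist i : (gdist S (val (x (fingraph.root (near x) i))) (val (x i)) <= D)%N.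
  have := connect_root (near x) i; rewrite csym.
  move: (fingraph.root _ _) => a0 /connectP[p pp ->].
  case: (shortenP pp) => p' pp' up' _ {p pp}.
  have sp : (size p' <= m.+2)%N.
    by have := max_card [in a0 :: p']; rewrite (card_uniqP up') card_ord; exact: ltnW.
  apply: (@leq_trans (size p' * s)); last by rewrite leq_mul2r sp orbT.
  elim: p' a0 pp' {up' sp} => [|j p' ih] a /=; first by rewrite gdistxx.
  move=> /andP[aj jp]; rewrite mulSn (leq_trans (gdist_triangle cayleyS (val (x j)) _ _))//.
  by rewrite leq_add// ih.
apply/fintype.imageP.
pose y : {ffun 'I_r -> T} := [ffun k : 'I_r => x (nth ord0 (enum (roots (near x))) k)].
pose g : {ffun I -> 'I_r} := [ffun i => Ordinal (gi i)].
have yg i : y (g i) = x (fingraph.root (near x) i).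
  by rewrite !ffunE /= nth_index// mem_enum; exact: roots_root.
have zi i : ((val (x (fingraph.root (near x) i)))^-1 * val (x i))%g \in ball S D.
  by rewrite mem_ball// -gdistE.
pose z : {ffun I -> ball S D} := [ffun i => [` zi i]%fset].
exists (g, (y, z)) => //; apply/ffunP => i; rewrite ffunE /= yg ffunE /= mulVKg.
by apply: val_inj; rewrite /= insubdK//; exact: valP.
Qed.

Lemma moment_recursion :
  `|mean P (fun om => total om ^+ m.+2) -
    m.+1%:R * (mean P (fun om => total om ^+ 2) * mean P (fun om => total om ^+ m))| <=
  (vol S n)%:R ^+ m.+2 * (delta + m.+1%:R * (Q * delta)) +
  (m.+1./2 ^ m.+2 * (vol S n ^ m.+1./2 * vol S (m.+2 * s) ^ m.+2))%:R * (Q + m.+1%:R * (Q * Q)).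
Proof.
have Q0 : 0 <= Q by rewrite (le_trans ler01).
rewrite -sum_defect (bigID clumped)/= addrC (le_trans (ler_normD _ _))//.
apply: lerD; rewrite (le_trans (ler_norm_sum _ _ _))//.
  rewrite (le_trans (ler_sum _ (fun x nx => defect_small nx)))//.
  rewrite sumr_const -[leLHS]mulr_natl ler_wpM2r ?addr_ge0 ?mulr_ge0//.
  rewrite -natrX ler_nat (leq_trans (max_card _))//.
  by rewrite card_ffun card_ord -cardfE.
rewrite (le_trans (ler_sum _ (fun x _ => defect_le x)))//.
rewrite sumr_const -[leLHS]mulr_natl ler_wpM2r ?addr_ge0 ?mulr_ge0//.
by rewrite ler_nat clumped_card.
Qed.

End MomentRecursion.

Fixpoint gauss_moment (R : realType) (v : R) (m : nat) : R :=
  match m with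
  | 0 => 1
  | 1 => 0
  | m'.+2 => m'.+1%:R * (v * gauss_moment v m')
  end.

(** * Convergence of the normalised moments *)

Section MomentConvergence.
Variables (R : realType) (V : groupType) (S : {fset V}).
Hypothesis cayleyS : cayley_graph S.
Variables (d : measure_display) (Omega : measurableType d) (P : probability Omega R).
Variables (Y : nat -> V -> Omega -> R).
Hypothesis fY : forall n x, (0 < n)%N -> fmom P (Y n x).
Hypothesis Y0 : forall n x, (0 < n)%N -> x \in ball S n -> mean P (Y n x) = 0.
Hypothesis momQ : forall p, exists2 Q, 1 <= Q & forall n r, (0 < n)%N -> (size r <= p)%N ->
  {subset r <= ball S n} -> `|mean P (fun om => \prod_(x <- r) Y n x om)| <= Q.
Hypothesis mixing : forall p K, exists2 C, 0 <= C & forall n s xs ys, (0 < n)%N -> (0 < s)%N ->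
  (size xs + size ys <= p)%N -> {subset xs <= ball S n} -> {subset ys <= ball S n} ->
  (forall x y, x \in xs -> y \in ys -> (s < gdist S x y)%N) ->
  `|cov P (fun om => \prod_(x <- xs) Y n x om) (fun om => \prod_(y <- ys) Y n y om)| <=
    C / (vol S s)%:R ^+ K.

Notation N n := ((vol S n)%:R : R).

Lemma vol_large (X : R) : exists n0, forall n, (n0 <= n)%N -> X < N n.
Proof.
exists `|Num.ceil X|%N => n n0; apply: (@le_lt_trans _ _ n%:R).
  apply: (@le_trans _ _ (`|Num.ceil X|%N)%:R); last by rewrite ler_nat.
  by rewrite natr_absz (le_trans (ceil_ge X))// ler_int ler_norm.
by rewrite ltr_nat vol_ge.
Qed.

(** The largest [s] with the lower bound also has the upper one, as a step multiplies volumes by at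
    most [vol S 1]. *)
Lemma scale_choice L n : (0 < L)%N -> (vol S 1 ^ L <= vol S n)%N ->
  exists s, [/\ (0 < s)%N, (vol S s ^ L <= vol S n)%N & (vol S n <= (vol S s * vol S 1) ^ L)%N].
Proof.
move=> L0 h1.
have ex : exists s, (vol S s ^ L <= vol S n)%N by exists 1%N.
have bd s : (vol S s ^ L <= vol S n)%N -> (s <= vol S n)%N.
  apply: leq_trans; apply: (@leq_trans (vol S s)); first by rewrite ltnW// vol_ge.
  by rewrite -[X in (X <= _)%N]expn1 leq_pexp2l// vol_gt0.
case: (ex_maxnP ex bd) => s sn smax; exists s; split => //; first exact: smax.
rewrite ltnW// ltnNge; apply/negP => h.
have /smax : (vol S s.+1 ^ L <= vol S n)%N.
  by apply: leq_trans h; rewrite leq_exp2r// -addn1 volD.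
by rewrite ltnn.
Qed.

Definition rootvol n : R := Num.sqrt (N n).

Lemma vol1 n : 1 <= N n. Proof. by rewrite ler1n vol_gt0. Qed.
Lemma rootvol_sqr n : rootvol n ^+ 2 = N n. Proof. by rewrite sqr_sqrtr. Qed.
Lemma rootvol_ge1 n : 1 <= rootvol n.
Proof. by rewrite -(@ler_pXn2r _ 2)// ?nnegrE ?sqrtr_ge0// expr1n rootvol_sqr vol1. Qed.
Lemma rootvol_gt0 n : 0 < rootvol n. Proof. exact: lt_le_trans (rootvol_ge1 n). Qed.

Definition nmoment m n : R := mean P (fun om => total S (Y n) n om ^+ m) / rootvol n ^+ m.

Lemma recursion_bound m : exists A B : R, 0 <= A /\ 0 <= B /\
  exists n0, forall n, (n0 <= n)%N -> exists2 z : R, 0 <= z /\ z ^+ 4 <= (N n)^-1 &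
    `|nmoment m.+2 n - m.+1%:R * (nmoment 2 n * nmoment m n)| <= A / rootvol n + B * z.
Proof.
(* With [vol s ^ L] comparable to [vol n], the choice [K = L * M] makes [vol s ^ K] comparable to
   the number [vol n ^ M] of all configurations, and [L = 4 * M ^ 2] keeps the freedom
   [vol s ^ (M * M)] inside the clusters below [vol n ^ (1 / 4)]. *)
pose M := m.+2; pose L := (4 * M ^ 2)%N; pose K := (L * M)%N; pose r := m.+1./2.
have [Q Q1 hQ] := momQ M; have [C C0 hC] := mixing M K.
have Q0 : 0 <= Q by rewrite (le_trans ler01).
pose c1 := 1 + m.+1%:R * Q.
pose A := C * (vol S 1)%:R ^+ K * c1.
pose B := (r ^ M)%:R * (Q + m.+1%:R * (Q * Q)).
have c10 : 0 <= c1 by rewrite addr_ge0 ?mulr_ge0.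
have A0 : 0 <= A by rewrite mulr_ge0// mulr_ge0// exprn_ge0.
exists A, B; split; first exact: A0.
split; first by rewrite mulr_ge0 ?addr_ge0 ?mulr_ge0.
have [n1 hn1] := vol_large (vol S 1 ^ L)%:R.
exists (maxn n1 1) => n; rewrite geq_max => /andP[n1n n0].
have [|s [s0 sn ns]] := @scale_choice L n isT.
  by have := hn1 n n1n; rewrite ltr_nat; exact: ltnW.
pose delta := C / (vol S s)%:R ^+ K.
have vs0 : 0 < (vol S s)%:R :> R by rewrite ltr0n vol_gt0.
have delta0 : 0 <= delta by rewrite divr_ge0// exprn_ge0// ltW.
have rec := moment_recursion cayleyS (fun x => fY x n0) (fun x => @Y0 n x n0) Q1 delta0
  (fun r => @hQ n r n0) (fun xs ys => @hC n s xs ys n0 s0).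
pose u := rootvol n; have u0 : 0 < u := rootvol_gt0 n.
pose T := (vol S n ^ r * vol S s ^ (M * M))%N.
(* Up to a constant, a bound for the number of clumped configurations after normalisation. As
   [2 * r <= M - 1], it is at most [vol n ^ (- 1 / 4)]; the fourth power keeps exponents
   integral. *)
exists (T%:R / u ^+ M).
  split; first by rewrite divr_ge0// exprn_ge0// ltW.
  rewrite expr_div_n -exprM mulnC exprM mulrC ler_pdivrMl ?exprn_gt0//.
  have -> : (u ^+ 4) ^+ M = N n ^+ (2 * M).
    by rewrite -rootvol_sqr -!exprM mulnA.
  rewrite ler_pdivlMr ?(lt_le_trans ltr01 (vol1 n))//.
  rewrite -!natrX -natrM ler_nat /T expnMn -!expnM.
  have -> : (M * M * 4 = L)%N by rewrite /L mulnC mulnn.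
  rewrite -mulnA (leq_trans (leq_mul (leqnn _) (leq_mul sn (leqnn _))))//.
  rewrite mulnn -expnD leq_pexp2l ?vol_gt0//.
  by rewrite /r /M; clear; lia.
have -> : nmoment m.+2 n - m.+1%:R * (nmoment 2 n * nmoment m n) =
   (mean P (fun om => total S (Y n) n om ^+ m.+2) - m.+1%:R *
      (mean P (fun om => total S (Y n) n om ^+ 2) * mean P (fun om => total S (Y n) n om ^+ m)))
    / u ^+ M.
  rewrite /nmoment /M -addn2 addnC exprD -/u; field.
  by rewrite expf_neq0 ?gt_eqF.
rewrite normrM (ger0_norm (x := _^-1)); last by rewrite invr_ge0 exprn_ge0// ltW.
have uM0 : 0 < u ^+ M by rewrite exprn_gt0.
apply: (@le_trans _ _ (A / u ^+ M + B * (T%:R / u ^+ M))); last first.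
  rewrite lerD2r ler_wpM2l// lef_pV2 ?posrE//.
  by rewrite -[leLHS]expr1 ler_weXn2l// rootvol_ge1.
rewrite (mulrA B) -mulrDl ler_pM2r ?invr_gt0//; apply: (le_trans rec).
apply: lerD.
  rewrite -/delta (_ : delta + _ = delta * c1); last by rewrite /c1; ring.
  rewrite mulrA ler_wpM2r// /delta mulrCA ler_wpM2l// ler_pdivrMr ?exprn_gt0//.
  rewrite -!natrX -natrM ler_nat -expnMn mulnC.
  by rewrite /K expnM leq_exp2r// mulnC.
rewrite -/r -/M natrM mulrAC /B ler_wpM2l ?mulr_ge0 ?addr_ge0 ?mulr_ge0// ler_nat /T leq_mul2l.
by rewrite expnM leq_exp2r// vol_mul ?orbT.
Qed.

Lemma recursion_cvg m :
  (nmoment m.+2 n - m.+1%:R * (nmoment 2 n * nmoment m n)) @[n --> \oo] --> (0 : R).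
Proof.
have [A [B [A0 [B0 [n0 h]]]]] := recursion_bound m.
apply/cvgn_distP => e e0.
have e20 : 0 < e / 2 by rewrite divr_gt0.
have [n1 h1] := vol_large ((A / (e / 2)) ^+ 2).
have [n2 h2] := vol_large (((B + 1) / (e / 2)) ^+ 4).
exists (maxn n0 (maxn n1 n2)) => n; rewrite !geq_max => /and3P[nn0 nn1 nn2].
have [z [z0 z4] hz] := h n nn0; rewrite subr0; apply: (le_lt_trans hz).
rewrite [ltRHS](splitr e) ltr_leD//.
  rewrite ltr_pdivrMr ?rootvol_gt0// mulrC -ltr_pdivrMr//.
  rewrite -(@ltr_pXn2r _ 2) ?nnegrE ?rootvol_sqr ?divr_ge0 ?(ltW e0) ?(ltW e20) ?(ltW (rootvol_gt0 _))//.
  exact: h1.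
have B1 : 0 < B + 1 by rewrite ltr_wpDl.
apply: (@le_trans _ _ ((B + 1) * z)); first by rewrite ler_wpM2r// lerDl.
rewrite mulrC -ler_pdivlMr//.
rewrite -(@ler_pXn2r _ 4) ?nnegrE ?divr_ge0 ?(ltW e0) ?(ltW e20) ?(ltW B1)//.
apply: (le_trans z4); rewrite -[leRHS]invrK lef_pV2 ?posrE ?invr_gt0 ?exprn_gt0 ?divr_gt0//.
  by rewrite -exprVn invf_div ltW// h2.
by rewrite (lt_le_trans ltr01 (vol1 n)).
Qed.

(** The recursion has step two, hence the induction carries two consecutive orders; it starts from
    orders 0 and 1, the latter vanishing by centring. *)
Lemma nmoment_cvg v : nmoment 2 n @[n --> \oo] --> v ->
  forall m, nmoment m n @[n --> \oo] --> gauss_moment v m.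
Proof.
move=> hv.
have n0 : nmoment 0 = fun _ => 1.
  by apply/funext => n; rewrite /nmoment mean_cst divr1.
have n1 n : (0 < n)%N -> nmoment 1 n = 0.
  move=> n0'; rewrite /nmoment; have -> : mean P (fun om => total S (Y n) n om ^+ 1) = 0.
    rewrite mean_sum_seq; last by move=> x _; exact: fY.
    by rewrite big_seq big1// => x xn; exact: Y0.
  by rewrite mul0r.
have step m : nmoment m n @[n --> \oo] --> gauss_moment v m ->
    nmoment m.+2 n @[n --> \oo] --> gauss_moment v m.+2.
  move=> hm.
  have -> : nmoment m.+2 = (fun n => (nmoment m.+2 n - m.+1%:R * (nmoment 2 n * nmoment m n)) +
      m.+1%:R * (nmoment 2 n * nmoment m n)).
    by apply/funext => n; rewrite subrK.
  rewrite /= -[X in _ --> X]add0r; apply: cvgD; first exact: recursion_cvg.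
  by apply: cvgMl_tmp; exact: cvgM.
suff h m : (nmoment m n @[n --> \oo] --> gauss_moment v m) /\
           (nmoment m.+1 n @[n --> \oo] --> gauss_moment v m.+1) by move=> m; have [] := h m.
elim: m => [|m [h1 h2]]; last by split => //; exact: step.
split; first by rewrite n0; exact: cvg_cst.
apply/cvgn_distP => e e0; exists 1%N => n nn; rewrite n1// subrr normr0//.
Qed.

End MomentConvergence.

(** * Convergence in distribution from convergence of moments *)

Lemma cvgn_sum (R : realType) (I : Type) (r : seq I) (Q : pred I) (f : I -> nat -> R) (l : I -> R) :
  (forall i, Q i -> f i n @[n --> \oo] --> l i) ->
  \sum_(i <- r | Q i) f i n @[n --> \oo] --> \sum_(i <- r | Q i) l i.
Proof.
move=> h; elim: r => [|i r ih].
  by under eq_fun do rewrite big_nil; rewrite big_nil; exact: cvg_cst.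
under eq_fun do rewrite big_cons; rewrite big_cons.
by case Qi : (Q i) => //; apply: cvgD => //; exact: h.
Qed.

(** * Taylor expansion of the cosine *)

Section Taylor.
Variable R : realType.
Implicit Types x c : R.

Lemma is_derive_powS N x : is_derive x (1 : R) (fun y : R => y ^+ N.+1) (N.+1%:R * x ^+ N).
Proof.
have := @is_deriveX R R id N.+1 x 1 1 (is_derive_id _ _).
rewrite (_ : (id ^+ N.+1 : R -> R) = fun y => y ^+ N.+1); last first.
  by apply/funext => y; rewrite fctE.
by rewrite /GRing.scale /= mulr1.
Qed.

(** Every derivative of the cosine is the cosine with its phase advanced by [pi / 2]: carrying a
    phase [c] lets one formula serve all orders, and the sine too. *)
Definition cos_poly N c x : R :=
  \sum_(j < N) cos (c + j%:R * (pi / 2)) / j`!%:R * x ^+ j.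

Lemma is_derive_cos_poly N c x :
  is_derive x 1 (cos_poly N.+1 c) (cos_poly N (c + pi / 2) x).
Proof.
elim: N => [|N ih].
  have -> : cos_poly 1 c = cst (cos c).
    by apply/funext => y; rewrite /cos_poly big_ord1 mul0r addr0 fact0 divr1 mulr1.
  by rewrite /cos_poly big_ord0; exact: is_derive_cst.
have -> : cos_poly N.+2 c = cos_poly N.+1 c +
    (cos (c + N.+1%:R * (pi / 2)) / N.+1`!%:R) \*: (fun y => y ^+ N.+1).
  by apply/funext => y; rewrite /cos_poly big_ord_recr.
have -> : cos_poly N.+1 (c + pi / 2) x = cos_poly N (c + pi / 2) x +
    (cos (c + N.+1%:R * (pi / 2)) / N.+1`!%:R) * (N.+1%:R * x ^+ N).
  rewrite /cos_poly big_ord_recr /=; congr (_ + _).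
  have -> : c + pi / 2 + N%:R * (pi / 2) = c + N.+1%:R * (pi / 2) by rewrite -natr1; ring.
  rewrite factS natrM invfM; field.
  by rewrite nat1r !pnatr_eq0 -lt0n fact_gt0.
by apply: is_deriveD; apply: is_deriveZ; exact: is_derive_powS.
Qed.

Definition cos_rem N c x : R := cos (x + c) - cos_poly N c x.

Lemma is_derive_cos_rem N c x :
  is_derive x 1 (cos_rem N.+1 c) (cos_rem N (c + pi / 2) x).
Proof.
rewrite /cos_rem; apply: is_deriveB; last exact: is_derive_cos_poly.
rewrite addrA cosDpihalf.
have h : is_derive x (1 : R) (fun y => y + c) 1.
  by have := is_deriveD (is_derive_id x (1 : R)) (is_derive_cst c x (1 : R)); rewrite addr0.
by have := @is_derive1_comp _ cos (fun y => y + c) x _ _ (is_derive_cos (x + c)) h; rewrite mulr1.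
Qed.

Lemma cos_rem0 N c : cos_rem N.+1 c 0 = 0.
Proof.
rewrite /cos_rem /cos_poly big_ord_recl /= big1 => [|i _].
  by rewrite mul0r !addr0 add0r fact0 divr1 mulr1 subrr.
by rewrite /= expr0n mulr0.
Qed.

Lemma cos_remN N c x : cos_rem N c (- x) = cos_rem N (- c) x.
Proof.
rewrite /cos_rem -cosN opprD opprK; congr (_ - _); apply: eq_bigr => j _.
have -> : cos (- c + j%:R * (pi / 2)) = (-1) ^+ j * cos (c + j%:R * (pi / 2)).
  rewrite -cosN opprD opprK.
  have -> : c + j%:R * (pi / 2) = c - j%:R * (pi / 2) + pi *+ j.
    by rewrite -mulr_natl; field.
  by rewrite (alternatingn (@cosDpi R)) signrMK.
by rewrite [(- x) ^+ j]exprNn; move: ((-1) ^+ j) (x ^+ j) (_^-1) (cos _) => a b e f; ring.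
Qed.

(** Differentiation turns the remainder of order [N.+1] into that of order [N] with an advanced
    phase. The induction hypothesis therefore makes the claimed bound, plus or minus the remainder,
    nondecreasing on the nonnegative reals. *)
Lemma cos_taylor N c x : `|cos_rem N c x| <= `|x| ^+ N / N`!%:R.
Proof.
wlog x0 : c x / 0 <= x => [hw|].
  have [/hw //|/ltW] := leP 0 x; rewrite -oppr_ge0 => /hw.
  by move=> /(_ (- c)); rewrite cos_remN opprK normrN.
elim: N c x x0 => [|N ih] c x x0.
  rewrite expr0 fact0 divr1 /cos_rem /cos_poly big_ord0 subr0 ler_norml.
  by rewrite cos_geN1 cos_le1.
rewrite (ger0_norm x0).
pose p y : R := y ^+ N.+1 / N.+1`!%:R.
have dp (y : R) : is_derive y (1 : R) p (y ^+ N / N`!%:R).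
  have -> : p = (N.+1`!%:R^-1) \*: (fun y => y ^+ N.+1).
    by apply/funext => z; rewrite /p mulrC.
  have -> : y ^+ N / N`!%:R = N.+1`!%:R^-1 * (N.+1%:R * y ^+ N).
    rewrite factS natrM invfM; field.
    by rewrite nat1r !pnatr_eq0 -lt0n fact_gt0.
  by apply: is_deriveZ; exact: is_derive_powS.
have p0 : p 0 = 0 by rewrite /p expr0n mul0r.
have mono (g : R -> R) (dg : R -> R) : (forall y : R, is_derive y (1 : R) g (dg y)) ->
    (forall y, 0 <= y -> 0 <= dg y) -> g 0 <= g x.
  move=> gd dg0.
  apply: (@ger0_derive1_ndecr R g 0 x) => //.
  - by move=> y /[!in_itv]/= /andP[y0 _]; rewrite derive1E derive_val dg0// ltW.
  - apply: derivable_within_continuous => y _; exact: ex_derive.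
rewrite ler_norml; apply/andP; split.
  rewrite lerNl -subr_ge0 opprK addrC.
  have := mono (p + cos_rem N.+1 c) (fun y => y ^+ N / N`!%:R + cos_rem N (c + pi / 2) y).
  rewrite !fctE p0 cos_rem0 addr0 addrC; apply.
    by move=> y; exact: is_deriveD (dp y) (is_derive_cos_rem N c y).
  move=> y y0; have := ih (c + pi / 2) y y0; rewrite (ger0_norm y0) ler_norml => /andP[].
  by rewrite -subr_ge0 opprK addrC.
rewrite -subr_ge0.
have := mono (p - cos_rem N.+1 c) (fun y => y ^+ N / N`!%:R - cos_rem N (c + pi / 2) y).
rewrite !fctE p0 cos_rem0 subr0; apply.
  by move=> y; exact: is_deriveB (dp y) (is_derive_cos_rem N c y).
move=> y y0; have := ih (c + pi / 2) y y0; rewrite (ger0_norm y0) ler_norml => /andP[_].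
by rewrite -subr_ge0.
Qed.

End Taylor.

Section CosineMeans.
Context {d d' : measure_display} {T : measurableType d} {T' : measurableType d'} {R : realType}.
Variables (P : probability T R) (nu : probability T' R).

Lemma measurable_cos_comp (d0 : measure_display) (U : measurableType d0) (Z : U -> R) c :
  measurable_fun setT Z -> measurable_fun setT (fun x => cos (Z x + c)).
Proof.
move=> mZ; apply: (measurableT_comp (f := @cos R)).
  by apply: continuous_measurable_fun; exact: continuous_cos.
by apply: measurable_funD => //; exact: measurable_cst.
Qed.

Lemma fmom_cos (d0 : measure_display) (U : measurableType d0) (Q : probability U R) (Z : U -> R) c :
  measurable_fun setT Z -> fmom Q (fun x => cos (Z x + c)).
Proof.
move=> mZ; apply: (@fmom_bounded _ _ _ _ _ 1); first exact: measurable_cos_comp.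
by move=> x; rewrite ler_norml cos_geN1 cos_le1.
Qed.

Lemma mean_cos_taylor (d0 : measure_display) (U : measurableType d0) (Q : probability U R)
    (Z : U -> R) c q : fmom Q Z ->
  `|mean Q (fun x => cos (Z x + c)) -
    \sum_(j < 2 * q) cos (c + j%:R * (pi / 2)) / j`!%:R * mean Q (fun x => Z x ^+ j)| <=
  mean Q (fun x => Z x ^+ (2 * q)) / (2 * q)`!%:R.
Proof.
move=> fZ; have fp j : fmom Q (fun x => Z x ^+ j) by exact: fmomX.
have -> : \sum_(j < 2 * q) cos (c + j%:R * (pi / 2)) / j`!%:R * mean Q (fun x => Z x ^+ j) =
    mean Q (fun x => cos_poly (2 * q) c (Z x)).
  rewrite /cos_poly mean_sum; last by move=> j _; exact: fmomZ.
  by apply: eq_bigr => j _; rewrite meanZ.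
have fcp : fmom Q (fun x => cos_poly (2 * q) c (Z x)).
  by apply: fmom_sum => j _; exact: fmomZ.
have fc : fmom Q (fun x => cos (Z x + c)) by apply: fmom_cos; case: fZ.
rewrite -meanB// mulrC -meanZ//; apply: mean_abs_le; [exact: fmomB|exact: fmomZ|].
move=> x; have := cos_taylor (2 * q) c (Z x).
by rewrite /cos_rem mulrC !exprM real_normK ?num_real.
Qed.

(** The remainder of even order [2 * q] is controlled by the moment of that order: small for the
    limit by assumption, hence for large [n] because that very moment converges. Finitely many
    moments remain. *)
Lemma mean_cos_cvg (Z : nat -> T -> R) (Y : T' -> R) c :
  (forall n, (0 < n)%N -> fmom P (Z n)) -> fmom nu Y ->
  (forall m, mean P (fun x => Z n x ^+ m) @[n --> \oo] --> mean nu (fun y => Y y ^+ m)) ->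
  (mean nu (fun y => Y y ^+ (2 * q)) / (2 * q)`!%:R @[q --> \oo] --> (0 : R)) ->
  mean P (fun x => cos (Z n x + c)) @[n --> \oo] --> mean nu (fun y => cos (Y y + c)).
Proof.
move=> fZ fY hm hq; apply/cvgn_distP => e e0.
have e40 : 0 < e / 4 by rewrite divr_gt0.
have [q /(_ q (leqnn q))] := (cvgn_distP _ _).1 hq _ e40.
rewrite subr0 => hq1.
pose p (m : nat -> R) := \sum_(j < 2 * q) cos (c + j%:R * (pi / 2)) / j`!%:R * m j.
have hp : p (fun j => mean P (fun x => Z n x ^+ j)) @[n --> \oo] --> p (fun j => mean nu (fun y => Y y ^+ j)).
  rewrite /p; apply: cvgn_sum => j _.
  by apply: cvgMl_tmp; exact: hm.
have [n1 hn1] := (cvgn_distP _ _).1 hp _ e40.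
have hm2 := cvgMr_tmp (b := (2 * q)`!%:R^-1) (hm (2 * q)%N).
have [n2 hn2] := (cvgn_distP _ _).1 (hm2 _) _ e40.
exists (maxn 1 (maxn n1 n2)) => n; rewrite !geq_max => /and3P[n0 nn1 nn2].
have h1 := mean_cos_taylor c q (fZ n n0).
have h2 := mean_cos_taylor c q fY.
have h3 := hn1 n nn1; have h4 := hn2 n nn2.
move: h1 h2 h3 h4 hq1; rewrite /p /=.
move: (mean P _) (mean nu (fun=> cos _)) => a b.
move: (\sum_(j < 2 * q) _) (\sum_(j < 2 * q) _) => u v.
move: (_ / _) (_ / _) => s t h1 h2 h3 h4 h5.
move: h1 h2 h3 h4 h5; rewrite !ler_norml !ltr_norml.
move=> /andP[? ?] /andP[? ?] /andP[? ?] /andP[? ?] /andP[? ?].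
by apply/andP; split; lra.
Qed.

End CosineMeans.

(** * Row vectors: Borel sets, linear functionals, uniform continuity *)

Section RowVectors.
Variables (R : realType) (k : nat).
Implicit Types x t : 'rV[R]_k.

Lemma rV_ballP x (U : set 'rV[R]_k) : nbhs x U ->
  exists2 e : R, 0 < e & forall y : 'rV[R]_k, (forall i, `|x 0 i - y 0 i| < e) -> U y.
Proof.
move=> /nbhs_ballP[e /= e0 eU]; exists e => // y xy; apply: eU; split => // i j.
by rewrite ord1; exact: xy.
Qed.

Lemma near_rV x e : 0 < e -> \forall y \near x, forall i, `|x 0 i - (y : 'rV[R]_k) 0 i| < e.
Proof.
move=> e0; apply/nbhs_ballP; exists e => //= y [_ xy] i; exact: xy.
Qed.

(** Open sets generate the Borel sets here, and each is a countable union of cubes with rational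
    data, whose preimages are finite intersections of measurable sets. *)
Lemma measurable_rV (d : measure_display) (T : measurableType d) (f : T -> borel_rV R k) :
  (forall i, measurable_fun setT (fun s => f s 0 i)) -> measurable_fun setT f.
Proof.
move=> mf; apply: (@measurability _ _ T (borel_rV R k) setT f (@open 'rV[R]_k)) => //.
move=> _ [U oU <-]; rewrite setTI.
pose box (qr : {ffun 'I_k -> rat} * rat) : set 'rV[R]_k :=
  [set x | forall i, `|x 0 i - ratr (qr.1 i)| < ratr qr.2].
have mbox qr : measurable (f @^-1` box qr).
  have -> : f @^-1` box qr = \bigcap_(i in [set: 'I_k]) [set s | `|f s 0 i - ratr (qr.1 i)| < ratr qr.2].
    apply/seteqP; split => s /= h i; [move=> _; exact: h|exact: (h i I)].
  apply: fin_bigcap_measurable => // i _.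
  have : measurable_fun setT (fun s => `|f s 0 i - ratr (qr.1 i)|).
    apply: measurableT_comp => //; apply: measurable_funB => //; exact: measurable_cst.
  move=> /(_ measurableT `]-oo, ratr qr.2[%classic); rewrite setTI => /(_ (measurable_itv _)).
  by congr measurable; apply/seteqP; split => s /=; rewrite in_itv.
have -> : f @^-1` U = \bigcup_(qr in [set qr | box qr `<=` U]) f @^-1` box qr.
  apply/seteqP; split => s /=; last by move=> [qr h hs]; exact: h.
  move=> Us; have [e e0 he] := rV_ballP (open_nbhs_nbhs (conj oU Us)).
  have [r /[!in_itv]/= /andP[r0 re]] := rat_in_itvoo (divr_gt0 e0 (ltr0n R 2)).
  have /choice [q hq] : forall i, exists q : rat, `|f s 0 i - ratr q| < ratr r.
    move=> i; have [|q /[!in_itv]/= /andP[q1 q2]] := @rat_in_itvoo R (f s 0 i - ratr r) (f s 0 i + ratr r).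
      by rewrite ltrD2l gtrN.
    by exists q; rewrite distrC ltr_distl q1 q2.
  exists ([ffun i => q i], r) => /=; last by move=> i; rewrite ffunE.
  move=> y yb; apply: he => i; have := yb i; rewrite ffunE /= => yi.
  rewrite -(subrKA (ratr (q i))) (le_lt_trans (ler_normD _ _))// [ltRHS](splitr e).
  by rewrite ltrD// ?(lt_trans _ re)//; rewrite distrC.
rewrite bigcup_mkcond; apply: countable_bigcupT_measurable => [|qr].
  exact: countableP.
by case: ifP => _.
Qed.

Lemma continuous_measurable_rV (f : 'rV[R]_k -> R) :
  continuous f -> measurable_fun [set: borel_rV R k] (f : borel_rV R k -> R).
Proof.
move=> cf; apply: (measurability _ (RGenOInfty.measurableE R)) => //.
move=> _ [_ [a ->] <-]; rewrite setTI; apply: sub_sigma_algebra.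
by move/continuousP: cf; apply; exact: interval_open.
Qed.

Definition dotr t x : R := (x *m t^T) 0 0.

Lemma dotrE t x : dotr t x = \sum_i x 0 i * t 0 i.
Proof. by rewrite /dotr mxE; apply: eq_bigr => i _; rewrite !mxE. Qed.

Lemma dotrDl s t x : dotr (s + t) x = dotr s x + dotr t x.
Proof. by rewrite !dotrE -big_split; apply: eq_bigr => i _; rewrite mxE mulrDr. Qed.

Lemma dotrBl s t x : dotr (s - t) x = dotr s x - dotr t x.
Proof. by rewrite !dotrE -sumrB; apply: eq_bigr => i _; rewrite !mxE mulrBr. Qed.

Lemma dotr_delta i a x : dotr (a *: delta_mx 0 i) x = a * x 0 i.
Proof.
rewrite dotrE (bigD1 i)//= big1 => [|j ji]; rewrite !mxE eqxx /=.
  by rewrite eqxx mulr1 addr0 mulrC.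
by rewrite (negbTE ji) !mulr0.
Qed.

Lemma measurable_coord_rV i : measurable_fun [set: borel_rV R k] (fun x : borel_rV R k => (x : 'rV[R]_k) 0 i).
Proof. by apply: continuous_measurable_rV; exact: coord_continuous. Qed.

(** Only [x] is confined to [K]: [bern_approx] compares with arbitrary nearby points. *)
Lemma compact_unif_cont (f : 'rV[R]_k -> R) (K : set 'rV[R]_k) e :
  continuous f -> compact K -> 0 < e ->
  exists2 eta : R, 0 < eta & forall x y : 'rV[R]_k, K x -> (forall i, `|x 0 i - y 0 i| < eta) -> `|f x - f y| < e.
Proof.
move=> cf /compact_near_coveringP cK e0.
pose Q (h : R) (x : 'rV[R]_k) := forall y : 'rV[R]_k, (forall i, `|x 0 i - y 0 i| < h) -> `|f x - f y| < e.
have e20 : 0 < e / 2 by rewrite divr_gt0.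
have : \forall h \near 0^'+, K `<=` Q h.
  apply: cK => x Kx.
  have /cvgrPdist_lt/(_ _ e20)/rV_ballP[d d0 hd] := cf x.
  have d20 : 0 < d / 2 by rewrite divr_gt0.
  near=> x' h => y hy.
  have xx' : forall i, `|x 0 i - x' 0 i| < d / 2 by near: x'; exact: near_rV.
  have hd2 : h < d / 2 by near: h; exact: nbhs_right_lt.
  rewrite -(subrKA (f x)) (le_lt_trans (ler_normD _ _))// [ltRHS](splitr e) ltrD//.
    rewrite distrC; apply: hd => i; rewrite (lt_le_trans (xx' i))// ler_pdivrMr// ler_peMr//.
      exact: ltW.
    by rewrite ler1n.
  apply: hd => i; rewrite -(subrKA (x' 0 i)) (le_lt_trans (ler_normD _ _))//.
  by rewrite [ltRHS](splitr d) ltrD// (lt_trans (hy i)).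
move=> [d /= d0 hd]; exists (d / 2); first by rewrite divr_gt0.
move=> x y Kx; apply: (hd (d / 2)) => //.
- by rewrite /= sub0r normrN gtr0_norm ?divr_gt0// ltr_pdivrMr// ltr_pMr// ltr1n.
- by rewrite divr_gt0.
Unshelve. all: by end_near. Qed.

End RowVectors.

Section TrigPolynomials.
Variables (R : realType) (k : nat).
Implicit Types (g h : 'rV[R]_k -> R).

(* Real trigonometric polynomials, the triple [(a, t, c)] coding the function
   [a cos (<t, x> + c)]. *)
Definition trig_poly g : Prop := exists s : seq (R * 'rV[R]_k * R),
  forall x, g x = \sum_(p <- s) p.1.1 * cos (dotr p.1.2 x + p.2).

Lemma trig_cst a : trig_poly (fun _ => a).
Proof.
exists [:: (a, 0, 0)] => x; rewrite big_seq1 /= dotrE big1 => [|i _].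
  by rewrite addr0 cos0 mulr1.
by rewrite mxE mulr0.
Qed.

Lemma trig_add g h : trig_poly g -> trig_poly h -> trig_poly (fun x => g x + h x).
Proof. by move=> [s gs] [s' hs]; exists (s ++ s') => x; rewrite big_cat gs hs. Qed.

Lemma trig_scale a g : trig_poly g -> trig_poly (fun x => a * g x).
Proof.
move=> [s gs]; exists [seq (a * p.1.1, p.1.2, p.2) | p <- s] => x.
by rewrite gs big_map mulr_sumr; apply: eq_bigr => p _ /=; rewrite mulrA.
Qed.

Lemma trig_sum (I : Type) (r : seq I) (Q : pred I) (g : I -> 'rV[R]_k -> R) :
  (forall i, trig_poly (g i)) -> trig_poly (fun x => \sum_(i <- r | Q i) g i x).
Proof.
move=> hg; elim: r => [|i r ih]; first by under eq_fun do rewrite big_nil; exact: trig_cst.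
under eq_fun do rewrite big_cons.
by case: (Q i) => //; exact: trig_add.
Qed.

Lemma trig_mul g h : trig_poly g -> trig_poly h -> trig_poly (fun x => g x * h x).
Proof.
move=> [s gs] [s' hs].
have -> : (fun x => g x * h x) = (fun x => \sum_(p <- s) \sum_(q <- s')
    (p.1.1 * cos (dotr p.1.2 x + p.2)) * (q.1.1 * cos (dotr q.1.2 x + q.2))).
  apply/funext => x; rewrite gs hs mulr_suml; apply: eq_bigr => p _.
  by rewrite mulr_sumr.
apply: trig_sum => p; apply: trig_sum => q.
exists [:: (p.1.1 * q.1.1 / 2, p.1.2 + q.1.2, p.2 + q.2);
           (p.1.1 * q.1.1 / 2, p.1.2 - q.1.2, p.2 - q.2)] => x.
rewrite big_cons big_seq1 /= dotrDl dotrBl.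
have -> : dotr p.1.2 x + dotr q.1.2 x + (p.2 + q.2) =
  (dotr p.1.2 x + p.2) + (dotr q.1.2 x + q.2) by ring.
have -> : dotr p.1.2 x - dotr q.1.2 x + (p.2 - q.2) =
  (dotr p.1.2 x + p.2) - (dotr q.1.2 x + q.2) by ring.
move: (dotr p.1.2 x + p.2) (dotr q.1.2 x + q.2) => A B.
by rewrite cosD cosB; field.
Qed.

Lemma trig_prod (I : Type) (r : seq I) (g : I -> 'rV[R]_k -> R) :
  (forall i, trig_poly (g i)) -> trig_poly (fun x => \prod_(i <- r) g i x).
Proof.
move=> hg; elim: r => [|i r ih]; first by under eq_fun do rewrite big_nil; exact: trig_cst.
by under eq_fun do rewrite big_cons; exact: trig_mul.
Qed.

Lemma trig_sin i a : trig_poly (fun x => sin (a * x 0 i)).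
Proof.
exists [:: (1, a *: delta_mx 0 i, - (pi / 2))] => x.
by rewrite big_seq1 /= dotr_delta mul1r cosBpihalf.
Qed.

End TrigPolynomials.

(** * Multivariate Bernstein polynomials *)

Section Bernstein.
Variables (R : realType) (k q : nat).
Implicit Types (p : 'I_k -> R) (b : {ffun 'I_k * 'I_q.+1 -> bool}).

(* The probability of the outcome [b] of independent coin tosses, [q + 1] of
   them having bias [p i] for each [i]. *)
Definition bern_weight p b : R := \prod_z (if b z then p z.1 else 1 - p z.1).

(** The frequencies of success. Summing over outcomes rather than over success counts avoids
    binomial coefficients and lets expectations of products factorise, as in [bern_sum_prod]. *)
Definition bern_node b : 'rV[R]_k := \row_i ((\sum_l (b (i, l))%:R) / q.+1%:R).

Lemma bern_weight_ge0 p b : (forall i, 0 <= p i <= 1) -> 0 <= bern_weight p b.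
Proof.
move=> p01; apply: prodr_ge0 => z _; have /andP[? ?] := p01 z.1.
by case: (b z) => //; rewrite subr_ge0.
Qed.

Lemma bern_sum_prod p (h : 'I_k * 'I_q.+1 -> bool -> R) :
  \sum_b bern_weight p b * \prod_z h z (b z) =
  \prod_z (p z.1 * h z true + (1 - p z.1) * h z false).
Proof.
have e z : p z.1 * h z true + (1 - p z.1) * h z false =
    \sum_(c : bool) (if c then p z.1 else 1 - p z.1) * h z c.
  by rewrite big_bool.
rewrite (eq_bigr _ (fun z _ => e z)) bigA_distr_bigA; apply: eq_bigr => b _.
by rewrite /bern_weight -big_split.
Qed.

Lemma bern_weight_sum p : \sum_b bern_weight p b = 1.
Proof.
transitivity (\sum_b bern_weight p b * \prod_(z : 'I_k * 'I_q.+1) 1).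
  by apply: eq_bigr => b _; rewrite big1 ?mulr1.
rewrite (bern_sum_prod p (fun _ _ => 1)) big1// => z _.
by rewrite !mulr1 addrC subrK.
Qed.

Lemma bern_cov p z z' : \sum_b bern_weight p b * (((b z)%:R - p z.1) * ((b z')%:R - p z'.1)) =
  if z == z' then p z.1 * (1 - p z.1) else 0.
Proof.
pose f (w y : 'I_k * 'I_q.+1) (c : bool) : R := if y == w then c%:R - p w.1 else 1.
have fP w b : \prod_y f w y (b y) = (b w)%:R - p w.1.
  rewrite (bigD1 w)//= big1 ?mulr1; first by rewrite /f eqxx.
  by move=> y /negbTE yw; rewrite /f yw.
transitivity (\sum_b bern_weight p b * \prod_y (f z y (b y) * f z' y (b y))).
  by apply: eq_bigr => b _; rewrite big_split /= !fP.
rewrite (bern_sum_prod p (fun y c => f z y c * f z' y c)) (bigD1 z)//=.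
rewrite /f eqxx; case: eqVneq => [->|zz'].
  rewrite big1 ?mulr1 => [|y /negbTE ->]; first by rewrite /=; ring.
  by rewrite !mulr1 addrC subrK.
set F := \prod_(_ | _) _.
have -> : p z.1 * ((true%:R - p z.1) * 1) + (1 - p z.1) * ((false%:R - p z.1) * 1) = 0 by rewrite /=; ring.
by rewrite mul0r.
Qed.

Lemma bern_variance p i : (0 <= p i <= 1) ->
  \sum_b bern_weight p b * (bern_node b 0 i - p i) ^+ 2 <= (q.+1%:R)^-1.
Proof.
move=> /andP[p0 p1]; have q0 : q.+1%:R != 0 :> R by rewrite pnatr_eq0.
have e b : (bern_node b 0 i - p i) ^+ 2 = q.+1%:R ^- 2 *
    \sum_l \sum_l' (((b (i, l))%:R - p i) * ((b (i, l'))%:R - p i)).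
  have -> : bern_node b 0 i - p i = q.+1%:R^-1 * \sum_l ((b (i, l))%:R - p i).
    rewrite mxE sumrB sumr_const card_ord -mulr_natl; field.
    by rewrite addrC natr1.
  by rewrite exprMn exprVn; congr (_ * _); rewrite expr2 big_distrlr.
have -> : \sum_b bern_weight p b * (bern_node b 0 i - p i) ^+ 2 =
    q.+1%:R ^- 2 * \sum_(l < q.+1) \sum_(l' < q.+1)
      \sum_b bern_weight p b * (((b (i, l))%:R - p i) * ((b (i, l'))%:R - p i)).
  under eq_bigr do rewrite e mulrCA.
  rewrite -mulr_sumr; congr (_ * _).
  under eq_bigr do rewrite mulr_sumr.
  rewrite exchange_big; apply: eq_bigr => l _.
  by under eq_bigr do rewrite mulr_sumr; rewrite exchange_big.
have -> : \sum_(l < q.+1) \sum_(l' < q.+1)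
      \sum_b bern_weight p b * (((b (i, l))%:R - p i) * ((b (i, l'))%:R - p i)) =
    q.+1%:R * (p i * (1 - p i)).
  rewrite (eq_bigr (fun _ => p i * (1 - p i))) => [|l _].
    by rewrite sumr_const card_ord mulr_natl.
  rewrite (bigD1 l)//= (bern_cov p (i, l) (i, l)) eqxx big1 ?addr0// => l' ll'.
  by rewrite (bern_cov p (i, l) (i, l')) xpair_eqE eqxx eq_sym (negbTE ll').
have -> : q.+1%:R ^- 2 * (q.+1%:R * (p i * (1 - p i))) = q.+1%:R^-1 * (p i * (1 - p i)).
  by field; rewrite addrC natr1.
by rewrite ler_piMr// ?invr_ge0//; nra.
Qed.

(* Chebyshev's inequality for the binomial law. *)
Lemma bern_approx (G : 'rV[R]_k -> R) (p : 'rV[R]_k) M eta e : 0 < eta -> 0 <= e ->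
  (forall x, `|G x| <= M) -> (forall i, 0 <= p 0 i <= 1) ->
  (forall y : 'rV[R]_k, (forall i, `|p 0 i - y 0 i| < eta) -> `|G p - G y| <= e) ->
  `|\sum_b bern_weight (p 0) b * G (bern_node b) - G p| <=
     e + 2 * M * k%:R / (eta ^+ 2 * q.+1%:R).
Proof.
move=> eta0 e0 GM p01 hG.
have M0 : 0 <= M by rewrite (le_trans _ (GM p)).
rewrite -[X in _ - X]mul1r -(bern_weight_sum (p 0)) mulr_suml -sumrB.
rewrite (le_trans (ler_norm_sum _ _ _))//.
have pt b : `|bern_weight (p 0) b * G (bern_node b) - bern_weight (p 0) b * G p| <=
    bern_weight (p 0) b * e + 2 * M / eta ^+ 2 *
      \sum_i bern_weight (p 0) b * (bern_node b 0 i - p 0 i) ^+ 2.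
  have w0 := bern_weight_ge0 b p01.
  rewrite -mulrBr normrM (ger0_norm w0) -mulr_sumr mulrCA -mulrDr ler_wpM2l//.
  have S0 : 0 <= \sum_i (bern_node b 0 i - p 0 i) ^+ 2 by apply: sumr_ge0 => i _; exact: sqr_ge0.
  have [far|close] := pselect (exists i, eta <= `|p 0 i - bern_node b 0 i|); last first.
    rewrite distrC (le_trans (hG _ _))//.
      by move=> i; rewrite ltNge; apply/negP => h; apply: close; exists i.
    by rewrite lerDl mulr_ge0// divr_ge0 ?mulr_ge0 ?exprn_ge0 ?(ltW eta0).
  have [i hi] := far.
  rewrite (le_trans (ler_normB _ _))// (@le_trans _ _ (2 * M))//.
    by rewrite mulr2n mulrDl mul1r lerD.
  rewrite -[leLHS]add0r lerD// -[leLHS]mulr1 -!mulrA ler_wpM2l// ler_wpM2l//.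
  rewrite mulrC ler_pdivlMr ?exprn_gt0// mul1r (bigD1 i)//=.
  apply: (@le_trans _ _ ((bern_node b 0 i - p 0 i) ^+ 2)).
    by rewrite -[leRHS]real_normK ?num_real// lerXn2r ?nnegrE ?(ltW eta0)// distrC.
  by rewrite lerDl sumr_ge0// => j _; exact: sqr_ge0.
rewrite (le_trans (ler_sum _ (fun b _ => pt b)))// big_split /= -mulr_suml bern_weight_sum mul1r.
rewrite lerD2l -mulr_sumr exchange_big /=.
have -> : 2 * M * k%:R / (eta ^+ 2 * q.+1%:R) = 2 * M / eta ^+ 2 * (k%:R * q.+1%:R^-1).
  by field; rewrite ?gt_eqF//= addrC natr1.
rewrite ler_wpM2l ?divr_ge0 ?mulr_ge0 ?exprn_ge0 ?(ltW eta0)//.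
rewrite (le_trans (ler_sum _ (fun i _ => bern_variance (p01 i))))//.
by rewrite sumr_const card_ord mulr_natl.
Qed.

End Bernstein.

(** * Trigonometric approximation on cubes with a global bound *)

Section TrigApprox.
Variables (R : realType) (k : nat) (f : 'rV[R]_k -> R) (M : R).
Hypothesis (cf : continuous f) (fM : forall x, `|f x| <= M).

(** On [[- s1, s1]], which stays away from 1 and -1, the arcsine is continuous; [1 / 2] is the
    largest value of [x_i / rho] on the cube [|x_i| <= rho / 2]. *)
Let s1 : R := sin (2^-1).

Let half_lt : 2^-1 < pi / 2 :> R.
Proof.
rewrite (@lt_le_trans _ _ 1)//; first by rewrite invf_lt1// ltr1n.
by rewrite ler_pdivlMr// mul1r pi_ge2.
Qed.

Let s1_bounds : 0 < s1 < 1.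
Proof.
have h0 : 0 < 2^-1 :> R by rewrite invr_gt0.
apply/andP; split; first by apply: sin_gt0_pihalf; rewrite h0 half_lt.
rewrite -(@sin_pihalf R); rewrite ltr_sin// in_itv/= ?lexx ?andbT.
  by rewrite (ltW half_lt) andbT (le_trans _ (ltW h0))// oppr_le0 divr_ge0// pi_ge0.
by rewrite (@le_trans _ _ 0)// ?oppr_le0 divr_ge0// pi_ge0.
Qed.

Let clamp (y : R) : R := Num.max (- s1) (Num.min s1 y).

Let clamp_itv y : - s1 <= clamp y <= s1.
Proof.
have /andP[s0 _] := s1_bounds.
rewrite /clamp le_max lexx ge_max ge_min lexx /= andbT; lra.
Qed.

Let clamp_id y : - s1 <= y <= s1 -> clamp y = y.
Proof. by move=> /andP[y1 y2]; rewrite /clamp min_r// max_r. Qed.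

Let clamp_cont : continuous clamp.
Proof.
move=> y; apply: (@continuous_max R R (fun _ => - s1) (fun z => Num.min s1 z)); first exact: cvg_cst.
by apply: (@continuous_min R R (fun _ => s1) id); [exact: cvg_cst|exact: cvg_id].
Qed.

Let A (rho y : R) : R := rho * asin (clamp y).

Let A_cont rho : continuous (A rho).
Proof.
move=> y; apply: cvgMl_tmp.
apply: (@continuous_comp _ _ _ clamp asin); first exact: clamp_cont.
apply: continuous_asin; have /andP[s0 s11] := s1_bounds; have /andP[? ?] := clamp_itv y; apply/andP; split; lra.
Qed.

Let A_sin rho u : 0 < rho -> `|u| <= rho / 2 -> A rho (sin (rho^-1 * u)) = u.
Proof.
move=> r0 ur; set v := rho^-1 * u.
have v2 : - 2^-1 <= v <= 2^-1.
  rewrite -ler_norml /v normrM gtr0_norm ?invr_gt0// mulrC ler_pdivrMr// mulrC.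
  by move: ur; rewrite mulrC.
have hv : v \in `[- (pi / 2), pi / 2].
  by rewrite in_itv/=; move: half_lt v2 => + /andP[? ?]; move=> ?; apply/andP; split; lra.
have hh : (2^-1 : R) \in `[- (pi / 2), pi / 2].
  by rewrite in_itv/=; move: half_lt => ?; apply/andP; split; lra.
have hhN : (- 2^-1 : R) \in `[- (pi / 2), pi / 2].
  by rewrite in_itv/=; move: half_lt => ?; apply/andP; split; lra.
rewrite /A clamp_id; first by rewrite sinK// /v mulVKf ?gt_eqF.
by case/andP: v2 => v1 v2; rewrite /s1 -sinN !leNgt !ltr_sin// -!leNgt v1 v2.
Qed.

(** The substitution [p_i = (1 + sin (x_i / rho)) / 2] maps the whole space into the unit cube and
    is inverted by an arcsine where [|x_i| <= rho / 2]. The Bernstein polynomial of [f] read in the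
    variables [p_i] is a trigonometric polynomial in [x]; being a weighted average of values of [f],
    it is bounded by [M] everywhere. *)
Lemma trig_approx (rho e : R) : 0 < rho -> 0 < e -> exists T : 'rV[R]_k -> R,
  [/\ trig_poly T, (forall x, `|T x| <= M) &
      forall x : 'rV[R]_k, (forall i, `|x 0 i| <= rho / 2) -> `|T x - f x| <= e].
Proof.
move=> r0 e0.
pose G (p : 'rV[R]_k) : R := f (\row_i A rho (2 * p 0 i - 1)).
have GM x : `|G x| <= M by exact: fM.
have M0 : 0 <= M by rewrite (le_trans _ (fM 0)).
have cG : continuous G.
  move=> p; apply: (@continuous_comp _ _ _ (fun p : 'rV[R]_k => \row_i A rho (2 * p 0 i - 1)) f); last exact: cf.
  move=> U [Q nQ QU] /=.
  have h i : \forall q \near p, Q 0 i (A rho (2 * (q : 'rV[R]_k) 0 i - 1)).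
    have := nQ 0 i; rewrite mxE.
    apply: (@continuous_comp _ _ _ (fun q : 'rV[R]_k => 2 * q 0 i - 1) (A rho)); last exact: A_cont.
    apply: continuousB; last exact: cst_continuous.
    by apply: continuousM; [exact: cst_continuous|exact: coord_continuous].
  change (nbhs p (fun q : 'rV[R]_k => U (\row_i A rho (2 * q 0 i - 1)))).
  have hall := @filter_forall _ _ _ (nbhs p) (nbhs_filter p) h.
  apply: (@filterS _ (nbhs p) (nbhs_filter p) _ _ _ hall) => q hq.
  by apply: QU => i j; rewrite mxE ord1; exact: hq.
have e20 : 0 < e / 2 by rewrite divr_gt0.
have cK : compact [set p : 'rV[R]_k | forall i, `[0, 1]%classic (p ord0 i)].
  by apply: (@rV_compact R k (fun=> `[0, 1]%classic)) => i; exact: segment_compact.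
have [eta eta0 heta] := compact_unif_cont cG cK e20.
(* Makes the Chebyshev term of [bern_approx] at most [e / 2]. *)
pose q := `|Num.ceil (2 * M * k%:R / eta ^+ 2 / (e / 2))|%N.
pose pp (x : 'rV[R]_k) : 'rV[R]_k := \row_i ((1 + sin (rho^-1 * x 0 i)) / 2).
have pp01 x i : 0 <= pp x 0 i <= 1.
  rewrite mxE; have := sin_geN1 (rho^-1 * x 0 i); have := sin_le1 (rho^-1 * x 0 i).
  by move: (sin _) => s ? ?; apply/andP; split; lra.
exists (fun x => \sum_(b : {ffun 'I_k * 'I_q.+1 -> bool}) bern_weight (pp x 0) b * G (bern_node R b)).
split.
- apply: trig_sum => b; under eq_fun do rewrite mulrC; apply: trig_scale.
  apply: trig_prod => z.
  have tp : trig_poly (fun x => pp x 0 z.1).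
    have -> : (fun x => pp x 0 z.1) = (fun x => 2^-1 + 2^-1 * sin (rho^-1 * x 0 z.1)).
      by apply/funext => x; rewrite mxE; field.
    by apply: trig_add; [exact: trig_cst|apply: trig_scale; exact: trig_sin].
  case: (b z) => //.
  have -> : (fun x => 1 - pp x 0 z.1) = (fun x => 1 + (-1) * pp x 0 z.1).
    by apply/funext => x; rewrite mulN1r.
  by apply: trig_add; [exact: trig_cst|exact: trig_scale].
- move=> x; rewrite (le_trans (ler_norm_sum _ _ _))//.
  rewrite (@le_trans _ _ (\sum_(b : {ffun 'I_k * 'I_q.+1 -> bool}) bern_weight (pp x 0) b * M))//.
    apply: ler_sum => b _; rewrite normrM ger0_norm ?bern_weight_ge0//.
    by rewrite ler_wpM2l// bern_weight_ge0.
  by rewrite -mulr_suml bern_weight_sum mul1r.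
move=> x xr.
have Gpp : G (pp x) = f x.
  rewrite /G; congr f; apply/rowP => i; rewrite !mxE.
  have -> : 2 * ((1 + sin (rho^-1 * x 0 i)) / 2) - 1 = sin (rho^-1 * x 0 i) by field.
  exact: A_sin.
rewrite -Gpp.
apply: (le_trans (bern_approx q eta0 (ltW e20) GM (pp01 x) _)).
  move=> y xy; apply: ltW; apply: heta => // i /=; rewrite in_itv/=; exact: pp01.
have hq : 2 * M * k%:R / eta ^+ 2 / (e / 2) <= q.+1%:R.
  rewrite (le_trans (ceil_ge _))//.
  apply: (@le_trans _ _ (q%:R)); last by rewrite ler_nat.
  by rewrite natr_absz ler_int ler_norm.
rewrite [leRHS](splitr e) lerD2l.
move: hq; rewrite ler_pdivrMr// ler_pdivrMr ?exprn_gt0// => hq.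
rewrite ler_pdivrMr ?mulr_gt0 ?exprn_gt0// (le_trans hq)//.
by rewrite [leLHS]mulrAC [leLHS]mulrC; nra.
Qed.

End TrigApprox.

Section ContinuousStatistics.
Variables (R : realType) (k : nat).

Lemma fmom_dotr (d0 : measure_display) (U : measurableType d0) (Q : probability U R)
    (Z : U -> 'rV[R]_k) t : (forall i, fmom Q (fun s => Z s 0 i)) -> fmom Q (fun s => dotr t (Z s)).
Proof.
move=> fZ; under eq_fun do rewrite dotrE.
apply: fmom_sum => i _; under eq_fun do rewrite mulrC; exact: fmomZ.
Qed.

Lemma fmom_bounded_rV (d0 : measure_display) (U : measurableType d0) (Q : probability U R)
    (Z : U -> 'rV[R]_k) (g : 'rV[R]_k -> R) M : (forall i, fmom Q (fun s => Z s 0 i)) ->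
  continuous g -> (forall x, `|g x| <= M) -> fmom Q (fun s => g (Z s)).
Proof.
move=> fZ cg gM; apply: fmom_bounded => //.
apply: (measurableT_comp (continuous_measurable_rV cg)).
by apply: measurable_rV => i; have [] := fZ i.
Qed.

Lemma fmom_trig (d0 : measure_display) (U : measurableType d0) (Q : probability U R)
    (Z : U -> 'rV[R]_k) (g : 'rV[R]_k -> R) : (forall i, fmom Q (fun s => Z s 0 i)) ->
  trig_poly g -> fmom Q (fun s => g (Z s)).
Proof.
move=> fZ [s gs]; under eq_fun do rewrite gs.
apply: fmom_sum => p _; apply: fmomZ; apply: fmom_cos.
by have [] := fmom_dotr p.1.2 fZ.
Qed.

End ContinuousStatistics.

(** * From moments to bounded continuous functions *)

Section WeakConvergence.
Variables (R : realType) (k : nat).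
Context {d d' : measure_display} {T : measurableType d} {T' : measurableType d'}.
Variables (P : probability T R) (nu : probability T' R).
Variables (Y : nat -> T -> 'rV[R]_k) (Z : T' -> 'rV[R]_k).
Hypothesis fY : forall n i, (0 < n)%N -> fmom P (fun s => Y n s 0 i).
Hypothesis fZ : forall i, fmom nu (fun x => Z x 0 i).
Hypothesis moments : forall (t : 'rV[R]_k) m,
  mean P (fun s => dotr t (Y n s) ^+ m) @[n --> \oo] --> mean nu (fun x => dotr t (Z x) ^+ m).
Hypothesis determined : forall t : 'rV[R]_k,
  mean nu (fun x => dotr t (Z x) ^+ (2 * q)) / (2 * q)`!%:R @[q --> \oo] --> (0 : R).

Lemma trig_mean_cvg g : trig_poly g ->
  mean P (fun s => g (Y n s)) @[n --> \oo] --> mean nu (fun x => g (Z x)).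
Proof.
move=> [s gs].
have fc (d0 : measure_display) (U : measurableType d0) (Q : probability U R) (Q0 : U -> 'rV[R]_k)
    (p : R * 'rV[R]_k * R) : (forall i, fmom Q (fun s => Q0 s 0 i)) ->
    fmom Q (fun s => cos (dotr p.1.2 (Q0 s) + p.2)).
  by move=> fQ0; apply: fmom_cos; have [] := fmom_dotr p.1.2 fQ0.
have e (d0 : measure_display) (U : measurableType d0) (Q : probability U R) (Q0 : U -> 'rV[R]_k) :
    (forall i, fmom Q (fun s => Q0 s 0 i)) ->
    mean Q (fun s => g (Q0 s)) = \sum_(p <- s) p.1.1 * mean Q (fun s => cos (dotr p.1.2 (Q0 s) + p.2)).
  move=> fQ0; under eq_fun do rewrite gs.
  rewrite mean_sum => [|p _]; last by apply: fmomZ; exact: fc.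
  by apply: eq_bigr => p _; rewrite meanZ//; exact: fc.
rewrite (e _ _ nu Z)//.
have : (\sum_(p <- s) p.1.1 * mean P (fun s => cos (dotr p.1.2 (Y n s) + p.2))) @[n --> \oo] -->
    \sum_(p <- s) p.1.1 * mean nu (fun x => cos (dotr p.1.2 (Z x) + p.2)).
  apply: cvgn_sum => p _; apply: cvgMl_tmp; apply: mean_cos_cvg => //.
    by move=> n n0; apply: fmom_dotr => i; exact: fY.
  exact: fmom_dotr fZ.
move=> h; apply/cvgn_distP => eps eps0; have [n0 hn0] := (cvgn_distP _ _).1 h _ eps0.
exists (maxn n0 1) => n; rewrite geq_max => /andP[nn0 n1]; rewrite e; first exact: hn0.
by move=> i; exact: fY.
Qed.

(** Inside a large cube [f] is close to a trigonometric polynomial; outside both are bounded by [M],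
    and Chebyshev's inequality with the converging second moments bounds the loss for all large [n]
    at once. *)
Lemma bounded_mean_cvg (f : 'rV[R]_k -> R) M : continuous f -> (forall x, `|f x| <= M) ->
  mean P (fun s => f (Y n s)) @[n --> \oo] --> mean nu (fun x => f (Z x)).
Proof.
move=> cf fM; apply/cvgn_distP => e e0.
have M0 : 0 <= M by rewrite (le_trans _ (fM 0)).
pose v i := mean nu (fun x => Z x 0 i ^+ 2).
pose W := \sum_i (v i + 1).
have v0 i : 0 <= v i by apply: mean_ge0 => x; exact: sqr_ge0.
have W0 : 0 <= W by apply: sumr_ge0 => i _; rewrite addr_ge0.
have e80 : 0 < e / 8 by rewrite divr_gt0.
(* As [rho / 2 >= 1], the tail [2 * M * W / (rho / 2) ^ 2] is at most [2 * M * W / (rho / 2)], which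
   this choice brings below [e / 8]. *)
pose rho := 2 * (1 + 2 * M * W / (e / 8)).
have b0 : 0 <= 2 * M * W / (e / 8) by rewrite divr_ge0 ?mulr_ge0// ltW.
have rho0 : 0 < rho by rewrite /rho; lra.
have [A [tA AM Af]] := trig_approx cf fM rho0 e80.
have hv i : \forall n \near \oo, mean P (fun s => Y n s 0 i ^+ 2) <= v i + 1.
  have := @moments (1 *: delta_mx 0 i) 2%N.
  have -> : mean nu (fun x => dotr (1 *: delta_mx 0 i) (Z x) ^+ 2) = v i.
    by congr mean; apply/funext => x; rewrite dotr_delta mul1r.
  move=> /cvgn_distP/(_ 1 ltr01)[n0 hn0]; exists n0 => // n nn0.
  have := hn0 n nn0.
  have -> : mean P (fun s => dotr (1 *: delta_mx 0 i) (Y n s) ^+ 2) = mean P (fun s => Y n s 0 i ^+ 2).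
    by congr mean; apply/funext => x; rewrite dotr_delta mul1r.
  by rewrite ltr_norml => /andP[_]; lra.
have [n1 _ hn1] : \forall n \near \oo, forall i, mean P (fun s => Y n s 0 i ^+ 2) <= v i + 1.
  exact: (filter_forall _ hv).
have [n2 hn2] := (cvgn_distP _ _).1 (trig_mean_cvg tA) _ e80.
have key (d0 : measure_display) (U : measurableType d0) (Q : probability U R) (Q0 : U -> 'rV[R]_k) :
    (forall i, fmom Q (fun s => Q0 s 0 i)) -> (forall i, mean Q (fun s => Q0 s 0 i ^+ 2) <= v i + 1) ->
    `|mean Q (fun s => A (Q0 s)) - mean Q (fun s => f (Q0 s))| <= e / 8 + e / 8.
  move=> fQ0 hZ.
  have fA := fmom_trig fQ0 tA; have ff := fmom_bounded_rV fQ0 cf fM.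
  rewrite -meanB//.
  pose c := 2 * M * (rho / 2) ^- 2.
  have c0 : 0 <= c by rewrite mulr_ge0 ?mulr_ge0// invr_ge0 sqr_ge0.
  have fs : fmom Q (fun s => \sum_i Q0 s 0 i ^+ 2) by apply: fmom_sum => i _; exact: fmomX.
  apply: (@le_trans _ _ (mean Q (fun s => e / 8 + c * \sum_i Q0 s 0 i ^+ 2))).
    apply: mean_abs_le; [exact: fmomB|by apply: fmomD; [exact: fmom_cst|exact: fmomZ]|].
    move=> s; have S0 : 0 <= \sum_i Q0 s 0 i ^+ 2 by apply: sumr_ge0 => i _; exact: sqr_ge0.
    have [h|/existsNP[i /negP]] := pselect (forall i, `|Q0 s 0 i| <= rho / 2).
      by rewrite (le_trans (Af _ h))// lerDl mulr_ge0.
    rewrite -ltNge => hi.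
    rewrite (le_trans (ler_normB _ _))// (@le_trans _ _ (2 * M))//.
      by rewrite mulr2n mulrDl mul1r lerD.
    rewrite -[leLHS]add0r lerD ?(ltW e80)// /c -mulrA ler_peMr ?mulr_ge0//.
    rewrite mulrC ler_pdivlMr ?mul1r; last by rewrite exprn_gt0// divr_gt0.
    rewrite (bigD1 i)//=; apply: (@le_trans _ _ (Q0 s 0 i ^+ 2)).
      rewrite -[leRHS]real_normK ?num_real// lerXn2r ?nnegrE ?divr_ge0 ?(ltW rho0)//.
      exact: ltW.
    by rewrite lerDl sumr_ge0// => j _; exact: sqr_ge0.
  rewrite meanD ?mean_cst ?meanZ//; [|exact: fmom_cst|exact: fmomZ].
  rewrite lerD2l mean_sum => [|i _]; last exact: fmomX.
  apply: (@le_trans _ _ (c * W)).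
    by rewrite ler_wpM2l// ler_sum.
  have r1 : 1 <= rho / 2 by rewrite /rho mulrC mulKf//; lra.
  have r2 : 0 < (rho / 2) ^+ 2 by rewrite exprn_gt0// (lt_le_trans ltr01).
  have h : 2 * M * W / (e / 8) <= rho / 2 by rewrite /rho; move: (_ / (e / 8)) => z; lra.
  move: h; rewrite ler_pdivrMr// => h.
  rewrite /c mulrAC ler_pdivrMr// (le_trans h)// mulrC ler_wpM2l ?(ltW e80)//.
  by rewrite expr2 ler_peMr// (le_trans ler01).
exists (maxn 1 (maxn n1 n2)) => n; rewrite !geq_max => /and3P[n0 nn1 nn2].
have k1 := key _ _ P (Y n) (fun i => fY i n0) (hn1 n nn1).
have k2 := key _ _ nu Z fZ (fun i => _).
have {}k2 := k2 _; have {}k2 := k2 (fun i => ltW (ltr_pwDr ltr01 (lexx _))).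
have k3 := hn2 n nn2.
move: k1 k2 k3; rewrite !ler_norml !ltr_norml => /andP[? ?] /andP[? ?] /andP[? ?].
by apply/andP; split; lra.
Qed.

End WeakConvergence.

Lemma cvg_in_distribution_moments (R : realType) (k : nat) (d : measure_display) (T : measurableType d)
    (P : probability T R) (nu : probability (borel_rV R k) R) (Y : nat -> T -> 'rV[R]_k) :
  (forall n i, (0 < n)%N -> fmom P (fun s => Y n s 0 i)) ->
  (forall i, fmom nu (fun x : borel_rV R k => (x : 'rV[R]_k) 0 i)) ->
  (forall (t : 'rV[R]_k) m,
    mean P (fun s => dotr t (Y n s) ^+ m) @[n --> \oo] --> mean nu (fun x => dotr t x ^+ m)) ->
  (forall t : 'rV[R]_k, mean nu (fun x => dotr t x ^+ (2 * q)) / (2 * q)`!%:R @[q --> \oo] --> (0 : R)) ->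
  cvg_in_distribution P Y nu.
Proof.
move=> fY fnu moments determined f cf [M fM].
have fZ := fmom_bounded_rV (Z := fun x : borel_rV R k => x) fnu cf fM.
have -> : (\int[nu]_x (f x)%:E)%E = (mean nu (fun x => f x))%:E.
  by rewrite /mean /Rintegral fineK//; apply: integrable_fin_num => //; exact: fmom_int.
have h := bounded_mean_cvg (Z := fun x : borel_rV R k => x) fY fnu moments determined cf fM.
have : (mean P (fun s => f (Y n s)))%:E @[n --> \oo] --> (mean nu (fun x => f x))%:E.
  by apply: cvg_EFin => //; exact: nearW.
apply: cvg_trans; apply: near_eq_cvg; exists 1%N => // n n1 /=.
have fYn := fmom_bounded_rV (fun i => fY n i n1) cf fM.
rewrite unlock /mean /Rintegral fineK//.
by apply: integrable_fin_num => //; exact: fmom_int fYn.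
Qed.

(** * Gaussian vectors *)

Section ExponentialExpansion.
Variable R : realType.
Implicit Types (t x y v : R).

Lemma series_le_expR y N : 0 <= y -> \sum_(m < N) y ^+ m / m`!%:R <= expR y.
Proof.
move=> y0; have c : cvgn (series (exp_coeff y)) by exact: is_cvg_series_exp_coeff.
have := nondecreasing_cvgn_le _ c N.
rewrite /series/= big_mkord; apply; apply/nondecreasing_seqP => n.
by rewrite /series/= big_nat_recr//= lerDl /exp_coeff/= mulr_ge0 ?invr_ge0 ?exprn_ge0.
Qed.

(** For [|t| <= 1] every term of the tail contains [|t| ^ N]. The bound separates [t] from [x] and
    can thus be integrated in [x]. *)
Lemma expR_taylor t x N : `|t| <= 1 ->
  `|expR (t * x) - \sum_(m < N) t ^+ m * (x ^+ m / m`!%:R)| <= `|t| ^+ N * expR `|x|.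
Proof.
move=> t1; have c : series (exp_coeff (t * x)) @ \oo --> expR (t * x).
  exact: is_cvg_series_exp_coeff.
pose s := \sum_(m < N) t ^+ m * (x ^+ m / m`!%:R).
have h : `|series (exp_coeff (t * x)) n - s| @[n --> \oo] --> `|expR (t * x) - s|.
  by apply: cvg_norm; apply: cvgB => //; exact: cvg_cst.
rewrite -/s -(cvg_lim _ h)//; apply: limr_le; first by apply/cvg_ex; eexists; exact: h.
exists N => // n /= Nn.
have -> : series (exp_coeff (t * x)) n - s = \sum_(N <= m < n) t ^+ m * (x ^+ m / m`!%:R).
  rewrite /series/= (big_cat_nat (n := N))//= /s big_mkord.
  rewrite [X in X + _ - _](eq_bigr (fun m : 'I_N => t ^+ m * (x ^+ m / m`!%:R))); last first.
    by move=> m _; rewrite /exp_coeff/= exprMn mulrA.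
  rewrite addrAC subrr add0r; apply: eq_bigr => m _.
  by rewrite /exp_coeff/= exprMn mulrA.
rewrite (le_trans (ler_norm_sum _ _ _))//.
apply: (@le_trans _ _ (`|t| ^+ N * \sum_(m < n) `|x| ^+ m / m`!%:R)); last first.
  by rewrite ler_wpM2l ?exprn_ge0// series_le_expR.
rewrite mulr_sumr -(big_mkord xpredT (fun m => `|t| ^+ N * (`|x| ^+ m / m`!%:R))).
rewrite [leRHS](big_cat_nat (n := N))//= -[leLHS]add0r lerD//.
  by apply: sumr_ge0 => m _; rewrite mulr_ge0 ?divr_ge0 ?exprn_ge0.
apply: ler_sum_nat => m /andP[Nm _].
rewrite normrM normrX normrM normrX normfV (normr_nat _ m`!) ler_wpM2r//.
by rewrite -(subnKC Nm) exprD ler_piMr ?exprn_ge0// exprn_ile1.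
Qed.

(** Letting [t] tend to 0 kills the constant term, and division by [t] lowers the order. This
    identifies moments from expansions, without differentiation under the integral. *)
Lemma polynomial_vanishing N (a : nat -> R) (C : R) :
  (forall t : R, 0 < t <= 1 -> `|\sum_(m < N) a m * t ^+ m| <= C * t ^+ N) ->
  forall m, (m < N)%N -> a m = 0.
Proof.
elim: N a C => [//|N ih] a C h.
have C0 : 0 <= C by have := h 1; rewrite ltr01 lexx expr1n mulr1 => /(_ isT); exact: le_trans.
pose D := C + \sum_(m < N) `|a m.+1|.
have a0 : a 0%N = 0.
  have D0 : 0 <= D by rewrite addr_ge0// sumr_ge0.
  have aD t : 0 < t <= 1 -> `|a 0%N| <= t * D.
    move=> t01; have /andP[t0 t1] := t01; have := h t t01.
    rewrite big_ord_recl expr0 mulr1 => {}h.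
    rewrite -[a 0%N](addrK (\sum_(i < N) a (lift ord0 i) * t ^+ lift ord0 i)).
    rewrite (le_trans (ler_normB _ _))// /D mulrDr lerD//.
      by rewrite (le_trans h)// mulrC ler_wpM2r// exprS ler_piMr ?exprn_ile1 ?(ltW t0).
    rewrite mulr_sumr (le_trans (ler_norm_sum _ _ _))// ler_sum// => i _.
    rewrite lift0 normrM mulrC ler_wpM2r// ger0_norm ?exprn_ge0 ?(ltW t0)//.
    by rewrite exprS ler_piMr ?exprn_ile1 ?(ltW t0).
  apply/eqP; rewrite -normr_eq0 eq_le normr_ge0 andbT leNgt; apply/negP => e0.
  (* So small that [t * D < |a 0|], against [aD]. *)
  pose t := Num.min 1 (`|a 0%N| / (2 * (D + 1))).
  have t0 : 0 < t by rewrite lt_min ltr01 divr_gt0// mulr_gt0// ltr_wpDl.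
  have := aD t; rewrite t0 ge_min lexx => /(_ isT).
  have : t * (2 * (D + 1)) <= `|a 0%N|.
    by rewrite -ler_pdivlMr ?ge_min ?lexx ?orbT// mulr_gt0// ltr_wpDl.
  by have := mulr_ge0 (ltW t0) D0; move: t0; clearbody t D; clear; lra.
have {}ih := ih (fun m => a m.+1) C.
move=> [//|m] mN; apply: ih => // t /andP[t0 t1].
have := h t; rewrite t0 t1 => /(_ isT).
rewrite big_ord_recl a0 mul0r add0r.
under eq_bigr => i _ do rewrite lift0 exprS mulrCA.
by rewrite -mulr_sumr normrM gtr0_norm// exprS mulrCA ler_pM2l.
Qed.

(** The right-hand side is the coefficient of [t ^ (2 * q)] in [exp (v * t ^ 2 / 2)]; as the general
    term of an exponential series it tends to 0, which is the determinacy condition. *)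
Lemma gauss_moment_even v q : gauss_moment v (2 * q) / (2 * q)`!%:R = (v / 2) ^+ q / q`!%:R.
Proof.
elim: q => [|q ih]; first by rewrite muln0 expr0.
rewrite mulnS add2n /= !factS !natrM exprS.
have -> : q`!%:R = (q`!%:R : R) by [].
have f0 n : n`!%:R != 0 :> R by rewrite pnatr_eq0 -lt0n fact_gt0.
have s0 n : n.+1%:R != 0 :> R by rewrite pnatr_eq0.
apply: (mulIf (s0 (2 * q).+1)); apply: (mulIf (f0 (2 * q)%N)).
move/(canRL (divfK (f0 _))): ih => ->.
have -> : (2 * q).+2%:R = 2 * q.+1%:R :> R by rewrite -natrM mulnS.
have := f0 q; have := f0 (2 * q)%N; have := s0 q; have := s0 (2 * q)%N.
move: (v / 2 ^+ q) => w; move: (q`!%:R) ((2 * q)`!%:R) (q.+1%:R) ((2 * q).+1%:R) => A B C D.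
by move=> *; field; do ?[apply/andP; split].
Qed.

Lemma gauss_moment_odd v q : gauss_moment v (2 * q).+1 = 0.
Proof. by elim: q => [//|q ih]; rewrite mulnS add2n /= -/(gauss_moment v (2 * q).+1) ih !mulr0. Qed.

Lemma gauss_moment_determined v :
  gauss_moment v (2 * q) / (2 * q)`!%:R @[q --> \oo] --> (0 : R).
Proof.
under eq_fun do rewrite gauss_moment_even.
exact: (cvg_series_cvg_0 (is_cvg_series_exp_coeff (v / 2))).
Qed.

Lemma gauss_mgf_expansion v t N : 0 <= v -> `|t| <= 1 ->
  `|expR (v * t ^+ 2 / 2) - \sum_(m < 2 * N) t ^+ m * (gauss_moment v m / m`!%:R)| <=
    `|t| ^+ (2 * N) * expR (v / 2).
Proof.
move=> v0 t1.
have t21 : `|t ^+ 2| <= 1 by rewrite normrX exprn_ile1.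
have := expR_taylor (v / 2) N t21.
rewrite normrX -exprM (ger0_norm (divr_ge0 v0 (ler0n _ 2))).
have -> : t ^+ 2 * (v / 2) = v * t ^+ 2 / 2 by ring.
suff -> : \sum_(m < 2 * N) t ^+ m * (gauss_moment v m / m`!%:R) =
  \sum_(m < N) (t ^+ 2) ^+ m * ((v / 2) ^+ m / m`!%:R) by [].
elim: N => [|N ih]; first by rewrite muln0 !big_ord0.
rewrite mulnS add2n !big_ord_recr.
rewrite -[LHS]/(\sum_(m < 2 * N) t ^+ m * (gauss_moment v m / m`!%:R) +
  t ^+ (2 * N) * (gauss_moment v (2 * N) / (2 * N)`!%:R) +
  t ^+ (2 * N).+1 * (gauss_moment v (2 * N).+1 / (2 * N).+1`!%:R)).
rewrite ih gauss_moment_odd mul0r mulr0 addr0.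
by rewrite -gauss_moment_even -exprM.
Qed.

End ExponentialExpansion.

(** * Moments from a Gaussian moment generating function *)

Section MomentGeneratingFunction.
Variables (R : realType) (d : measure_display) (T : measurableType d) (P : probability T R).
Variables (Y : T -> R) (v : R).
Hypothesis v0 : 0 <= v.
Hypothesis mY : measurable_fun setT Y.
Hypothesis mgf : forall t : R, (\int[P]_x (expR (t * Y x))%:E = (expR (v * t ^+ 2 / 2))%:E)%E.

Let integrable_mgf t : P.-integrable setT (fun x => (expR (t * Y x))%:E).
Proof.
apply/integrableP; split.
  by apply/measurable_EFinP; apply: measurableT_comp => //; exact: measurable_funM.
under eq_integral do rewrite /= ger0_norm ?expR_ge0//.
by rewrite mgf ltry.
Qed.

Let expR_norm (y : R) : expR `|y| <= expR y + expR (- y).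
Proof.
by have [y0|y0] := leP 0 y; rewrite ?(ger0_norm y0) ?(ltr0_norm y0) ?lerDl ?lerDr ?expR_ge0.
Qed.

(** [|y| ^ p / p!] is one term of [exp |y|], which [exp y + exp (- y)] dominates. *)
Lemma fmom_mgf : fmom P Y.
Proof.
split => // p.
have h : P.-integrable setT (fun x => (p`!%:R * (expR (1 * Y x) + expR (- 1 * Y x)))%:E).
  under eq_fun do rewrite EFinM EFinD.
  by apply: integrableZl => //; apply: integrableD.
apply: le_integrable h => //.
  by apply/measurable_EFinP; apply: measurable_funX; exact: measurableT_comp.
move=> x _; rewrite /= lee_fin mul1r mulN1r normrX normr_id.
rewrite [leRHS]ger0_norm; last by rewrite mulr_ge0// addr_ge0 ?expR_ge0.
rewrite -ler_pdivrMl ?ltr0n ?fact_gt0// mulrC.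
apply: le_trans (expR_norm _).
apply: le_trans (series_le_expR p.+1 (normr_ge0 (Y x))).
by rewrite big_ord_recr/= lerDr sumr_ge0// => i _; rewrite divr_ge0 ?exprn_ge0.
Qed.

Let fmom_exp t : fmom P (fun x => expR (t * Y x)).
Proof.
split => [|p]; first by apply: measurableT_comp => //; exact: measurable_funM.
have := integrable_mgf (p%:R * t); congr (integrable _ _ _); apply/funext => x.
by rewrite ger0_norm ?expR_ge0// -expRM_natl mulrA.
Qed.

(** The mean of the truncated exponential series and the expansion of [exp (v * t ^ 2 / 2)] agree up
    to [O(t ^ (2 * m.+1))], so [polynomial_vanishing] matches their coefficients. The order is even
    because [gauss_mgf_expansion] advances two terms at a time. *)
Lemma mean_mgf m : mean P (fun x => Y x ^+ m) = gauss_moment v m.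
Proof.
pose a j := (mean P (fun x => Y x ^+ j) - gauss_moment v j) / j`!%:R.
suff : a m = 0.
  move/eqP; rewrite mulf_eq0 invr_eq0 pnatr_eq0 -[_`! == _]negbK -lt0n fact_gt0/= orbF subr_eq0.
  by move/eqP.
have fY := fmom_mgf.
apply: (@polynomial_vanishing R (2 * m.+1) a (3 * expR (v / 2))); last by lia.
move=> t /andP[t0 t1].
have at1 : `|t| <= 1 by rewrite gtr0_norm.
have mE s : mean P (fun x => expR (s * Y x)) = expR (v * s ^+ 2 / 2).
  by rewrite /mean /Rintegral mgf.
have fS : fmom P (fun x => \sum_(j < 2 * m.+1) t ^+ j * (Y x ^+ j / j`!%:R)).
  apply: fmom_sum => j _; apply: fmomZ; under eq_fun do rewrite mulrC.
  by apply: fmomZ; exact: fmomX.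
have SE : mean P (fun x => \sum_(j < 2 * m.+1) t ^+ j * (Y x ^+ j / j`!%:R)) =
    \sum_(j < 2 * m.+1) t ^+ j * (mean P (fun x => Y x ^+ j) / j`!%:R).
  rewrite mean_sum => [|j _]; last first.
    apply: fmomZ; under eq_fun do rewrite mulrC.
    by apply: fmomZ; exact: fmomX.
  apply: eq_bigr => j _; under eq_fun do rewrite [_ / _]mulrC mulrA.
  by rewrite meanZ ?mulrA; [rewrite mulrAC|exact: fmomX].
have h1 : `|expR (v * t ^+ 2 / 2) - \sum_(j < 2 * m.+1) t ^+ j * (mean P (fun x => Y x ^+ j) / j`!%:R)| <=
    t ^+ (2 * m.+1) * (2 * expR (v / 2)).
  rewrite -mE -SE -meanB//.
  have -> : 2 * expR (v / 2) = mean P (fun x => expR (1 * Y x) + expR (- 1 * Y x)).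
    by rewrite meanD ?mE// sqrrN expr1n mulr1; ring.
  rewrite -meanZ; last exact: fmomD.
  apply: mean_abs_le; [exact: fmomB|by apply: fmomZ; exact: fmomD|].
  move=> x; apply: (le_trans (expR_taylor _ _ at1)).
  by rewrite gtr0_norm// ler_wpM2l ?exprn_ge0 ?(ltW t0)// mul1r mulN1r.
have h2 := gauss_mgf_expansion m.+1 v0 at1; rewrite [X in X ^+ _ * _]gtr0_norm// in h2.
have -> : \sum_(j < 2 * m.+1) a j * t ^+ j =
    \sum_(j < 2 * m.+1) t ^+ j * (mean P (fun x => Y x ^+ j) / j`!%:R) -
    \sum_(j < 2 * m.+1) t ^+ j * (gauss_moment v j / j`!%:R).
  by rewrite -sumrB; apply: eq_bigr => j _; rewrite /a; ring.
move: h1 h2; set A := \sum_(j < _) _; set B := \sum_(j < _) _; set e := expR (v * _ / 2).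
rewrite !ler_norml => /andP[? ?] /andP[? ?]; apply/andP; split; lra.
Qed.

End MomentGeneratingFunction.

Lemma pushforward_probability (R : realType) (d d' : measure_display) (T : measurableType d)
    (T' : measurableType d') (P : probability T R) (Y : T -> T') : measurable_fun setT Y ->
  exists nu : probability T' R, (forall A, nu A = P (Y @^-1` A)) /\
    forall g : T' -> \bar R, measurable_fun setT g -> (forall y, 0 <= g y)%E ->
      (\int[nu]_y g y = \int[P]_x g (Y x))%E.
Proof.
move=> mY; pose F : {mfun T >-> T'} := HB.pack Y (isMeasurableFun.Build _ _ _ _ Y mY).
exists (distribution P F : probability T' R); split => // g mg g0.
exact: (@ge0_integral_distribution _ _ _ _ _ P F).
Qed.

(** * Uniqueness of laws on the real line *)

Section LawUniqueness.
Context {R : realType} {d d' : measure_display} {T : measurableType d} {T' : measurableType d'}.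
Variables (P : probability T R) (Q : probability T' R).

(** Continuous ramps increasing to the indicator of an open ray carry equality of means over from
    continuous functions to rays. *)
Lemma clamp_indicator_cvg (a x : R) :
  Num.min 1 (Num.max 0 (n%:R * (a - x))) @[n --> \oo] --> ((x < a)%R%:R : R).
Proof.
have [xa|ax] := ltP x a; last first.
  have -> : (fun n => Num.min 1 (Num.max 0 (n%:R * (a - x)))) = fun n : nat => 0 : R.
    apply/funext => n; rewrite (max_idPl _) ?mulr_ge0_le0 ?subr_le0//.
    by rewrite (min_idPr _).
  exact: cvg_cst.
have a0 : 0 < a - x by rewrite subr_gt0.
apply/cvgn_distP => e e0; exists (`|Num.ceil (a - x)^-1|%N) => n hn.
have : (a - x)^-1 <= n%:R.
  rewrite (le_trans (ceil_ge _))// (@le_trans _ _ (`|Num.ceil (a - x)^-1|%N)%:R) ?ler_nat//.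
  by rewrite natr_absz ler_int ler_norm.
rewrite -[_^-1]mul1r ler_pdivrMr// => h1.
rewrite (max_idPr _) ?mulr_ge0 ?(ltW a0)// (min_idPl _)//.
by rewrite subrr normr0.
Qed.

Lemma clamp_bound (a x : R) (n : nat) : `|Num.min 1 (Num.max 0 (n%:R * (a - x)))| <= 1.
Proof. by rewrite ger0_norm ?ge_min ?lexx// le_min ler01 le_max lexx. Qed.

Lemma clamp_continuous (a : R) (n : nat) :
  continuous (fun x : R => Num.min 1 (Num.max 0 (n%:R * (a - x))) : R).
Proof.
move=> x; apply: (@continuous_min R R (fun=> 1) (fun x : R => Num.max 0 (n%:R * (a - x)))).
  exact: cvg_cst.
apply: (@continuous_max R R (fun=> 0) (fun x : R => n%:R * (a - x))).
  exact: cvg_cst.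
by apply: cvgMl_tmp; apply: cvgB; [exact: cvg_cst|exact: cvg_id].
Qed.

Lemma mean_ray_cvg (d0 : measure_display) (U : measurableType d0) (W : probability U R) (F : U -> R) a :
  measurable_fun setT F ->
  (mean W (fun s => Num.min 1 (Num.max 0 (n%:R * (a - F s)))))%:E @[n --> \oo] -->
  W (F @^-1` `]-oo, a[).
Proof.
move=> mF; have mA : measurable (F @^-1` `]-oo, a[) by rewrite -[X in measurable X]setTI; exact: mF.
have mf n : measurable_fun setT (fun s => Num.min 1 (Num.max 0 (n%:R * (a - F s))) : R).
  apply: (measurableT_comp (f := fun x : R => Num.min 1 (Num.max 0 (n%:R * (a - x))) : R)) => //.
  exact: continuous_measurable_fun (@clamp_continuous a n).
have -> : W (F @^-1` `]-oo, a[) = (\int[W]_s ((F s < a)%R%:R : R)%:E)%E.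
  rewrite -[LHS]mul1e -integral_cst// [LHS]integral_mkcond.
  apply: eq_integral => s _; rewrite patchE.
  case: ifPn; first by rewrite inE /= in_itv /= => ->.
  by rewrite notin_setE /= in_itv /= => /negP/negbTE ->.
have -> : (fun n => (mean W (fun s => Num.min 1 (Num.max 0 (n%:R * (a - F s)))))%:E) =
    (fun n => \int[W]_s (Num.min 1 (Num.max 0 (n%:R * (a - F s))))%:E)%E.
  apply/funext => n; rewrite /mean /Rintegral fineK//; apply: integrable_fin_num => //.
  by apply: fmom_int; apply: (@fmom_bounded _ _ _ _ _ 1); [exact: mf|move=> x; exact: clamp_bound].
apply: (@dominated_cvg _ _ _ _ _ measurableT _ _ (fun=> 1%E)) => //.
- by move=> n; apply/measurable_EFinP; exact: mf.
- move=> s _; apply: cvg_EFin; first exact: nearW.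
  exact: clamp_indicator_cvg.
- exact: finite_measure_integrable_cst.
- by move=> n s _; rewrite /= lee_fin clamp_bound.
Qed.

(** Open left rays are stable under intersection and generate the Borel sets, so two probability
    measures that agree on them coincide. *)
Lemma law_eq_continuous (Y : T -> R) (Z : T' -> R) :
  measurable_fun setT Y -> measurable_fun setT Z ->
  (forall f : R -> R, continuous f -> (forall x, `|f x| <= 1) ->
     mean P (fun s => f (Y s)) = mean Q (fun s => f (Z s))) ->
  forall A : set R, measurable A -> P (Y @^-1` A) = Q (Z @^-1` A).
Proof.
move=> mY mZ h.
have eray a : P (Y @^-1` `]-oo, a[) = Q (Z @^-1` `]-oo, a[).
  have h1 := mean_ray_cvg (W := P) (a := a) mY; have h2 := mean_ray_cvg (W := Q) (a := a) mZ.
  have e n : mean P (fun s => Num.min 1 (Num.max 0 (n%:R * (a - Y s)))) =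
      mean Q (fun s => Num.min 1 (Num.max 0 (n%:R * (a - Z s)))).
    exact: (h _ (@clamp_continuous a n) (fun x => clamp_bound a x n)).
  have {}h1 : (mean Q (fun s => Num.min 1 (Num.max 0 (n%:R * (a - Z s)))))%:E @[n --> \oo] -->
      P (Y @^-1` `]-oo, a[) by under eq_fun do rewrite -e.
  by have := cvg_unique _ h1 h2; apply.
have [PY [PYE _]] := pushforward_probability P mY.
have [QZ [QZE _]] := pushforward_probability Q mZ.
move=> A mA; rewrite -PYE -QZE.
apply: (@measure_unique _ _ _ (@RGenInftyO.G R) (fun n => `]-oo, n%:R[%classic)) => //.
- exact: RGenInftyO.measurableE.
- move=> _ _ [x ->] [y ->]; exists (Num.min x y); apply/seteqP; split => z /=; rewrite !in_itv/= lt_min.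
    by move=> [-> ->].
  by move=> /andP.
- by move=> i; exists i%:R.
- apply/seteqP; split => // x _; exists (`|Num.ceil (`|x| + 1)|%N) => //=.
  rewrite in_itv/= (@lt_le_trans _ _ (`|x| + 1))//.
    by rewrite (le_lt_trans (ler_norm _))// ltrDl.
  by rewrite (le_trans (ceil_ge _))// natr_absz ler_int ler_norm.
- by move=> _ [a ->]; apply: etrans (PYE _) _; exact: etrans (eray a) (esym (QZE _)).
- by move=> n; apply: (@le_lt_trans _ _ 1%E); [apply: probability_le1; exact: measurable_itv|exact: ltry].
Qed.

(** Both variables have the same Gaussian moments. [bounded_mean_cvg] is then applied to the
    constant sequence [Y] with limit [Z]: convergence of a constant sequence is equality. *)
Lemma law_eq_mgf (Y : T -> R) (Z : T' -> R) (v : R) : 0 <= v ->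
  measurable_fun setT Y -> measurable_fun setT Z ->
  (forall t : R, (\int[P]_x (expR (t * Y x))%:E = (expR (v * t ^+ 2 / 2))%:E)%E) ->
  (forall t : R, (\int[Q]_x (expR (t * Z x))%:E = (expR (v * t ^+ 2 / 2))%:E)%E) ->
  forall A : set R, measurable A -> P (Y @^-1` A) = Q (Z @^-1` A).
Proof.
move=> v0 mY mZ hY hZ; apply: law_eq_continuous => // f cf f1.
have fY := fmom_mgf mY hY; have fZ := fmom_mgf mZ hZ.
pose row1 (y : R) : 'rV[R]_1 := \row_(_ < 1) y.
have dE (t : 'rV[R]_1) y : dotr t (row1 y) = t 0 0 * y.
  by rewrite dotrE big_ord_recl big_ord0 addr0 mxE mulrC.
have mm (d0 : measure_display) (U : measurableType d0) (W : probability U R) (F : U -> R) (t : 'rV[R]_1) m :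
    fmom W F -> mean W (fun s => dotr t (row1 (F s)) ^+ m) = t 0 0 ^+ m * mean W (fun s => F s ^+ m).
  move=> fF; under eq_fun do rewrite dE exprMn.
  by rewrite meanZ//; exact: fmomX.
have fr (d0 : measure_display) (U : measurableType d0) (W : probability U R) (F : U -> R) :
    fmom W F -> forall i, fmom W (fun s => row1 (F s) 0 i).
  by move=> fF i; under eq_fun do rewrite mxE.
have cfr : continuous (fun x : 'rV[R]_1 => f (x 0 0)).
  move=> x; apply: (@continuous_comp _ _ _ (fun x : 'rV[R]_1 => x 0 0) f); last exact: cf.
  exact: coord_continuous.
have := @bounded_mean_cvg R 1 d d' T T' P Q (fun=> row1 \o Y) (row1 \o Z) _ _ _ _
  (fun x : 'rV[R]_1 => f (x 0 0)) 1 cfr (fun x => f1 _).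
have -> : (fun s => f ((row1 \o Y) s 0 0)) = f \o Y by apply/funext => s /=; rewrite mxE.
have -> : (fun s => f ((row1 \o Z) s 0 0)) = f \o Z by apply/funext => s /=; rewrite mxE.
move=> hc; suff hc' : mean P (f \o Y) @[_ --> \oo] --> mean Q (f \o Z).
  by have := cvg_unique _ (cvg_cst (mean P (f \o Y))) hc'; apply.
apply: hc.
- by move=> n i _; exact: fr.
- by move=> i; exact: fr.
- move=> t m; rewrite !mm//; rewrite (mean_mgf v0 mY hY) (mean_mgf v0 mZ hZ); exact: cvg_cst.
- move=> t; under eq_fun do rewrite mm// (mean_mgf v0 mZ hZ).
  have -> : (fun q => t 0 0 ^+ (2 * q) * gauss_moment v (2 * q) / (2 * q)`!%:R) =
      fun q => gauss_moment (t 0 0 ^+ 2 * v) (2 * q) / (2 * q)`!%:R.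
    apply/funext => q; rewrite -mulrA !gauss_moment_even exprM.
    by rewrite -(mulrA _ v) [(_ * (v / 2)) ^+ q]exprMn mulrA.
  exact: gauss_moment_determined.
Qed.

End LawUniqueness.

Section NormalLaw.
Variable R : realType.

(** The change of variables goes through the Radon-Nikodym derivative, which agrees almost
    everywhere with the density since both have the same integrals over measurable sets. *)
Lemma integral_normal_prob (s : R) (g : R -> \bar R) : measurable_fun setT g -> (forall x, 0 <= g x)%E ->
  (\int[normal_prob 0 s]_x g x = \int[lebesgue_measure]_x (g x * (normal_pdf 0 s x)%:E))%E.
Proof.
move=> mg g0; have dom := normal_prob_dominates 0 s.
rewrite -(Radon_Nikodym_SigmaFinite.change_of_variables dom g0 measurableT mg).
have iF := Radon_Nikodym_SigmaFinite.f_integrable dom.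
have mpdf : measurable_fun setT (fun x : R => (normal_pdf 0 s x)%:E).
  by apply/measurable_EFinP; exact: measurable_normal_pdf.
apply: ae_eq_integral => //.
- by apply: emeasurable_funM => //; exact: measurable_int iF.
- exact: emeasurable_funM.
- apply: ae_eqe_mul2l; apply: integral_ae_eq => // E _ mE.
  by rewrite -Radon_Nikodym_SigmaFinite.f_integral.
Qed.

Lemma normal_mgf (s t : R) : s != 0 ->
  (\int[normal_prob 0 s]_x (expR (t * x))%:E = (expR (s ^+ 2 * t ^+ 2 / 2))%:E)%E.
Proof.
move=> s0; rewrite integral_normal_prob//; last first.
  by apply/measurable_EFinP; apply: measurableT_comp => //; exact: measurable_funM.
(* Completing the square moves the mean to [s ^ 2 * t]. *)
have e x : ((expR (t * x))%:E * (normal_pdf 0 s x)%:E =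
    (expR (s ^+ 2 * t ^+ 2 / 2))%:E * (normal_pdf (s ^+ 2 * t) s x)%:E)%E.
  rewrite -!EFinM !normal_pdfE//; congr EFin; rewrite mulrCA [RHS]mulrCA; congr (_ * _).
  rewrite /normal_fun -!expRD; congr expR.
  by field.
under eq_integral do rewrite e.
rewrite ge0_integralZl//= ?integral_normal_pdf ?mule1//.
- by apply/measurable_EFinP; exact: measurable_normal_pdf.
- by move=> x _; rewrite lee_fin normal_pdf_ge0.
Qed.

End NormalLaw.

(** * Construction of Gaussian vectors *)

Section GaussianVector.
Variables (R : realType) (k : nat).
Implicit Types (t x v : 'rV[R]_k) (Sigma : 'M[R]_k).

Definition quad Sigma t : R := (t *m Sigma *m t^T) 0 0.

Lemma dotr_measurable t : measurable_fun setT (fun x : borel_rV R k => dotr t x).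
Proof.
under eq_fun do rewrite dotrE; apply: measurable_sum => i.
by apply: measurable_funM => //; exact: measurable_coord_rV.
Qed.

Lemma dotrDr t x y : dotr t (x + y) = dotr t x + dotr t y.
Proof. by rewrite /dotr mulmxDl mxE. Qed.

Lemma dotrZr t a x : dotr t (a *: x) = a * dotr t x.
Proof. by rewrite /dotr -scalemxAl mxE. Qed.

Lemma dotrZl a t x : dotr (a *: t) x = a * dotr t x.
Proof. by rewrite /dotr linearZ -scalemxAr mxE. Qed.

(** Starting from the point mass at 0, each [v] adds an independent standard normal multiple of
    itself, realised on a product space; by Fubini this multiplies the moment generating function by
    [exp (dotr t v ^ 2 / 2)]. *)
Lemma gaussian_sum_exists (s : seq 'rV[R]_k) : exists nu : probability (borel_rV R k) R,
  forall t, (\int[nu]_x (expR (dotr t x))%:E = (expR ((\sum_(v <- s) dotr t v ^+ 2) / 2))%:E)%E.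
Proof.
elim: s => [|v s [nu hnu]].
  exists (\d_(0 : borel_rV R k)) => t; rewrite integral_dirac//.
    by rewrite diracT mul1e big_nil mul0r /dotr mul0mx mxE.
  by apply/measurable_EFinP; apply: measurableT_comp => //; exact: dotr_measurable.
pose f (p : borel_rV R k * R) : borel_rV R k := (p.1 : 'rV[R]_k) + p.2 *: v.
have mf : measurable_fun setT f.
  apply: measurable_rV => i; under eq_fun do rewrite !mxE.
  apply: measurable_funD; last by apply: measurable_funM => //; exact: measurable_snd.
  exact: (measurableT_comp (measurable_coord_rV i) measurable_fst).
have [rho [_ hrho]] := pushforward_probability (nu \x normal_prob (0 : R) (1 : R))%E mf.
exists rho => t; have mexp : measurable_fun setT (fun x : borel_rV R k => (expR (dotr t x))%:E).
  by apply/measurable_EFinP; apply: measurableT_comp => //; exact: dotr_measurable.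
rewrite hrho//.
rewrite fubini_tonelli1//=; last exact: (measurableT_comp mexp mf).
rewrite /fubini_F /=.
under eq_integral => x _.
  have e y : ((expR (dotr t (f (x, y))))%:E = (expR (dotr t x))%:E * (expR (dotr t v * y))%:E)%E.
    by rewrite /f /= dotrDr dotrZr expRD EFinM mulrC.
  under eq_integral do rewrite e.
  rewrite ge0_integralZl//; last first.
    by apply/measurable_EFinP; apply: measurableT_comp => //; exact: measurable_funM.
  rewrite normal_mgf ?oner_eq0// expr1n mul1r muleC.
  over.
rewrite ge0_integralZl//.
by rewrite hnu big_cons -EFinM -expRD mulrDl.
Qed.

Lemma quad_delta Sigma i j a b : Sigma^T = Sigma ->
  quad Sigma (a *: delta_mx 0 i + b *: delta_mx 0 j) =
  a ^+ 2 * Sigma i i + 2 * a * b * Sigma i j + b ^+ 2 * Sigma j j.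
Proof.
move=> sym; have symE p q : Sigma p q = Sigma q p by rewrite -{1}sym mxE.
have e p q : ((delta_mx 0 p : 'rV[R]_k) *m Sigma *m (delta_mx 0 q : 'rV[R]_k)^T) 0 0 = Sigma p q.
  by rewrite -rowE trmx_delta -colE !mxE.
rewrite /quad linearD !linearZ /= !mulmxDl !mulmxDr -!scalemxAl -!scalemxAr.
have := e j j; have := e j i; have := e i j; have := e i i.
set m1 := delta_mx 0 i *m Sigma *m (delta_mx 0 i)^T; set m2 := delta_mx 0 i *m Sigma *m (delta_mx 0 j)^T.
set m3 := delta_mx 0 j *m Sigma *m (delta_mx 0 i)^T; set m4 := delta_mx 0 j *m Sigma *m (delta_mx 0 j)^T.
clearbody m1 m2 m3 m4; move=> e1 e2 e3 e4; rewrite !mxE e1 e2 e3 e4 (symE j i); ring.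
Qed.

(** Elimination with pivot [j]: subtracting a square along [row j Sigma] keeps the form nonnegative,
    clears the diagonal entry [j] and leaves zero diagonal entries zero, so fewer nonzero ones
    remain. Singular forms cause no trouble. *)
Lemma quadratic_form_squares Sigma : Sigma^T = Sigma -> (forall t, 0 <= quad Sigma t) ->
  exists s : seq 'rV[R]_k, forall t, quad Sigma t = \sum_(v <- s) dotr t v ^+ 2.
Proof.
have [n] := ubnP #|[pred i | Sigma i i != 0]|.
elim: n Sigma => [//|n ih] Sigma; rewrite ltnS => hn sym psd.
have symE p q : Sigma p q = Sigma q p by rewrite -{1}sym mxE.
have d0 i : 0 <= Sigma i i.
  have := psd (1 *: delta_mx 0 i + 0 *: delta_mx 0 i); rewrite quad_delta//.
  by rewrite expr1n expr0n/= mulr0 !mul0r mul1r !addr0.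
have [j jS|zero] := pickP [pred i | Sigma i i != 0]; last first.
  exists [::] => t; rewrite big_nil.
  suff -> : Sigma = 0 by rewrite /quad mulmx0 mul0mx mxE.
  apply/matrixP => p q; rewrite mxE.
  have zp i : Sigma i i = 0 by have /negbFE/eqP := zero i.
  (* With a zero diagonal this test vector yields [- 2 * Sigma p q ^ 2 >= 0]. *)
  have := psd (1 *: delta_mx 0 p + (- Sigma p q) *: delta_mx 0 q); rewrite quad_delta// !zp.
  rewrite !mulr0 add0r addr0 => h; apply/eqP; rewrite -sqrf_eq0 eq_le sqr_ge0 andbT expr2; lra.
move: jS => /= jS; have jpos : 0 < Sigma j j by rewrite lt_neqAle eq_sym jS d0.
pose v : 'rV[R]_k := (Num.sqrt (Sigma j j))^-1 *: row j Sigma.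
have dv t : dotr t v ^+ 2 = dotr t (row j Sigma) ^+ 2 / Sigma j j.
  by rewrite dotrZr exprMn exprVn sqr_sqrtr// mulrC.
pose Sigma' := Sigma - v^T *m v.
have q' t : quad Sigma' t = quad Sigma t - dotr t v ^+ 2.
  rewrite /quad mulmxBr mulmxBl [LHS]mxE; congr (_ + _); rewrite mxE; congr (- _).
  have -> : t *m (v^T *m v) *m t^T = (v *m t^T)^T *m (v *m t^T).
    by rewrite trmx_mul trmxK !mulmxA.
  by rewrite mxE big_ord_recl big_ord0 addr0 mxE.
have sym' : Sigma'^T = Sigma' by rewrite linearB /= sym trmx_mul trmxK.
have psd' t : 0 <= quad Sigma' t.
  rewrite q' dv.
  (* Moving by [- a] along coordinate [j] minimises the form, and the minimum is the value of the
     reduced form at [t]. *)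
  pose a := dotr t (row j Sigma) / Sigma j j.
  have := psd (t + (- a) *: delta_mx 0 j).
  have -> : quad Sigma (t + (- a) *: delta_mx 0 j) = quad Sigma t - 2 * a * dotr t (row j Sigma) + a ^+ 2 * Sigma j j.
    have e1 : t *m Sigma *m (delta_mx 0 j)^T = t *m (row j Sigma)^T.
      by rewrite rowE trmx_mul sym mulmxA.
    have e2 : (delta_mx 0 j : 'rV[R]_k) *m Sigma *m t^T = row j Sigma *m t^T by rewrite rowE.
    have e3 : (delta_mx 0 j : 'rV[R]_k) *m Sigma *m (delta_mx 0 j)^T = (Sigma j j)%:M.
      by rewrite -rowE trmx_delta -colE; apply/matrixP => p q; rewrite !ord1 !mxE eqxx.
    have e4 : (t *m (row j Sigma)^T) 0 0 = (row j Sigma *m t^T) 0 0.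
      by rewrite !mxE; apply: eq_bigr => i _; rewrite !mxE mulrC.
    have eT : (t + - a *: delta_mx 0 j)^T = t^T + (- a) *: (delta_mx 0 j)^T.
      by apply/matrixP => p q; rewrite !mxE.
    rewrite /quad eT !mulmxDl !mulmxDr -!scalemxAl -!scalemxAr e1 e2 e3 /dotr.
    move: e4; move: (t *m Sigma *m t^T) (t *m _) (row j Sigma *m _) => A B C e4.
    by rewrite !mxE -e4 eqxx mulr1n; ring.
  have -> : a ^+ 2 * Sigma j j = a * dotr t (row j Sigma) by rewrite /a expr2 -mulrA divfK.
  have -> : dotr t (row j Sigma) ^+ 2 / Sigma j j = a * dotr t (row j Sigma) by rewrite /a; ring.
  by lra.
have d' i : Sigma' i i = Sigma i i - Sigma j i ^+ 2 / Sigma j j.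
  by rewrite !mxE big_ord_recl big_ord0 addr0 !mxE -expr2 exprMn exprVn sqr_sqrtr// mulrC.
have [|s hs] := ih Sigma' _ sym' psd'.
  apply: leq_trans hn; apply: proper_card; apply/properP; split.
    apply/fintype.subsetP => i; rewrite !inE; apply: contra => /eqP i0.
    rewrite eq_le; apply/andP; split; last first.
      have := psd' (1 *: delta_mx 0 i + 0 *: delta_mx 0 i); rewrite quad_delta//.
      by rewrite expr1n expr0n/= mulr0 !mul0r mul1r !addr0.
    by rewrite d' i0 add0r oppr_le0 divr_ge0// ?sqr_ge0// ltW.
  by exists j; rewrite !inE// negbK d' expr2 -mulrA divff// mulr1 subrr.
by exists (v :: s) => t; rewrite big_cons -hs q' addrC subrK.
Qed.

(** Each linear functional has a Gaussian moment generating function, which determines its law, a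
    point mass when its variance vanishes. *)
Lemma gaussian_exists Sigma : Sigma^T = Sigma -> (forall t, 0 <= quad Sigma t) ->
  exists nu : probability (borel_rV R k) R, [/\ is_gaussian Sigma nu,
    (forall i, fmom nu (fun x : borel_rV R k => (x : 'rV[R]_k) 0 i)) &
    forall t m, mean nu (fun x => dotr t x ^+ m) = gauss_moment (quad Sigma t) m].
Proof.
move=> sym psd; have [s hs] := quadratic_form_squares sym psd.
have [nu hnu] := gaussian_sum_exists s; exists nu.
have mgf t (c : R) : (\int[nu]_x (expR (c * dotr t x))%:E = (expR (quad Sigma t * c ^+ 2 / 2))%:E)%E.
  under eq_integral do rewrite -dotrZl.
  rewrite hnu hs; have -> : \sum_(v <- s) dotr (c *: t) v ^+ 2 = (\sum_(v <- s) dotr t v ^+ 2) * c ^+ 2.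
    by rewrite mulr_suml; apply: eq_bigr => v _; rewrite dotrZl exprMn mulrC.
  by [].
split.
- split => // t A mA.
  have <- : nu ((fun x : borel_rV R k => dotr t x) @^-1` A) = nu [set x : 'rV[R]_k | A ((x *m t^T) 0 0)] by [].
  rewrite /normal_law -/(quad Sigma t); case: eqP => [v0|/eqP v0].
    apply: (law_eq_mgf (Q := \d_(0 : R)) (Z := id) (psd t) (dotr_measurable t)) => // c.
    rewrite v0 mul0r mul0r integral_dirac//; first by rewrite diracT mul1e mulr0.
    by apply/measurable_EFinP; apply: measurableT_comp => //; exact: measurable_funM.
  have s0 : Num.sqrt (quad Sigma t) != 0 by rewrite sqrtr_eq0 -ltNge lt_neqAle eq_sym v0 psd.
  apply: (law_eq_mgf (Q := normal_prob (0 : R) (Num.sqrt (quad Sigma t))) (Z := id) (psd t) (dotr_measurable t)) => // c.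
  by rewrite normal_mgf// sqr_sqrtr.
- move=> i; have := fmom_mgf (dotr_measurable (1 *: delta_mx 0 i)) (mgf _).
  by under eq_fun do rewrite dotr_delta mul1r.
- by move=> t m; apply: mean_mgf => //; exact: dotr_measurable.
Qed.

End GaussianVector.

(** * Localization of score functions *)

Lemma fin_nat_bound (I : finType) (Q : I -> nat -> Prop) :
  (forall i m n, (m <= n)%N -> Q i m -> Q i n) -> (forall i, exists n, Q i n) ->
  exists n, forall i, Q i n.
Proof.
move=> mono /choice[n hn]; exists (\max_i n i)%N => i.
by apply: mono (hn i); exact: leq_bigmax.
Qed.

Lemma fin_real_bound (R : realType) (I : finType) (Q : I -> R -> Prop) :
  (forall i a b, a <= b -> Q i a -> Q i b) -> (forall i, exists a, Q i a) ->
  exists a, forall i, Q i a.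
Proof.
move=> mono /choice[a ha]; exists (\sum_i `|a i|) => i; apply: mono (ha i).
by rewrite (le_trans (ler_norm _))// (bigD1 i)//= lerDl sumr_ge0.
Qed.

Lemma nat_ge (R : realType) (a : R) : exists n : nat, a <= n%:R.
Proof.
exists `|Num.ceil a|%N; rewrite (le_trans (ceil_ge _))//.
by rewrite natr_absz ler_int ler_norm.
Qed.

Lemma depends_on_bounded (R : realType) (V : groupType) (A : seq V) (h : config V -> R) :
  depends_on A h -> exists B, forall mu, `|h mu| <= B.
Proof.
elim: A h => [|x A ih] h dh.
  by exists `|h (fun=> false)| => mu; rewrite (dh mu (fun=> false)).
have [B1 h1] := ih _ (depends_on_upd true dh).
have [B0 h0] := ih _ (depends_on_upd false dh).
exists (Num.max B1 B0) => mu; rewrite (upd_split h mu x) le_max.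
by case: ifP; rewrite ?h1 ?h0 ?orbT.
Qed.

Section Scores.
Variables (R : realType) (V : groupType) (S : {fset V}).
Hypothesis cayleyS : cayley_graph S.
Variables (d : measure_display) (Omega : measurableType d).
Variables (P : probability Omega R) (X : {RV P >-> config V}).
Variables (k : nat) (xi : 'I_k -> V -> config V -> R).
Hypothesis score_xi : forall i, score_function (xi i).

Notation N s := ((vol S s)%:R : R).

Definition score_at i n x (om : Omega) : R := xi i x (win S X n om).

(** Windows are indexed by [1 <= n <= oo], so the radius 0 is left out. *)
Definition valid_window (n : option nat) : bool := if n is Some m then (0 < m)%N else true.

Lemma vol_ge1 s : 1 <= N s. Proof. by rewrite ler1n vol_gt0. Qed.

Lemma score_translate i x mu : xi i x mu = xi i 1%g (Defs.shift (x^-1)%g mu).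
Proof. by have [_ tr _] := score_xi i; rewrite -[RHS](tr x) mulg1; congr xi; apply/funext => y; rewrite /Defs.shift invgK mulgA mulgV mul1g. Qed.

Lemma shift_coord x y (mu : config V) : Defs.shift (x^-1)%g mu y = mu (x * y)%g.
Proof. by rewrite /Defs.shift invgK. Qed.

Lemma depends_on_translate (U : Type) t x (h : config V -> U) :
  depends_on (ball S t) h -> depends_on (nbh S x t) (fun mu => h (Defs.shift (x^-1)%g mu)).
Proof.
move=> dh mu mu' e; apply: dh => y yt; rewrite !shift_coord; apply: e.
by rewrite mem_nbh// gdistE// mulKg -mem_ball.
Qed.

Lemma sc_outside i n x om : ~~ inw S n x -> score_at i n x om = 0.
Proof.
move=> xn; have [_ _ z] := score_xi i; apply: z.
by rewrite /win (negbTE xn) andbF.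
Qed.

(** One good event [G] serves all windows, so that scores in a window and in the full model can be
    compared; only its probability is controlled window by window, at points inside. *)
Definition scores_localized t (B lam : R) : Prop :=
  exists G : 'I_k -> V -> config V -> bool, forall i x,
  [/\ depends_on (nbh S x t) (G i x),
      depends_on (nbh S x t) (fun mu => if G i x mu then xi i x mu else 0),
      (forall mu, G i x mu -> `|xi i x mu| <= B)
    & forall n, valid_window n -> inw S n x -> mean P (fun om => (~~ G i x (win S X n om))%:R) <= lam ^+ 2].

(** Outside the window the score vanishes identically and the trivial good event will do. *)
Lemma localized_sc t B lam i n x : 0 <= B -> valid_window n -> scores_localized t B lam ->
  localized S X n t B lam x (score_at i n x).
Proof.
move=> B0 vn [G hG]; have [dG dh hB hl] := hG i x.
have [xn|xn] := boolP (inw S n x).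
  by exists (G i x), (xi i x); split => //; exact: hl.
exists (fun=> true), (fun=> 0); split => //.
- by apply/funext => om; rewrite sc_outside.
- by move=> mu; rewrite normr0.
- by rewrite mean_cst sqr_ge0.
Qed.

Section Clustering.
Variables (C c : nat -> R) (phi : R -> R).
Hypothesis clus : clustering S P X C c phi.

Definition error_bound p t (B : R) u : R :=
  3 ^+ (p * vol S t) * B ^+ p * (C (p * vol S t)%N * phi (c (p * vol S t)%N * u%:R)).

(* At every scale [s], up to an error smaller than any negative power of
   the volume of the ball of radius [s], the scores are bounded functions of the spins
   at distance less than [s / 2] whose dependence across distance [s] is
   controlled by clustering. *)
Definition approximable : Prop := forall p K, exists2 C0, 0 <= C0 & forall s, (0 < s)%N ->
  exists t B lam, [/\ (2 * t < s)%N, 1 <= B, 0 < lam, scores_localized t B lam &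
    lam <= C0 / N s ^+ K /\ error_bound p t B (s - 2 * t) <= C0 / N s ^+ K].

Lemma phi_ge0 j u : 0 <= phi (c j * u%:R).
Proof.
have [_ _ [c0 _] [phi01 _ _] _] := clus.
by have /andP[] := phi01 (c j * u%:R) (mulr_ge0 (ltW (c0 _)) (ler0n _ _)).
Qed.

Lemma phi_le1 j u : phi (c j * u%:R) <= 1.
Proof.
have [_ _ [c0 _] [phi01 _ _] _] := clus.
by have /andP[] := phi01 (c j * u%:R) (mulr_ge0 (ltW (c0 _)) (ler0n _ _)).
Qed.

Lemma C_ge0 j : 0 <= C j.
Proof. by have [_ [C0 _] _ _ _] := clus; rewrite ltW. Qed.

(** At the finitely many small scales the empty good event with [t = 0] and [B = lam = 1] is
    admissible, and the constant absorbs the resulting errors. *)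
Lemma approximable_large : (forall p K, exists C0 s0, forall s, (s0 <= s)%N ->
    exists t B lam, [/\ (2 * t < s)%N, 1 <= B, 0 < lam, scores_localized t B lam &
    lam <= C0 / N s ^+ K /\ error_bound p t B (s - 2 * t) <= C0 / N s ^+ K]) -> approximable.
Proof.
move=> large p K; have [C0 [s0 hs]] := large p K.
pose A := 1 + 3 ^+ p * C p.
have A1 : 1 <= A by rewrite lerDl mulr_ge0 ?C_ge0.
pose C1 := Num.max C0 (A * N s0 ^+ K).
have NK s : 0 < N s ^+ K by rewrite exprn_gt0// (lt_le_trans ltr01)// vol_ge1.
have C10 : 0 <= C1 by rewrite le_max mulr_ge0 ?orbT ?(ltW (NK _))// (le_trans ler01).
exists C1 => // s spos; have [ss0|ss0] := leqP s0 s.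
  have [t [B [lam [h1 h2 h3 h4 [h5 h6]]]]] := hs s ss0.
  exists t, B, lam; split => //; split.
    by rewrite (le_trans h5)// ler_wpM2r ?invr_ge0 ?(ltW (NK _))// le_max lexx.
  by rewrite (le_trans h6)// ler_wpM2r ?invr_ge0 ?(ltW (NK _))// le_max lexx.
have AC : A <= C1 / N s ^+ K.
  rewrite ler_pdivlMr// le_max; apply/orP; right; rewrite ler_wpM2l ?(le_trans ler01)//.
  by rewrite lerXn2r ?nnegrE// ler_nat vol_le// ltnW.
exists 0%N, 1, 1; split => //.
- exists (fun _ _ _ => false) => i x; split => // n _ _.
  by rewrite mean_cst expr1n.
- split; first exact: le_trans AC.
  apply: le_trans AC; rewrite /error_bound; have -> : vol S 0 = 1%N by rewrite /vol cardfs1.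
  rewrite muln1 expr1n mulr1 /A -[leLHS]add0r lerD//.
  by rewrite ler_wpM2l// ler_piMr ?C_ge0// phi_le1.
Qed.

End Clustering.

Definition bounded_moments : Prop :=
  (forall i n x, valid_window n -> fmom P (score_at i n x)) /\
  forall p : nat, exists M, forall i n x, valid_window n -> mean P (fun om => `|score_at i n x om| ^+ p) <= M.

(** * Local scores *)

Section Local.
Hypothesis local_xi : forall i, local_score S (xi i).

Lemma local_radius : exists r, forall i x, depends_on (nbh S x r) (xi i x).
Proof.
suff [r hr] : exists r, forall i, depends_on (ball S r) (xi i 1%g).
  exists r => i x mu mu' e; rewrite !(score_translate i x).
  exact: (depends_on_translate (hr i)).
apply: (@fin_nat_bound _ (fun i r => depends_on (ball S r) (xi i 1%g))) => [i m n mn|i].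
  by apply: depends_on_sub => x; exact: ball_le mn x.
have [r r0 hr] := local_xi i; have [n rn] := nat_ge r; exists n => mu mu' e; apply: hr.
suff h A : A = W S 1%g (r%:E : \bar R) -> Defs.restrict mu A = Defs.restrict mu' A by exact: h.
move=> AE; apply/funext => x; rewrite /Defs.restrict.
have ex : A x -> mu x = mu' x.
  move=> xr; apply: e; rewrite mem_ball//.
  by move: xr; rewrite AE /W /= lee_fin => xr; rewrite -(ler_nat R) (le_trans xr).
by apply/idP/idP => /andP[h1 h2]; apply/andP; split => //; move: h1; rewrite (ex (set_mem h2)).
Qed.

Lemma local_bounded : exists2 B, 1 <= B & forall i x mu, `|xi i x mu| <= B.
Proof.
have [r hr] := local_radius.
have [B hB] := @fin_real_bound R 'I_k (fun i B => forall mu, `|xi i 1%g mu| <= B)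
  (fun i a b ab h mu => le_trans (h mu) ab) (fun i => depends_on_bounded (hr i 1%g)).
exists (Num.max 1 B); first by rewrite le_max lexx.
by move=> i x mu; rewrite score_translate le_max hB orbT.
Qed.

Lemma measurable_sc i n x : measurable_fun setT (score_at i n x).
Proof.
have [m _ _] := score_xi i; exact: measurableT_comp (m x) (measurable_win _ _ _).
Qed.

Lemma local_moments : bounded_moments.
Proof.
have [B B1 hB] := local_bounded; split => [i n x _|p].
  by apply: (@fmom_bounded _ _ _ _ _ B); [exact: measurable_sc|move=> om; exact: hB].
exists (B ^+ p) => i n x _.
have h : `|mean P (fun om => `|score_at i n x om| ^+ p)| <= B ^+ p.
  apply: mean_abs_bound.
    by apply: measurable_funX; apply: measurableT_comp => //; exact: measurable_sc.
  move=> om; rewrite normrX normr_id lerXn2r ?nnegrE ?(le_trans ler01 B1)//.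
  exact: hB.
by rewrite (le_trans (ler_norm _)).
Qed.

Lemma esum_ge_fset (f : V -> \bar R) (A : {fset V}) : (forall x, 0 <= f x)%E ->
  (\sum_(x <- A) f x <= \esum_(x in [set: V]) f x)%E.
Proof.
move=> f0; apply: esum_ge; exists [set` A]; last by rewrite -fsbig_seq// fset_uniq.
by split => //; exact: finite_fset.
Qed.

(** By monotonicity the summand [phi ^ (1 / K.+1)] is on the ball of radius [s] at least its value
    at [s], so [vol s] times that value is at most the whole sum; the power [K.+1] of this bound is
    the claim. *)
Lemma summable_decay phi : fast_decreasing phi -> summable_in S phi -> forall (a : R) K, 0 < a ->
  exists2 D, 0 <= D & forall s, phi (a * s%:R) <= D / N s ^+ K.
Proof.
move=> [phi01 phim _] sphi a K a0.
have := sphi a K.+1%:R a0; rewrite ler1n => /(_ isT).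
rewrite /summable; set g := fun x => _; move=> sg.
have bphi s : 0 <= phi (a * s%:R) <= 1 by apply: phi01; rewrite mulr_ge0// ltW.
have gE s : phi (a * s%:R) = (phi (a * s%:R) `^ K.+1%:R^-1) ^+ K.+1.
  rewrite -powR_mulrn ?powR_ge0// -powRrM mulVf ?pnatr_eq0// powRr1//.
  by have /andP[] := bphi s.
pose D := fine (\esum_(x in [set: V]) g x)%E.
have gfin : (\esum_(x in [set: V]) g x)%E \is a fin_num.
  have g0 : (0 <= \esum_(x in [set: V]) g x)%E by apply: esum_ge0 => x _; exact: abse_ge0.
  by rewrite ge0_fin_numE.
have key s : N s * phi (a * s%:R) `^ K.+1%:R^-1 <= D.
  rewrite -lee_fin fineK//; apply: le_trans (esum_ge_fset (ball S s) (fun x => abse_ge0 _)).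
  apply: (@le_trans _ _ (\sum_(x <- ball S s) (phi (a * s%:R) `^ K.+1%:R^-1)%:E)%E).
    rewrite sumEFin lee_fin big_const_seq count_predT iter_addr addr0.
    by rewrite -[leRHS]mulr_natl.
  rewrite big_seq [leRHS]big_seq; apply: lee_sum => x xs.
  rewrite /g /= lee_fin ger0_norm ?powR_ge0// ge0_ler_powR ?nnegrE ?invr_ge0//.
  - by have /andP[] := bphi s.
  - by have /andP[] := bphi (gdist S 1%g x).
  - apply: phim; first by rewrite mulr_ge0// ltW.
    by rewrite ler_wpM2l ?(ltW a0)// ler_nat -/(len S x) -mem_ball.
have D0 : 0 <= D by apply: fine_ge0; apply: esum_ge0 => x _; exact: abse_ge0.
exists (D ^+ K.+1); first exact: exprn_ge0.
move=> s; have N1 := vol_ge1 s; have N0 : 0 < N s by rewrite (lt_le_trans ltr01).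
apply: (@le_trans _ _ (D ^+ K.+1 / N s ^+ K.+1)).
  rewrite gE -expr_div_n lerXn2r ?nnegrE ?powR_ge0 ?divr_ge0 ?(ltW N0)//.
  by rewrite ler_pdivlMr// mulrC.
rewrite ler_wpM2l ?exprn_ge0// lef_pV2 ?posrE ?exprn_gt0//.
by rewrite ler_weXn2l.
Qed.

(** With a fixed radius the price of locality is a constant, and without bad events [lam] may be
    chosen at will. *)
Lemma local_approximable C c phi : clustering S P X C c phi -> summable_in S phi ->
  approximable C c phi.
Proof.
move=> clus sphi; apply: (approximable_large clus) => p K.
have [r hr] := local_radius; have [B B1 hB] := local_bounded.
have [_ _ [c0 _] fphi _] := clus.
set j := (p * vol S r)%N.
have [D D0 hD] := summable_decay fphi sphi K (c0 j).
pose A := 3 ^+ j * B ^+ p * C j.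
have A0 : 0 <= A by rewrite !mulr_ge0 ?exprn_ge0 ?(C_ge0 clus)// (le_trans ler01).
exists (1 + A * D * N (2 * r) ^+ K), (2 * r).+1 => s rs.
have NK m : 0 < N m ^+ K by rewrite exprn_gt0// (lt_le_trans ltr01)// vol_ge1.
exists r, B, (N s ^+ K)^-1; split => //; first by rewrite invr_gt0.
- exists (fun _ _ _ => true) => i x; split => //.
  by move=> n _ _; rewrite mean_cst sqr_ge0.
split.
  by rewrite ler_pdivlMr// mulVf ?gt_eqF// lerDl mulr_ge0 ?(ltW (NK _))// mulr_ge0.
rewrite ler_pdivlMr// /error_bound -/j mulrA -/A.
(* Submultiplicativity, [vol s <= vol (s - 2 * r) * vol (2 * r)], moves the decay from the gap
   [s - 2 * r] to the scale [s]. *)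
apply: (@le_trans _ _ (A * (D / N (s - 2 * r) ^+ K) * (N (s - 2 * r) * N (2 * r)) ^+ K)).
  apply: ler_pM; [by rewrite mulr_ge0// (phi_ge0 clus)|exact: ltW|by rewrite ler_wpM2l// hD|].
  rewrite lerXn2r ?nnegrE ?mulr_ge0// -natrM ler_nat.
  by rewrite -{1}(subnK (ltnW rs)) volD.
rewrite exprMn -[leLHS]add0r lerD// !mulrA mulfVK ?gt_eqF//.
Qed.

End Local.
End Scores.

(** * Stretched exponential decay *)

Section StretchedExponentials.
Variable R : realType.

Lemma stretched_exp_decayP (phi : R -> R) (b : R) : stretched_exp_decay phi b ->
  exists delta T : R, 0 < delta /\ forall t, T <= t -> phi t <= expR (- (delta * t `^ b)).
Proof.
move=> /ereal_inf_lt[_ [A [M [_ hM]] <-] supA].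
(* The supremum may be [-oo], in which case any positive [r] works. *)
have [r r0 hr] : exists2 r : R, 0 < r & (ereal_sup ((fun t : R => lne (phi t)%:E * ((t `^ b)^-1)%:E) @` A) <= (- r)%:E)%E.
  move: supA; case: (ereal_sup _) => [r r0|//|_]; last by exists 1 => //; rewrite leNye.
  by exists (- r); [rewrite oppr_gt0 -lte_fin|rewrite opprK].
exists r, (Num.max 1 (M + 1)); split => // t; rewrite ge_max => /andP[t1 tM].
have [p0|p0] := leP (phi t) 0; first by rewrite (le_trans p0)// expR_ge0.
have tb : 0 < t `^ b by rewrite powR_gt0// (lt_le_trans ltr01).
have At : A t by apply: hM; rewrite (lt_le_trans _ tM)// ltrDl.
have : (lne (phi t)%:E * ((t `^ b)^-1)%:E <= (- r)%:E)%E.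
  by apply: le_trans hr; apply: ereal_sup_ubound; exists t.
rewrite lne_EFin// -EFinM lee_fin ler_pdivrMr// mulNr => h.
by rewrite -[phi t]lnK ?posrE// ler_expR.
Qed.

Lemma exp_eventually_ge (delta c : R) N : 0 < delta -> 0 < c ->
  exists T : nat, forall t, (T <= t)%N -> (t%:R : R) ^+ N <= expR (delta * t%:R `^ c).
Proof.
(* One term of the exponential series suffices: [m * c >= N + 1] leaves a spare factor [t], which
   absorbs [m! / delta ^ m]. *)
move=> d0 c0; have [m hm] := nat_ge (N.+1%:R / c).
have [T hT] := nat_ge (m`!%:R / delta ^+ m).
have dm : 0 < delta ^+ m by rewrite exprn_gt0.
exists (maxn 1 T) => t; rewrite geq_max => /andP[t1 Tt].
have t1' : 1 <= t%:R :> R by rewrite ler1n.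
have t0 : 0 <= t%:R :> R by [].
have y0 : 0 <= delta * t%:R `^ c by rewrite mulr_ge0 ?powR_ge0// ltW.
apply: le_trans (series_le_expR m.+1 y0).
rewrite big_ord_recr/= -[leLHS]add0r lerD//.
  by apply: sumr_ge0 => i _; rewrite divr_ge0 ?exprn_ge0.
rewrite exprMn ler_pdivlMr ?ltr0n ?fact_gt0//.
apply: (@le_trans _ _ (t%:R ^+ N * (delta ^+ m * t%:R))).
  rewrite ler_wpM2l ?exprn_ge0// mulrC -ler_pdivrMr//.
  by rewrite (le_trans hT)// ler_nat.
rewrite mulrCA ler_wpM2l ?(ltW dm)// -exprSr.
rewrite -[leRHS]powR_mulrn ?powR_ge0// -powRrM -powR_mulrn//.
by rewrite ler_powR// mulrC -ler_pdivrMr.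
Qed.

End StretchedExponentials.

(** * Exponentially quasi-local scores *)

Section QuasiLocal.
Variables (R : realType) (V : groupType) (S : {fset V}).
Hypothesis cayleyS : cayley_graph S.
Variables (d : measure_display) (Omega : measurableType d).
Variables (P : probability Omega R) (X : {RV P >-> config V}).
Variables (k : nat) (xi : 'I_k -> V -> config V -> R).
Hypothesis score_xi : forall i, score_function (xi i).

Notation N s := ((vol S s)%:R : R).

(* The radius of stabilisation at [x] is at most [t]. *)
Definition stable t i x (mu : config V) : bool :=
  `[< forall mu', (forall y, y \in nbh S x t -> mu y = mu' y) -> xi i x mu = xi i x mu' >].

Lemma stable_depends t i x : depends_on (nbh S x t) (stable t i x).
Proof.
suff h mu mu' : (forall y, y \in nbh S x t -> mu y = mu' y) -> stable t i x mu -> stable t i x mu'.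
  by move=> mu mu' e; apply/idP/idP; apply: h => // y /e.
move=> e /asboolP s; apply/asboolP => nu e'.
rewrite -(s mu')//; apply: s => y yt.
by rewrite e// e'.
Qed.

Lemma stable_score_depends t i x :
  depends_on (nbh S x t) (fun mu => if stable t i x mu then xi i x mu else 0).
Proof.
move=> mu mu' e; rewrite -(stable_depends i e); case: ifP => // /asboolP s.
exact: s.
Qed.

Lemma W_nat t y : W S 1%g (t%:R%:E : \bar R) y = (len S y <= t)%N.
Proof. by rewrite /W /= lee_fin ler_nat. Qed.

Lemma restrict_eqP t (mu mu' : config V) :
  Defs.restrict mu (W S 1%g (t%:R%:E : \bar R)) = Defs.restrict mu' (W S 1%g (t%:R%:E : \bar R)) <->
  (forall y, (len S y <= t)%N -> mu y = mu' y).
Proof.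
split=> [e y yt|e].
  have : W S 1%g (t%:R%:E : \bar R) y by rewrite W_nat.
  move=> /mem_set yW; have := congr1 (fun f => f y) e.
  by rewrite /Defs.restrict yW !andbT.
apply/funext => y; rewrite /Defs.restrict.
have ey : W S 1%g (t%:R%:E : \bar R) y -> mu y = mu' y by rewrite W_nat => /e.
by apply/idP/idP => /andP[h1 h2]; apply/andP; split => //; move: h1; rewrite (ey (set_mem h2)).
Qed.

(** The radius is a positive integer or [+oo], so exceeding [t] means being at least [t + 1]; [t] is
    positive because the infimum runs over positive radii. *)
Lemma stable_radius t i x mu : (0 < t)%N ->
  (~~ stable t i x mu) = ((t.+1%:R%:E : \bar R) <= stab_radius S (xi i) x mu)%E.
Proof.
move=> t0; apply/idP/idP => [|h].
  move=> /asboolPn ns; apply: le_ereal_inf_tmp => _ [r [r0 hr] <-].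
  rewrite lee_fin ler_nat ltnNge; apply/negP => rt; apply: ns => mu' e.
  rewrite !(score_translate score_xi i x); apply: hr; apply/restrict_eqP => y yr.
  rewrite !shift_coord; apply/esym/e; rewrite mem_nbh// gdistE// mulKg.
  exact: leq_trans rt.
apply/negP => /asboolP s; move: h; apply/negP; rewrite -ltNge.
apply: (@le_lt_trans _ _ (t%:R%:E : \bar R)); last by rewrite lte_fin ltr_nat.
apply: ereal_inf_lbound; exists t => //; split => // mu' /restrict_eqP e.
rewrite -(score_translate score_xi) (s (Defs.shift x mu')).
  rewrite (score_translate score_xi); congr xi.
  by apply/funext => y; rewrite shift_coord /Defs.shift mulKg.
move=> y; rewrite mem_nbh// => yt.
have : (len S (x^-1 * y)%g <= t)%N by rewrite -gdistE.
by move=> /e h; rewrite /Defs.shift h shift_coord mulVKg.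
Qed.

(** On a stable configuration the spins outside the ball can be erased without changing the score,
    and the growth condition applies to what is left. *)
Lemma stable_bound (n0 : nat) t i x mu : (0 < t)%N ->
  (forall nu, `|xi i 1%g (Defs.restrict nu (W S 1%g (t%:R%:E : \bar R)))| <= expR (n0%:R * t%:R ^+ n0)) ->
  stable t i x mu -> `|xi i x mu| <= expR (n0%:R * t%:R ^+ n0).
Proof.
move=> t0 h /asboolP s; pose nu := Defs.restrict (Defs.shift (x^-1)%g mu) (W S 1%g (t%:R%:E : \bar R)).
rewrite (s (Defs.shift x nu)); last first.
  move=> y; rewrite mem_nbh// gdistE// => yt; rewrite /Defs.shift /nu /Defs.restrict /Defs.shift invgK mulVKg.
  have -> : (x^-1 * y)%g \in W S 1%g (t%:R%:E : \bar R) by apply/mem_set; rewrite W_nat.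
  by rewrite andbT.
rewrite (score_translate score_xi).
have -> : Defs.shift (x^-1)%g (Defs.shift x nu) = nu.
  by apply/funext => y; rewrite shift_coord /Defs.shift mulKg.
exact: h.
Qed.

Lemma growth_bound : (forall i, exponential_growth S (xi i)) ->
  exists n0 : nat, forall i t nu, (0 < t)%N ->
  `|xi i 1%g (Defs.restrict nu (W S 1%g (t%:R%:E : \bar R)))| <= expR (n0%:R * t%:R ^+ n0).
Proof.
move=> eg; suff [n0 h] : exists n0 : nat, forall i, forall t nu, (0 < t)%N ->
    `|xi i 1%g (Defs.restrict nu (W S 1%g (t%:R%:E : \bar R)))| <= expR (n0%:R * t%:R ^+ n0).
  by exists n0.
apply: fin_nat_bound => [i m n mn h t nu t0|i].
  apply: (le_trans (h t nu t0)); rewrite ler_expR ler_pM ?exprn_ge0 ?ler_nat//.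
  by rewrite ler_weXn2l// ler1n.
have [kappa [cs [kap0 hk]]] := eg i.
have [n1 h1] := nat_ge kappa; have [n2 h2] := nat_ge cs.
exists (maxn n1 n2) => t nu t0.
have t1 : 1 <= t%:R :> R by rewrite ler1n.
apply: (le_trans (hk t%:R nu _)); first by rewrite ltr0n.
rewrite ler_expR; apply: (@le_trans _ _ ((maxn n1 n2)%:R * t%:R `^ kappa)).
  by rewrite ler_wpM2r ?powR_ge0// (le_trans h2)// ler_nat leq_maxr.
by rewrite ler_wpM2l// -powR_mulrn// ler_powR// (le_trans h1)// ler_nat leq_maxl.
Qed.

Lemma window_probability n x (B : \bar R) (f : \bar R -> V -> \bar R) :
  (ereal_sup [set ereal_sup [set f m x | x in W S 1%g m] | m in window_indices (R:=R)] <= B)%E ->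
  valid_window n -> inw S n x ->
  (f (if n is Some m then m%:R%:E else +oo%E) x <= B)%E.
Proof.
move=> h vn xn; apply: le_trans h; set m := (X in f X x).
apply: (@le_trans _ _ (ereal_sup [set f m x | x in W S 1%g m])).
  apply: ereal_sup_ubound; exists x => //; rewrite /m; case: n vn xn {m} => [m|] /= vn xn.
    by rewrite W_nat -mem_ball.
  by rewrite /W /= leey.
apply: ereal_sup_ubound; exists m => //; rewrite /m; case: n vn xn {m} => [m|] /= vn xn.
  by left; exists m.
by right.
Qed.

Lemma windowedE n : windowed S X (if n is Some m then m%:R%:E else +oo%E : \bar R) = win S X n.
Proof. by case: n => [m|]; [exact: windowed_Some|exact: windowed_None]. Qed.

Lemma unstable_mean (A : R) (phi : R -> R) t i n x : (0 < t)%N ->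
  (forall t : R, 0 <= t ->
    (ereal_sup [set ereal_sup
      [set P [set om | (t%:E <= stab_radius S (xi i) x (windowed S X n om))%E]
        | x in W S 1%g n] | n in window_indices (R:=R)] <= (A * phi t)%:E)%E) ->
  valid_window n -> inw S n x ->
  mean P (fun om => (~~ stable t i x (win S X n om))%:R) <= A * phi t.+1%:R.
Proof.
move=> t0 h vn xn; rewrite -lee_fin mean_bool; last first.
  apply: (measurableT_comp (f := fun mu : config V => ~~ stable t i x mu)); last exact: measurable_win.
  by apply: (depends_on_measurable (A := nbh S x t)) => mu mu' e; rewrite (stable_depends i e).
have := window_probability (f := fun n x => P [set om | (t.+1%:R%:E <= stab_radius S (xi i) x (windowed S X n om))%E])
  (h t.+1%:R (ler0n _ _)) vn xn.
rewrite windowedE; congr (P _ <= _)%E; apply/seteqP; split => om /=; rewrite stable_radius//.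
Qed.

(** A single integer [q] stands for the prefactor, the rate, the exponent and the threshold, and for
    all scores at once, because the bound weakens as [q] grows. *)
Lemma quasi_local_bound : (forall i, exponentially_quasi_local S P X (xi i)) ->
  exists2 q : nat, (0 < q)%N & forall i t n x, (q <= t)%N -> valid_window n -> inw S n x ->
    mean P (fun om => (~~ stable t i x (win S X n om))%:R) <= q%:R * expR (- (q%:R^-1 * t%:R `^ q%:R^-1)).
Proof.
move=> eq; suff [q h] : exists q : nat, forall i, (0 < q)%N /\ forall t n x, (q <= t)%N -> valid_window n -> inw S n x ->
    mean P (fun om => (~~ stable t i x (win S X n om))%:R) <= q%:R * expR (- (q%:R^-1 * t%:R `^ q%:R^-1)).
  exists (maxn 1 q); first by rewrite leq_max.
  move=> i; have [q0 hq] := h i; suff -> : maxn 1 q = q by [].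
  exact/maxn_idPr.
have mono (p q t : nat) : (0 < p)%N -> (p <= q)%N -> (0 < t)%N ->
    p%:R * expR (- (p%:R^-1 * t%:R `^ p%:R^-1)) <= q%:R * expR (- (q%:R^-1 * t%:R `^ q%:R^-1)) :> R.
  move=> p0 pq t0; have qi : q%:R^-1 <= p%:R^-1 :> R by rewrite lef_pV2 ?posrE ?ltr0n ?ler_nat// (leq_trans p0).
  apply: ler_pM => //; rewrite ?expR_ge0 ?ler_nat// ler_expR lerN2.
  apply: ler_pM => //; rewrite ?powR_ge0 ?invr_ge0//.
  by rewrite ler_powR// ler1n.
apply: fin_nat_bound => [i p q pq [p0 h]|i].
  split=> [|t n x qt vn xn]; first exact: leq_trans pq.
  apply: le_trans (mono _ _ _ p0 pq _); last by rewrite (leq_trans p0)// (leq_trans pq).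
  by apply: h => //; exact: leq_trans qt.
have [A [phi [A0 [phim _] hphi [c c0 /stretched_exp_decayP[delta [T [d0 hT]]]]]]] := eq i.
have [q1 h1] := nat_ge A; have [q2 h2] := nat_ge delta^-1; have [q3 h3] := nat_ge c^-1.
have [q4 h4] := nat_ge T.
pose q := (q1 + q2 + q3 + q4).+1.
have qle (j : nat) : (j <= q1 + q2 + q3 + q4)%N -> j%:R <= q%:R :> R by move=> jq; rewrite ler_nat ltnW.
exists q; split => // t n x qt vn xn.
have t0 : (0 < t)%N by exact: leq_trans qt.
have t1 : 1 <= t%:R :> R by rewrite ler1n.
apply: (le_trans (unstable_mean t0 hphi vn xn)).
have q0 : 0 < q%:R :> R by rewrite ltr0n.
apply: (@le_trans _ _ (A * expR (- (delta * t%:R `^ c)))).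
  rewrite ler_wpM2l ?(ltW A0)//; apply: (@le_trans _ _ (phi t%:R)).
    by apply: phim => //; rewrite ler_nat.
  by apply: hT; rewrite (le_trans h4)// (le_trans (qle q4 _)) ?ler_nat// leq_addl.
apply: ler_pM; rewrite ?(ltW A0) ?expR_ge0//.
  by rewrite (le_trans h1)// qle// -!addnA leq_addr.
rewrite ler_expR lerN2; apply: ler_pM; rewrite ?powR_ge0 ?invr_ge0//.
  rewrite -[leRHS]invrK lef_pV2 ?posrE ?invr_gt0// (le_trans h2)// qle//.
  by clear; lia.
rewrite ler_powR// -[leRHS]invrK lef_pV2 ?posrE ?invr_gt0// (le_trans h3)// qle//.
by clear; lia.
Qed.


(** With [t] near [s ^ (1 / L)], expanding the local functions costs at most [exp (Q * t ^ M)] up to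
    a constant, whereas clustering across a distance of order [t ^ L] gains
    [exp (- eta * t ^ M.+1)]. What remains is at most of order [exp (- t)] and beats the volume of
    scale [s], a polynomial in [t]; the truncation error does so as well. *)
Lemma approximable_quasi_local (C c : nat -> R) phi (c0 C1 b : R) :
  polynomial_growth S R -> clustering S P X C c phi -> 0 < c0 -> (forall j, c0 <= c j) ->
  (forall j, C j <= C1 * expR (j%:R ^+ 2)) -> 0 < b -> stretched_exp_decay phi b ->
  (forall i, exponentially_quasi_local S P X (xi i)) -> (forall i, exponential_growth S (xi i)) ->
  approximable S X xi C c phi.
Proof.
move=> growth clus c00 cc hC b0 /stretched_exp_decayP[db [Tb [db0 hphi]]] eq eg.
have [C0' [D growth']] := polynomial_growthP cayleyS growth.
have [q q0 hq] := quasi_local_bound eq; have [n0 hn0] := growth_bound eg.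
have C10 : 0 <= C1.
  have := le_trans (C_ge0 clus 0) (hC 0%N); rewrite pmulr_lge0 ?expR_gt0//.
pose C0 : R := C0'%:R.
apply: (approximable_large clus) => p K.
(* Up to constants, [t ^ (2 * D)] bounds the squared number of spins, present through
   [C j <= C1 * exp (j ^ 2)], and [t ^ n0] the logarithm of the score bound [B]. *)
pose M := (2 * D + n0 + 1)%N.
(* [L * b >= M + 1] lets clustering win, and [L >= 2] gives [4 * t <= s] once [t >= 4]. *)
have [Lb hLb] := nat_ge (M.+1%:R / b); pose L := (Lb + 2)%N.
have hL : M.+1%:R <= L%:R * b.
  rewrite -ler_pdivrMr// (le_trans hLb)// ler_nat; exact: leq_addr.
pose NN := (L * D * K)%N.
pose C2 : R := (C0 * 2 ^+ (L * D)) ^+ K.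
have C00 : 0 <= C0 by [].
have C20 : 0 <= C2 by rewrite exprn_ge0// mulr_ge0// exprn_ge0.
pose eta := db * (c0 / 2) `^ b.
have eta0 : 0 < eta by rewrite mulr_gt0// powR_gt0// divr_gt0.
pose Q := 2 * (p%:R * C0) + (p%:R * C0) ^+ 2 + p%:R * n0%:R : R.
have Q0 : 0 <= Q by rewrite !addr_ge0// ?sqr_ge0// !mulr_ge0.
have qr0 : 0 < q%:R :> R by rewrite ltr0n.
have [T1 hT1] : exists T : nat, forall t, (T <= t)%N -> (t%:R : R) ^+ NN <= expR ((2 * q%:R)^-1 * t%:R `^ q%:R^-1).
  by apply: exp_eventually_ge; rewrite invr_gt0// mulr_gt0.
have [T2 hT2] : exists T : nat, forall t, (T <= t)%N -> (t%:R : R) ^+ NN <= expR (1 * t%:R `^ 1).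
  exact: exp_eventually_ge.
have [T3 hT3] := nat_ge ((Q + 1) / eta).
have [T4 hT4] := nat_ge (Tb / (c0 / 2)).
(* [T1] serves the truncation error, [T2] the final factor [exp (- t)], [T3] the comparison of
   exponents, [T4] the onset of the decay of [phi]. *)
pose t0 := (T1 + T2 + T3 + T4 + q + 4)%N.
exists (q%:R * C2 + C1 * C2), (t0 ^ L)%N => s hs.
have L0 : (0 < L)%N by rewrite /L addn2.
have s0 : (0 < s)%N by rewrite (leq_trans _ hs)// expn_gt0 /t0 addn4.
have [t [tt0 ts st]] : exists t, [/\ (t0 <= t)%N, (t ^ L <= s)%N & (s < t.+1 ^ L)%N].
  have ex : exists t, (t ^ L <= s)%N by exists t0.
  have bd t : (t ^ L <= s)%N -> (t <= s)%N.
    case: t => // t; apply: leq_trans; rewrite -[X in (X <= _)%N]expn1.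
    exact: leq_pexp2l.
  case: (ex_maxnP ex bd) => t ts tmax; exists t; split => //; first exact: tmax.
  by rewrite ltnNge; apply/negP => /tmax; rewrite ltnn.
have t4 : (4 <= t)%N by rewrite (leq_trans _ tt0)// leq_addl.
have t1' : (0 < t)%N by rewrite (leq_trans _ t4).
have t1 : 1 <= t%:R :> R by rewrite ler1n.
have tpos : 0 <= t%:R :> R by [].
have t4s : (4 * t <= s)%N.
  apply: leq_trans ts; rewrite /L expnD; apply: leq_trans (_ : t ^ 2 <= _)%N.
    by rewrite -mulnn leq_mul2r t4 orbT.
  by rewrite leq_pmull// expn_gt0 t1'.
have volt : N t <= C0 * t%:R ^+ D by rewrite -natrX -natrM ler_nat growth'.
have vols : N s ^+ K <= C2 * t%:R ^+ NN.
  rewrite /NN exprM -exprMn lerXn2r ?nnegrE ?mulr_ge0 ?exprn_ge0//.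
  apply: (@le_trans _ _ (C0 * s%:R ^+ D)); first by rewrite -natrX -natrM ler_nat growth'.
  rewrite -mulrA ler_wpM2l// -exprMn exprM lerXn2r ?nnegrE ?exprn_ge0// ?mulr_ge0//.
  rewrite -natrM -natrX ler_nat (leq_trans (ltnW st))// leq_exp2r//.
  by rewrite mul2n -addnn -addn1 leq_add2l.
have NsK : 0 < N s ^+ K by rewrite exprn_gt0// ltr0n vol_gt0.
have tM j : (j <= M)%N -> (t%:R : R) ^+ j <= t%:R ^+ M by move=> jM; rewrite ler_weXn2l.
pose B := expR (n0%:R * t%:R ^+ n0) : R.
(* The square root of the exponential in [quasi_local_bound], since failure probabilities are
   measured by [lam ^ 2]; the prefactor is kept, as [q <= q ^ 2]. *)
pose lam := q%:R * expR (- ((2 * q%:R)^-1 * t%:R `^ q%:R^-1)) : R.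
exists t, B, lam; split.
- by move: t4s t1'; clear; lia.
- by rewrite -expR0 ler_expR mulr_ge0// exprn_ge0.
- by rewrite mulr_gt0// expR_gt0.
- exists (stable t) => i x; split.
  + exact: stable_depends.
  + exact: stable_score_depends.
  + by move=> mu; apply: stable_bound => // nu; exact: hn0.
  + move=> n vn xn; apply: (@le_trans _ _ (q%:R * expR (- (q%:R^-1 * t%:R `^ q%:R^-1)))).
      by apply: hq => //; move: tt0; rewrite /t0; clear; lia.
    rewrite /lam exprMn expr2 -mulrA ler_wpM2l//.
    rewrite expr2 -expRD -[leLHS]mul1r ler_pM ?ler01 ?expR_ge0 ?ler1n// ler_expR.
    by rewrite invfM -!mulrA; move: (q%:R^-1 * _) => z; lra.
- split.
  + rewrite ler_pdivlMr//; apply: (@le_trans _ _ (q%:R * C2)); last by rewrite lerDl mulr_ge0.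
    rewrite /lam -mulrA ler_wpM2l// (le_trans (ler_wpM2l (expR_ge0 _) vols))//.
    rewrite mulrCA ler_piMr// expRN mulrC ler_pdivrMr ?expR_gt0// mul1r.
    by apply: hT1; move: tt0; rewrite /t0; clear; lia.
  + rewrite ler_pdivlMr//; apply: (@le_trans _ _ (C1 * C2)); last by rewrite lerDr mulr_ge0.
    set kk := (p * vol S t)%N; set u := (s - 2 * t)%N.
    have kD : kk%:R <= p%:R * C0 * t%:R ^+ D :> R.
      by rewrite /kk natrM -mulrA ler_wpM2l.
    have k0 : 0 <= kk%:R :> R by [].
    have k1 : kk%:R <= p%:R * C0 * t%:R ^+ M :> R.
      by rewrite (le_trans kD)// ler_wpM2l ?mulr_ge0// tM//; rewrite /M; clear; lia.
    have k2 : kk%:R ^+ 2 <= (p%:R * C0) ^+ 2 * t%:R ^+ M :> R.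
      apply: (@le_trans _ _ ((p%:R * C0 * t%:R ^+ D) ^+ 2)).
        by rewrite lerXn2r ?nnegrE ?mulr_ge0 ?exprn_ge0.
      by rewrite exprMn ler_wpM2l ?sqr_ge0// -exprM tM//; rewrite /M; clear; lia.
    have h3 : 3 ^+ kk <= expR (2 * kk%:R) :> R.
      rewrite mulrC expRM_natl lerXn2r ?nnegrE ?expR_ge0//.
      by rewrite (le_trans _ (expR_ge1Dx 2))//; lra.
    have hB : B ^+ p <= expR (p%:R * n0%:R * t%:R ^+ M).
      rewrite /B -expRM_natl ler_expR -mulrA ler_wpM2l// ler_wpM2l// tM//; rewrite /M; clear; lia.
    have hph : phi (c kk * u%:R) <= expR (- (eta * t%:R ^+ M.+1)).
      have [_ _ [cpos _] [_ phim _] _] := clus.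
      have tL : t%:R ^+ L / 2 <= u%:R :> R.
        rewrite ler_pdivrMr// -natrX -natrM ler_nat (leq_trans ts)// /u.
        by move: t4s; clear; lia.
      have tLb : t%:R ^+ M.+1 <= (t%:R ^+ L) `^ b.
        by rewrite -powR_mulrn// -powR_mulrn// -powRrM ler_powR.
      have ct : Tb <= c0 / 2 * t%:R ^+ L.
        rewrite mulrC -ler_pdivrMr ?divr_gt0// (le_trans hT4)//.
        apply: (@le_trans _ _ t%:R); first by rewrite ler_nat; move: tt0; rewrite /t0; clear; lia.
        by rewrite -[leLHS]expr1 ler_weXn2l.
      apply: (@le_trans _ _ (phi (c0 / 2 * t%:R ^+ L))).
        apply: phim; first by rewrite mulr_ge0 ?exprn_ge0// divr_ge0// ltW.
        apply: (@le_trans _ _ (c0 * u%:R)); last by rewrite ler_wpM2r.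
        by rewrite -mulrA ler_wpM2l ?(ltW c00)// mulrC.
      apply: (le_trans (hphi _ ct)); rewrite ler_expR lerN2 /eta -mulrA ler_wpM2l ?(ltW db0)//.
      rewrite (powRM _ (divr_ge0 (ltW c00) (ler0n _ 2)) (exprn_ge0 _ tpos)).
      by rewrite ler_wpM2l ?powR_ge0.
    have hE : error_bound S C c phi p t B u <= C1 * expR (- t%:R).
      apply: (@le_trans _ _ (expR (2 * kk%:R) * expR (p%:R * n0%:R * t%:R ^+ M) *
          (C1 * expR (kk%:R ^+ 2) * expR (- (eta * t%:R ^+ M.+1))))).
        rewrite /error_bound -/kk; apply: ler_pM.
        - by rewrite mulr_ge0 ?exprn_ge0 ?expR_ge0.
        - by rewrite mulr_ge0 ?(C_ge0 clus) ?(phi_ge0 clus).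
        - by apply: ler_pM; rewrite ?exprn_ge0 ?expR_ge0.
        - by apply: ler_pM; rewrite ?(C_ge0 clus) ?(phi_ge0 clus).
      rewrite (_ : _ * _ * _ = C1 * (expR (2 * kk%:R) * expR (p%:R * n0%:R * t%:R ^+ M) *
          expR (kk%:R ^+ 2) * expR (- (eta * t%:R ^+ M.+1)))); last by ring.
      rewrite ler_wpM2l// -!expRD ler_expR.
      have e1 : (Q + 1) * t%:R ^+ M <= eta * t%:R ^+ M.+1.
        rewrite exprS mulrA ler_wpM2r ?exprn_ge0// mulrC -ler_pdivrMr// (le_trans hT3)//.
        by rewrite ler_nat; move: tt0; rewrite /t0; clear; lia.
      have e2 : t%:R <= t%:R ^+ M :> R by rewrite -[leLHS]expr1 ler_weXn2l// /M addn1.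
      move: e1 e2 k1 k2; rewrite /Q; move: (t%:R ^+ M) => y; move: (eta * _) => z e1 e2 k1 k2.
      rewrite !mulrDl mul1r in e1; nra.
    apply: (le_trans (ler_pM _ (ltW NsK) hE vols)).
      by rewrite /error_bound !mulr_ge0 ?exprn_ge0 ?expR_ge0 ?(C_ge0 clus) ?(phi_ge0 clus).
    rewrite mulrACA ler_piMr ?mulr_ge0// expRN mulrC ler_pdivrMr ?expR_gt0// mul1r.
    have := hT2 t; rewrite mul1r powRr1//; apply.
    by move: tt0; rewrite /t0; clear; lia.
Qed.


(** [j ^ (a * j)] is at most [j ^ j], and [ln j < j]; the first [j0] constants are bounded by
    monotonicity. *)
Lemma exponential_clustering_constants (C c : nat -> R) phi (a : R) : clustering S P X C c phi ->
  0 <= a < 1 -> C =O_\oo (fun k => k%:R `^ (a * k%:R)) ->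
  exists C1, forall j, C j <= C1 * expR (j%:R ^+ 2).
Proof.
move=> clus /andP[a0 a1] /eqO_exP [A A0 [j0 _ hj]].
have [_ [Cpos Cm] _ _ _] := clus.
exists (C j0 + A) => j; have C0 := ltW (Cpos j0).
have e1 : 1 <= expR (j%:R ^+ 2 : R) by rewrite -expR0 ler_expR sqr_ge0.
have [jj|/ltnW jj] := leqP j0 j; last first.
  rewrite (le_trans (Cm _ _ jj))// -[leLHS]mulr1 ler_pM// lerDl ltW//.
have := hj j jj; rewrite (ger0_norm (ltW (Cpos j))) ger0_norm ?powR_ge0// => h.
apply: (le_trans h); apply: (@le_trans _ _ (A * expR (j%:R ^+ 2))); last first.
  by rewrite ler_wpM2r ?expR_ge0// lerDr.
rewrite ler_wpM2l ?(ltW A0)//; have [->|jpos] := posnP j.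
  by rewrite mulr0 powRr0 expr0n /= expR0.
have j1 : 1 <= j%:R :> R by rewrite ler1n.
apply: (@le_trans _ _ (j%:R `^ j%:R)).
  by rewrite ler_powR// ler_piMl// ltW.
rewrite /powR (gt_eqF (lt_le_trans ltr01 j1)) ler_expR expr2 ler_wpM2l//.
by rewrite ltW// ln_sublinear// ltr0n.
Qed.

Lemma quasi_local_moments :
  (forall i (p : R), 1 <= p -> moment_condition S P X (xi i) p) -> bounded_moments S X xi.
Proof.
move=> mc.
have msc i n x : measurable_fun setT (score_at S X xi i n x) by exact: measurable_sc.
have key (p : nat) : exists2 M : R, 1 <= M & forall i n x, valid_window n ->
    (\int[P]_om (`|score_at S X xi i n x om| ^+ p)%:E <= M%:E)%E.
  have h i : exists M : R, forall n x, valid_window n -> inw S n x ->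
      (\int[P]_om (`|score_at S X xi i n x om| ^+ p)%:E <= M%:E)%E.
    (* The exponent [p + 1] is at least 1 even for [p = 0], and the maximum with 1 makes the higher
       power dominate. *)
    have := mc i p.+1%:R; rewrite ler1n => /(_ isT); rewrite /moment_condition.
    set s := ereal_sup _ => sfin; exists (Num.max 0 (fine s)) => n x vn xn.
    have sM : (s <= (Num.max 0 (fine s))%:E)%E.
      move: sfin; case: s => [r _| //|_]; last by rewrite leNye.
      by rewrite lee_fin le_max lexx orbT.
    apply: le_trans sM.
    have := window_probability (f := fun n x => 'E_P[(fun om => Num.max `|xi i x (windowed S X n om)| 1 `^ p.+1%:R)%R]%E)
      (lexx s) vn xn.
    apply: le_trans; rewrite unlock windowedE; apply: ge0_le_integral => //.
    - by apply/measurable_EFinP; apply: measurable_funX; exact: measurableT_comp.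
    - apply/measurable_EFinP.
      have -> : (fun om => Num.max `|xi i x (win S X n om)| 1 `^ p.+1%:R) =
          fun om => Num.max `|score_at S X xi i n x om| 1 ^+ p.+1.
        by apply/funext => om; rewrite powR_mulrn// le_max ler01 orbT.
      by apply: measurable_funX; apply: measurable_maxr => //; exact: measurableT_comp.
    - move=> om _; rewrite lee_fin /score_at powR_mulrn; last by rewrite le_max ler01 orbT.
      set y := `|_|; apply: (@le_trans _ _ (Num.max y 1 ^+ p)).
        by rewrite lerXn2r ?nnegrE ?le_max ?lexx ?normr_ge0// ler01 orbT.
      by rewrite ler_weXn2l// le_max lexx orbT.
  have [M hM] : exists M : R, forall i n x, valid_window n -> inw S n x ->
      (\int[P]_om (`|score_at S X xi i n x om| ^+ p)%:E <= M%:E)%E.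
    apply: fin_real_bound h => i a b ab h n x vn xn.
    by apply: (le_trans (h n x vn xn)); rewrite lee_fin.
  exists (Num.max 1 M); first by rewrite le_max lexx.
  move=> i n x vn; have [xn|xn] := boolP (inw S n x).
    by apply: (le_trans (hM i n x vn xn)); rewrite lee_fin le_max lexx orbT.
  under eq_integral do rewrite sc_outside// normr0.
  rewrite integral_cst//= probability_setT mule1 lee_fin le_max expr0n.
  by case: p {h hM}; rewrite /= ?lexx// ler01.
have fsc i n x : valid_window n -> fmom P (score_at S X xi i n x).
  move=> vn; split => // p; apply/integrableP; split.
    by apply/measurable_EFinP; apply: measurable_funX; exact: measurableT_comp.
  have [M _ hM] := key p.
  under eq_integral do rewrite /= ger0_norm ?exprn_ge0//.
  by apply: (le_lt_trans (hM i n x vn)); exact: ltry.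
split => // p; have [M M1 hM] := key p; exists M => i n x vn.
have fa : fmom P (fun om => `|score_at S X xi i n x om| ^+ p) by apply: fmomX; apply: fmom_abs; exact: fsc.
rewrite -lee_fin /mean /Rintegral fineK; first exact: hM.
by apply: integrable_fin_num => //; exact: fmom_int fa.
Qed.

End QuasiLocal.

(** * Asymptotic covariances *)

Lemma ler_sum_subset (R : numDomainType) (I : eqType) (r r' : seq I) (F : I -> R) :
  uniq r -> uniq r' -> {subset r <= r'} -> (forall i, 0 <= F i) ->
  \sum_(i <- r) F i <= \sum_(i <- r') F i.
Proof.
move=> ur ur' rr' F0; rewrite [leRHS](bigID (mem r))/= -[leLHS]addr0 lerD//; last first.
  by rewrite sumr_ge0.
rewrite le_eqVlt; apply/orP; left; apply/eqP; rewrite -[RHS]big_filter.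
apply: perm_big; apply: uniq_perm => //; first exact: filter_uniq.
by move=> i; rewrite mem_filter /=; have [/rr' ->|] := boolP (i \in r).
Qed.

Lemma cvg_esum_exhaust (R : realType) (V : choiceType) (A : nat -> {fset V}) (g : V -> R) :
  {homo A : m n / (m <= n)%N >-> (m `<=` n)%fset} -> (forall x, exists n, x \in A n) ->
  (forall x, 0 <= g x) -> (\esum_(x in [set: V]) (g x)%:E < +oo)%E ->
  \sum_(x <- A n) g x @[n --> \oo] --> fine (\esum_(x in [set: V]) (g x)%:E)%E.
Proof.
move=> mA exA g0 gfin; set E := (\esum_(x in _) _)%E.
have E0 : (0 <= E)%E by apply: esum_ge0 => x _; rewrite lee_fin.
have Efin : E \is a fin_num by rewrite ge0_fin_numE.
have le_E (B : {fset V}) : \sum_(x <- B) g x <= fine E.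
  rewrite -lee_fin fineK// -sumEFin; apply: esum_ge; exists [set` B].
    by split => //; exact: finite_fset.
  by rewrite -fsbig_seq// fset_uniq.
apply/cvgn_distP => e e0.
have [_ [B [finB _] <-] hB] : exists2 y, [set (\sum_(x \in B) (g x)%:E)%E | B in fsets [set: V]] y & (E - e%:E < y)%E.
  by apply: ub_ereal_sup_adherent.
have [n0 hn0] : exists n0, {subset fset_set B <= A n0}.
  suff h (r : seq V) : exists n0, {subset r <= A n0} by exact: (h (fset_set B)).
  elim: r => [|x r [n hn]]; first by exists 0%N.
  have [m xm] := exA x; exists (maxn m n) => y; rewrite inE => /predU1P[->|/hn yn].
    by have /fsubsetP := mA _ _ (leq_maxl m n); exact.
  by have /fsubsetP := mA _ _ (leq_maxr m n); exact.
exists n0 => n nn0; rewrite distrC ger0_norm ?subr_ge0//.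
have Bn : \sum_(x <- fset_set B) g x <= \sum_(x <- A n) g x.
  apply: ler_sum_subset; rewrite ?fset_uniq// => x xB.
  by have /fsubsetP := mA _ _ nn0; apply; exact: hn0.
rewrite ltrBlDr -ltrBlDl; apply: lt_le_trans Bn.
move: hB; rewrite fsbig_finite//= sumEFin -(fineK Efin) -EFinB lte_fin.
by [].
Qed.

(** * Density of double sums over large balls *)

Section Density.
Variables (R : realType) (V : groupType) (S : {fset V}).
Hypothesis cayleyS : cayley_graph S.
Notation N s := ((vol S s)%:R : R).

Lemma vol_inv_ge0 s m : 0 <= (N s ^+ m)^-1. Proof. by rewrite invr_ge0 exprn_ge0. Qed.

(** The sphere of radius [m + 1] has [vol (m + 1) - vol m] points, each contributing
    [vol (m + 1) ^ -2], so the sum telescopes whatever the growth. Decay like an inverse squared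
    volume is therefore summable. *)
Lemma tail_ball s m : (s <= m)%N ->
  \sum_(z <- ball S m | (s < len S z)%N) (N (len S z) ^+ 2)^-1 <= (N s)^-1 - (N m)^-1.
Proof.
have Npos j : 0 < N j by rewrite ltr0n vol_gt0.
elim: m => [|m ih].
  rewrite leqn0 => /eqP ->; rewrite subrr big1_seq// => z /andP[sz].
  by rewrite mem_ball// leqNgt sz.
rewrite leq_eqVlt => /predU1P[<-|sm].
  by rewrite subrr big1_seq// => z /andP[sz]; rewrite mem_ball// leqNgt sz.
have pm : perm_eq (ball S m.+1) (ball S m ++ (ball S m.+1 `\` ball S m)%fset).
  apply: uniq_perm; rewrite ?fset_uniq// ?cat_uniq ?fset_uniq ?andbT/=.
    by apply/hasPn => z; rewrite in_fsetD => /andP[].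
  move=> z; rewrite mem_cat in_fsetD; case: (boolP (z \in ball S m)) => //= zm.
  by rewrite (ball_le (leqnSn m)).
rewrite (perm_big _ pm) big_cat /=.
have h : \sum_(z <- (ball S m.+1 `\` ball S m)%fset | (s < len S z)%N) (N (len S z) ^+ 2)^-1 <=
    (N m)^-1 - (N m.+1)^-1.
  apply: (@le_trans _ _ ((N m.+1 - N m) * (N m.+1 ^+ 2)^-1)).
    apply: (@le_trans _ _ (\sum_(z <- (ball S m.+1 `\` ball S m)%fset) (N (len S z) ^+ 2)^-1)).
      by rewrite [leRHS](bigID (fun z => (s < len S z)%N))/= lerDl sumr_ge0// => z _; exact: vol_inv_ge0.
    rewrite (eq_big_seq (fun=> (N m.+1 ^+ 2)^-1)); last first.
      move=> z; rewrite in_fsetD !mem_ball// -ltnNge => /andP[h1 h2].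
      by have -> : len S z = m.+1 by apply/eqP; rewrite eqn_leq h2 h1.
    rewrite big_const_seq count_predT iter_addr addr0 -[leLHS]mulr_natl ler_wpM2r ?vol_inv_ge0//.
    by rewrite cardfsDS ?natrB ?vol_le//; apply/fsubsetP/ball_le.
  have e : (N m)^-1 - (N m.+1)^-1 = (N m.+1 - N m) * (N m * N m.+1)^-1.
    by field; rewrite !gt_eqF.
  rewrite e ler_wpM2l ?subr_ge0 ?ler_nat ?vol_le//.
  rewrite lef_pV2 ?posrE ?mulr_gt0 ?exprn_gt0// expr2 ler_wpM2r// ler_nat vol_le//.
by have := lerD (ih sm) h; lra.
Qed.

Lemma tail_translate s x (r : seq V) : uniq r ->
  \sum_(y <- r | (s < gdist S x y)%N) (N (gdist S x y) ^+ 2)^-1 <= (N s)^-1.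
Proof.
move=> ur; pose F z := if (s < len S z)%N then (N (len S z) ^+ 2)^-1 else 0.
have F0 z : 0 <= F z by rewrite /F; case: ifP => // _; exact: vol_inv_ge0.
have [m hm] : exists m, forall y, y \in r -> (x^-1 * y)%g \in ball S m.
  elim: r {ur} => [|y r [m hm]]; first by exists 0%N.
  exists (maxn (len S (x^-1 * y)%g) m) => z; rewrite inE => /predU1P[->|/hm].
    by rewrite mem_ball// leq_maxl.
  by rewrite !mem_ball// => h; rewrite (leq_trans h)// leq_maxr.
apply: (@le_trans _ _ (\sum_(z <- ball S (maxn s m)) F z)).
  rewrite big_mkcond/=; have -> : \sum_(y <- r) (if (s < gdist S x y)%N then (N (gdist S x y) ^+ 2)^-1 else 0) =
      \sum_(z <- [seq (x^-1 * y)%g | y <- r]) F z.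
    by rewrite big_map; apply: eq_bigr => y _; rewrite /F gdistE.
  apply: ler_sum_subset => //.
    by rewrite map_inj_uniq// => y z /mulgI.
    exact: fset_uniq.
  by move=> _ /mapP[y /hm ym ->]; exact: (ball_le (leq_maxr s m)).
rewrite -big_mkcond/= (le_trans (tail_ball (leq_maxl s m)))//.
by rewrite lerBlDr lerDl invr_ge0.
Qed.

Lemma sum_translate x (r : seq V) : uniq r ->
  \sum_(y <- r) (N (gdist S x y) ^+ 2)^-1 <= 2.
Proof.
move=> ur; rewrite (bigID (fun y => (0 < gdist S x y)%N))/=.
have h := tail_translate 0 x ur.
have v0 : vol S 0 = 1%N by rewrite /vol cardfs1.
rewrite v0 invr1 in h; rewrite -[2]/(1 + 1) lerD//.
apply: (@le_trans _ _ (\sum_(y <- [:: x]) 1)); last by rewrite big_seq1.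
rewrite -big_filter.
apply: (@le_trans _ _ (\sum_(y <- [seq y <- r | ~~ (0 < gdist S x y)%N]) 1)).
  rewrite big_seq [leRHS]big_seq; apply: ler_sum => y; rewrite mem_filter -eqn0Ngt => /andP[/eqP -> _].
  by rewrite v0 expr1n invr1.
apply: ler_sum_subset => //; first exact: filter_uniq.
move=> y; rewrite mem_filter -eqn0Ngt inE gdistE// => /andP[/eqP /(len0 cayleyS) e _].
by rewrite -(mulVKg x y) e mulg1.
Qed.

Variables (a : nat -> V -> V -> R) (b : V -> R) (C : R).
Hypothesis C0 : 0 <= C.
Hypothesis a_decay : forall n x y, (0 < n)%N -> `|a n x y| <= C / N (gdist S x y) ^+ 2.
Hypothesis a_b : forall n s x y, (0 < n)%N -> (0 < s)%N -> {subset nbh S x s <= ball S n} ->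
  {subset nbh S y s <= ball S n} -> `|a n x y - b (x^-1 * y)%g| <= C / N s ^+ 2.
Hypothesis b_decay : forall z, `|b z| <= C / N (len S z) ^+ 2.

Lemma sum_b_bound (r : seq V) : uniq r -> \sum_(z <- r) `|b z| <= C * 2.
Proof.
move=> ur; apply: (@le_trans _ _ (C * \sum_(z <- r) (N (gdist S 1%g z) ^+ 2)^-1)).
  by rewrite mulr_sumr; apply: ler_sum => z _; exact: b_decay.
by rewrite ler_wpM2l// sum_translate.
Qed.

Lemma summable_b : summable [set: V] (fun z => (b z)%:E).
Proof.
rewrite /summable; apply: (@le_lt_trans _ _ (C * 2)%:E); last exact: ltry.
apply: ge_ereal_sup => _ [A [finA _] <-].
by rewrite fsbig_finite//= sumEFin lee_fin sum_b_bound// fset_uniq.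
Qed.

Definition total_b : R :=
  fine (\esum_(z in [set: V]) ((fun z => (b z)%:E)^\+ z) - \esum_(z in [set: V]) ((fun z => (b z)%:E)^\- z))%E.

(** The unordered sums of the positive and of the negative part are both limits of their sums along
    the exhausting balls. *)
Lemma sum_b_cvg : \sum_(z <- ball S s) b z @[s --> \oo] --> total_b.
Proof.
have sp := summable_funepos summable_b; have sn := summable_funeneg summable_b.
pose bp z := Num.max (b z) 0; pose bn z := Num.max (- b z) 0.
have epE : (fun z => (b z)%:E)^\+%E = fun z => (bp z)%:E by apply/funext => z; rewrite funeposE EFin_max.
have enE : (fun z => (b z)%:E)^\-%E = fun z => (bn z)%:E by apply/funext => z; rewrite funenegE EFin_max.
have bp0 z : 0 <= bp z by rewrite le_max lexx orbT.
have bn0 z : 0 <= bn z by rewrite le_max lexx orbT.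
rewrite epE in sp; rewrite enE in sn.
have fp : (\esum_(z in [set: V]) (bp z)%:E < +oo)%E.
  by apply: le_lt_trans sp; apply: le_esum => z _; rewrite lee_fin ler_norm.
have fn : (\esum_(z in [set: V]) (bn z)%:E < +oo)%E.
  by apply: le_lt_trans sn; apply: le_esum => z _; rewrite lee_fin ler_norm.
have mono : {homo ball S : m n / (m <= n)%N >-> (m `<=` n)%fset}.
  by move=> m n mn; apply/fsubsetP; exact: ball_le.
have cp := cvg_esum_exhaust mono (ball_cover cayleyS) bp0 fp.
have cn := cvg_esum_exhaust mono (ball_cover cayleyS) bn0 fn.
rewrite /total_b epE enE fineB; last 2 first.
- by rewrite ge0_fin_numE// esum_ge0// => z _; rewrite lee_fin.
- by rewrite ge0_fin_numE// esum_ge0// => z _; rewrite lee_fin.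
have -> : (fun s => \sum_(z <- ball S s) b z) = (fun s => \sum_(z <- ball S s) bp z - \sum_(z <- ball S s) bn z).
  apply/funext => s; rewrite -sumrB; apply: eq_bigr => z _; rewrite /bp /bn.
  by have [h|h] := leP (b z) 0; [rewrite (max_idPl _) ?oppr_ge0// sub0r opprK|rewrite (max_idPr _) ?oppr_le0 ?subr0// ltW].
exact: cvgB.
Qed.

(** Sites beyond [s] contribute a tail of at most [C / vol s]; each of the [vol s] sites within [s]
    differs from its stationary value by at most [C / vol s ^ 2]. The radius [2 * s] keeps the
    [s]-balls around those sites inside the window too. *)
Lemma inner_row n s x : (0 < n)%N -> (0 < s)%N -> {subset nbh S x (2 * s) <= ball S n} ->
  `|\sum_(y <- ball S n) a n x y - \sum_(z <- ball S s) b z| <= 2 * C / N s.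
Proof.
move=> n0 s0 xs; have Ns : 0 < N s by rewrite ltr0n vol_gt0.
rewrite (bigID (fun y => (s < gdist S x y)%N))/=.
have h1 : `|\sum_(y <- ball S n | (s < gdist S x y)%N) a n x y| <= C / N s.
  rewrite (le_trans (ler_norm_sum _ _ _))//.
  apply: (@le_trans _ _ (C * \sum_(y <- ball S n | (s < gdist S x y)%N) (N (gdist S x y) ^+ 2)^-1)).
    by rewrite mulr_sumr; apply: ler_sum => y _; exact: a_decay.
  by rewrite ler_wpM2l// tail_translate// fset_uniq.
have e : \sum_(y <- ball S n | ~~ (s < gdist S x y)%N) a n x y = \sum_(z <- ball S s) a n x (x * z)%g.
  rewrite -big_filter -(big_map (fun z => (x * z)%g) xpredT (fun y => a n x y)).
  apply: perm_big; apply: uniq_perm.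
  - exact/filter_uniq/fset_uniq.
  - by rewrite map_inj_uniq ?fset_uniq// => y z /mulgI.
  - move=> y; rewrite mem_filter -leqNgt -[_ \in map _ _]/(y \in nbh S x s) mem_nbh//.
    have [ys|//] := boolP (gdist S x y <= s)%N; rewrite andTb; apply/idP.
    by apply: xs; rewrite mem_nbh// (leq_trans ys)// mul2n -addnn leq_addr.
rewrite e -addrA -sumrB; have -> : 2 * C / N s = C / N s + C / N s by ring.
rewrite (le_trans (ler_normD _ _))// lerD//.
rewrite (le_trans (ler_norm_sum _ _ _))//.
apply: (@le_trans _ _ (\sum_(z <- ball S s) C / N s ^+ 2)); last first.
  rewrite big_const_seq count_predT iter_addr addr0 -[leLHS]mulr_natl -/(vol S s).
  by rewrite le_eqVlt; apply/orP; left; apply/eqP; field; rewrite gt_eqF.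
rewrite big_seq [leRHS]big_seq; apply: ler_sum => z zs.
rewrite -[X in b X](mulKg x z); apply: a_b => // y; rewrite mem_nbh// => hy; apply: xs; rewrite mem_nbh//.
  by rewrite (leq_trans hy)// mul2n -addnn leq_addr.
rewrite (leq_trans (gdist_triangle cayleyS (x * z)%g x y))// mul2n -addnn leq_add//.
by rewrite gdistE// mulKg -mem_ball.
Qed.

Lemma row_bound n x : (0 < n)%N -> `|\sum_(y <- ball S n) a n x y| <= C * 2.
Proof.
move=> n0; rewrite (le_trans (ler_norm_sum _ _ _))//.
apply: (@le_trans _ _ (C * \sum_(y <- ball S n) (N (gdist S x y) ^+ 2)^-1)).
  by rewrite mulr_sumr; apply: ler_sum => y _; exact: a_decay.
by rewrite ler_wpM2l// sum_translate// fset_uniq.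
Qed.

(** Rows of points off the collar are close to [total_b] by [inner_row]; the others are bounded, and
    amenability makes the density of the collar vanish. *)
Lemma density_cvg : b_amenable S R ->
  (\sum_(x <- ball S n) \sum_(y <- ball S n) a n x y) / N n @[n --> \oo] --> total_b.
Proof.
move=> amen; apply/cvgn_distP => e e0.
have e40 : 0 < e / 4 by rewrite divr_gt0.
have [s1 hs1] := (cvgn_distP _ _).1 sum_b_cvg _ e40.
have [s2 hs2] := nat_ge (2 * C / (e / 4)).
pose s := (maxn s1 s2).+1.
have Ns : 0 < N s by rewrite ltr0n vol_gt0.
have hs : 2 * C / N s <= e / 4.
  rewrite ler_pdivrMr// [leRHS]mulrC -ler_pdivrMr// (le_trans hs2)// ler_nat.
  rewrite (leq_trans _ (ltnW (vol_ge cayleyS s)))// /s ltnW// ltnS leq_maxr//.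
(* A collar point contributes at most [4 * C], half from its row and half from [beta]; the 1 keeps
   the divisor positive. *)
have C41 : 0 < 4 * C + 1 by rewrite ltr_wpDl// mulr_ge0.
have [n1 hn1] := (cvgn_distP _ _).1 (collar_cvg cayleyS (2 * s) amen) _ (divr_gt0 e40 C41).
exists (maxn 1 n1) => n; rewrite geq_max => /andP[n0 nn1].
have Nn : 0 < N n by rewrite ltr0n vol_gt0.
set beta := \sum_(z <- ball S s) b z.
have hb : `|beta - total_b| < e / 4 by apply: hs1; rewrite /s ltnW// ltnS leq_maxl.
have bb : `|beta| <= C * 2 by rewrite (le_trans (ler_norm_sum _ _ _))// sum_b_bound// fset_uniq.
have hcol : #|` collar S n (2 * s)|%:R * (4 * C) <= N n * (e / 4).
  have := hn1 n nn1; rewrite subr0 ger0_norm ?divr_ge0// ltr_pdivrMr// => h.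
  apply: (@le_trans _ _ (e / 4 / (4 * C + 1) * N n * (4 * C))).
    by rewrite ler_wpM2r ?mulr_ge0// ltW.
  have -> : e / 4 / (4 * C + 1) * N n * (4 * C) = N n * (e / 4) * (4 * C / (4 * C + 1)).
    by field; rewrite gt_eqF.
  by rewrite ler_piMr ?mulr_ge0 ?(ltW e0)// ler_pdivrMr// mul1r lerDl.
have main : `|\sum_(x <- ball S n) \sum_(y <- ball S n) a n x y - N n * beta| <=
    N n * (e / 4) + #|` collar S n (2 * s)|%:R * (4 * C).
  have -> : N n * beta = \sum_(x <- ball S n) beta.
    by rewrite big_const_seq count_predT iter_addr addr0 -[RHS]mulr_natl.
  rewrite -sumrB (le_trans (ler_norm_sum _ _ _))//.
  apply: (@le_trans _ _ (\sum_(x <- ball S n) (e / 4 + (x \in collar S n (2 * s))%:R * (4 * C)))).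
    rewrite big_seq [leRHS]big_seq; apply: ler_sum => x xn.
    have [xc|xc] := boolP (x \in collar S n (2 * s)).
      rewrite mul1r -[leLHS]add0r lerD ?(ltW e40)//.
      have -> : 4 * C = C * 2 + C * 2 by ring.
      by rewrite (le_trans (ler_normB _ _))// lerD// row_bound.
    rewrite mul0r addr0 (le_trans _ hs)//; apply: inner_row => // y; rewrite mem_nbh// => xy.
    apply: contraNT xc => yn; rewrite !inE xn /=; apply/asboolP; by exists y.
  rewrite big_split/= big_const_seq count_predT iter_addr addr0 -[X in X + _]mulr_natl lerD2l.
  rewrite -mulr_suml ler_wpM2r ?mulr_ge0//.
  rewrite -natr_sum ler_nat -big_mkcond/= sum1_count -size_filter.
  apply: uniq_leq_size; first exact/filter_uniq/fset_uniq.
  by move=> x; rewrite mem_filter => /andP[].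
set A := \sum_(x <- _) _ in main *.
have -> : A / N n - total_b = (A - N n * beta) / N n + (beta - total_b).
  by field; rewrite gt_eqF.
rewrite (le_lt_trans (ler_normD _ _))//.
have : `|(A - N n * beta) / N n| <= e / 4 + e / 4.
  rewrite normrM normfV (ger0_norm (ltW Nn)) ler_pdivrMr// (le_trans main)//.
  by rewrite mulrC [in leRHS]mulrDl lerD//; first rewrite [leRHS]mulrC// mulrC.
by lra.
Qed.

End Density.

(** * Covariances of scores under the common hypotheses *)

Section Hub.
Variables (R : realType) (V : groupType) (S : {fset V}).
Hypothesis cayleyS : cayley_graph S.
Variables (d : measure_display) (Omega : measurableType d).
Variables (P : probability Omega R) (X : {RV P >-> config V}).
Variables (k : nat) (xi : 'I_k -> V -> config V -> R).
Hypothesis score_xi : forall i, score_function (xi i).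
Variables (C c : nat -> R) (phi : R -> R).
Hypothesis clus : clustering S P X C c phi.
Hypothesis appr : approximable S X xi C c phi.
Hypothesis bm : bounded_moments S X xi.
Hypothesis amen : b_amenable S R.

Notation N s := ((vol S s)%:R : R).
Local Notation sc := (score_at S X xi).

Lemma fmom_sc i n x : valid_window n -> fmom P (sc i n x).
Proof. by case: bm => h _; exact: h. Qed.

Lemma abs_moment p : exists2 M, 0 <= M & forall i n x, valid_window n ->
  mean P (fun om => (1 + `|sc i n x om|) ^+ p) <= M.
Proof.
have [_ /(_ p)[M hM]] := bm.
exists (Num.max 0 (2 ^+ p * (1 + M))); first by rewrite le_max lexx.
move=> i n x vn; rewrite le_max; apply/orP; right.
have fs : fmom P (fun om => `|sc i n x om| ^+ p) by apply/fmomX/fmom_abs/fmom_sc.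
apply: (@le_trans _ _ (mean P (fun om => 2 ^+ p * (1 + `|sc i n x om| ^+ p)))).
  apply: mean_le.
  - by apply: fmomX; apply: fmomD; [exact: fmom_cst|exact/fmom_abs/fmom_sc].
  - by apply: fmomZ; apply: fmomD; [exact: fmom_cst|].
  - move=> om; set y := `|sc i n x om|; have y0 : 0 <= y by exact: normr_ge0.
    have [y1|y1] := leP y 1.
      apply: (@le_trans _ _ (2 ^+ p)); first by rewrite lerXn2r ?nnegrE ?addr_ge0//; lra.
      by rewrite ler_peMr ?exprn_ge0// lerDl exprn_ge0.
    apply: (@le_trans _ _ ((2 * y) ^+ p)).
      by rewrite lerXn2r ?nnegrE ?addr_ge0 ?mulr_ge0//; lra.
    by rewrite exprMn ler_wpM2l ?exprn_ge0// lerDr.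
rewrite meanZ; last by apply: fmomD; [exact: fmom_cst|].
rewrite meanD ?mean_cst//; last exact: fmom_cst.
by rewrite ler_wpM2l ?exprn_ge0// lerD2l hM.
Qed.

Lemma square_moment p : exists2 M, 0 <= M & forall i n x, valid_window n ->
  mean P (fun om => (1 + sc i n x om ^+ 2) ^+ p) <= M.
Proof.
have [M M0 hM] := abs_moment (2 * p); exists M => // i n x vn.
apply: le_trans (hM i n x vn); have fs := fmom_sc i x vn; apply: mean_le.
- by apply: fmomX; apply: fmomD; [exact: fmom_cst|exact: fmomX].
- by apply: fmomX; apply: fmomD; [exact: fmom_cst|exact: fmom_abs].
- move=> om; rewrite exprM lerXn2r ?nnegrE ?addr_ge0 ?sqr_ge0//.
  rewrite -(real_normK (num_real (sc i n x om))) sqrrD expr1n mul1r lerD2r lerDl.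
  by rewrite mulrn_wge0.
Qed.

Lemma mean_sc_bound : exists2 M, 0 <= M & forall i n x, valid_window n ->
  `|mean P (sc i n x)| <= M.
Proof.
have [M M0 hM] := abs_moment 1; exists M => // i n x vn.
apply: le_trans (hM i n x vn); have fs := fmom_sc i x vn; apply: mean_abs_le => //.
  by apply: fmomX; apply: fmomD; [exact: fmom_cst|exact: fmom_abs].
by move=> om; rewrite expr1 lerDr.
Qed.

Lemma sc_cov_decay K : exists2 D, 0 <= D & forall i j n x y s, valid_window n -> (0 < s)%N ->
  (s <= gdist S x y)%N -> `|cov P (sc i n x) (sc j n y)| <= D / N s ^+ K.
Proof.
have [C0 C00 h] := appr 2 K; have [M M0 hM] := square_moment 2.
have L0 : 0 <= loc_const 2 M.
  by rewrite /loc_const mulr_ge0// !addr_ge0// !mulr_ge0// addr_ge0// mulr_ge0.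
exists ((loc_const 2 M + 1) * C0) => [|i j n x y s vn s0 sxy]; first by rewrite mulr_ge0// addr_ge0.
have [t [B [lam [ts B1 lam0 loc [h1 h2]]]]] := h s s0.
have B0 : 0 <= B by rewrite (le_trans ler01).
(* The factors are indexed by pairs, as the two score functions may differ. *)
have := @localized_cov _ _ _ cayleyS _ _ P X ('I_k * V)%type snd (fun p => sc p.1 n p.2) n t 2 B lam M B1 lam0
  (fun p => localized_sc score_xi p.1 p.2 B0 vn loc) (fun p => fmom_sc p.1 p.2 vn) (fun p => hM p.1 n p.2 vn)
  C c phi [:: (i, x)] [:: (j, y)] (s - 2 * t)%N clus.
rewrite subn_gt0 ts => /(_ isT M0 isT).
have -> : (fun om => \prod_(p <- [:: (i, x)]) sc p.1 n p.2 om) = sc i n x by apply/funext => om; rewrite big_seq1.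
have -> : (fun om => \prod_(p <- [:: (j, y)]) sc p.1 n p.2 om) = sc j n y by apply/funext => om; rewrite big_seq1.
move=> hc; apply: le_trans (hc _) _.
  by move=> i0 j0; rewrite !inE => /eqP -> /eqP -> /=; rewrite (subnKC (ltnW ts)).
rewrite mulrDl mul1r mulrDl; apply: lerD; last exact: h2.
by rewrite -[leRHS]mulrA ler_wpM2l.
Qed.

Lemma mean_compare (F F' : Omega -> R) (b : Omega -> bool) lam : fmom P F -> fmom P F' ->
  measurable_fun setT b -> 0 < lam -> (forall om, ~~ b om -> F om = F' om) ->
  `|mean P F - mean P F'| <=
    lam * (mean P (fun om => F om ^+ 2) + mean P (fun om => F' om ^+ 2)) + 2 * lam^-1 * mean P (fun om => (b om)%:R).
Proof.
move=> fF fF' mb lam0 hb; have fb := fmom_bool P mb.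
rewrite -meanB//.
apply: (@le_trans _ _ (mean P (fun om => `|F om| * (b om)%:R + `|F' om| * (b om)%:R))).
  apply: mean_abs_le; first exact: fmomB.
    by apply: fmomD; apply: fmomM => //; exact: fmom_abs.
  move=> om; have [bo|/hb ->] := boolP (b om); last by rewrite subrr normr0 addr_ge0 ?mulr_ge0.
  by rewrite !mulr1 ler_normB.
rewrite meanD; [|by apply: fmomM => //; exact: fmom_abs..].
have h1 := mean_on_bad fF mb lam0; have h2 := mean_on_bad fF' mb lam0.
by apply: (le_trans (lerD h1 h2)); rewrite le_eqVlt; apply/orP; left; apply/eqP; ring.
Qed.

(** On the good event a score depends only on spins within [t <= s] of its point, where the window
    changes nothing. Off it, with probability at most [2 * lam ^ 2], second moments bound the
    discrepancy by the order of [lam]. *)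
Lemma window_comparison K : exists2 D, 0 <= D & forall i j n x y s, (0 < n)%N -> (0 < s)%N ->
  {subset nbh S x s <= ball S n} -> {subset nbh S y s <= ball S n} ->
  `|cov P (sc i (Some n) x) (sc j (Some n) y) - cov P (sc i None x) (sc j None y)| <= D / N s ^+ K.
Proof.
have [C0 C00 h] := appr 1 K; have [M M0 hM] := square_moment 2; have [Mm Mm0 hMm] := mean_sc_bound.
pose A := 2 * M + 4 : R.
have A0 : 0 <= A by rewrite addr_ge0// mulr_ge0.
exists ((A + 2 * Mm * A) * C0) => [|i j n x y s n0 s0 xs ys].
  by rewrite mulr_ge0// addr_ge0// !mulr_ge0.
have [t [B [lam [ts B1 lam0 [G hG] [h1 _]]]]] := h s s0.
have vN : valid_window (Some n) by []; have vI : valid_window None by [].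
have ts' : (t <= s)%N by move: ts; clear; lia.
have mem_x : x \in ball S n by apply: xs; rewrite mem_nbh// gdistxx.
have mem_y : y \in ball S n by apply: ys; rewrite mem_nbh// gdistxx.
have agree z om : {subset nbh S z s <= ball S n} -> forall w, w \in nbh S z t ->
    win S X (Some n) om w = win S X None om w.
  move=> zs w wt; rewrite /win /= zs ?andbT// mem_nbh//; move: wt; rewrite mem_nbh// => wt.
  exact: leq_trans ts'.
pose b om := ~~ G i x (win S X (Some n) om) || ~~ G j y (win S X (Some n) om).
have mG i' z : measurable_fun setT (fun om => ~~ G i' z (win S X (Some n) om)).
  apply: measurable_neg; apply: measurableT_comp (measurable_win _ _ _).
  by have [dG _ _ _] := hG i' z; exact: depends_on_measurable dG.
have mb : measurable_fun setT b by exact: measurable_or.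
have Eb : mean P (fun om => (b om)%:R) <= 2 * lam ^+ 2.
  apply: (@le_trans _ _ (mean P (fun om => (~~ G i x (win S X (Some n) om))%:R + (~~ G j y (win S X (Some n) om))%:R))).
    apply: mean_le; [exact: fmom_bool|by apply: fmomD; exact: fmom_bool|].
    by move=> om; rewrite /b; case: (G i x _); case: (G j y _); rewrite /= ?addr0 ?add0r ?lerDl.
  rewrite meanD; [|exact: fmom_bool..]; have -> : 2 * lam ^+ 2 = lam ^+ 2 + lam ^+ 2 by ring.
  by apply: lerD; [have [_ _ _ hh] := hG i x|have [_ _ _ hh] := hG j y]; apply: hh.
have eq_sc i' z om : {subset nbh S z s <= ball S n} -> G i' z (win S X (Some n) om) ->
    sc i' (Some n) z om = sc i' None z om.
  move=> zs g; have [dG dh _ _] := hG i' z.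
  have := dh _ _ (agree z om zs); rewrite -(dG _ _ (agree z om zs)) g.
  by [].
have ex om : ~~ b om -> sc i (Some n) x om = sc i None x om.
  by rewrite negb_or !negbK => /andP[g _]; exact: eq_sc.
have ey om : ~~ b om -> sc j (Some n) y om = sc j None y om.
  by rewrite negb_or !negbK => /andP[_ g]; exact: eq_sc.
have cmp (F F' : Omega -> R) : fmom P F -> fmom P F' -> (forall om, ~~ b om -> F om = F' om) ->
    mean P (fun om => F om ^+ 2) <= M -> mean P (fun om => F' om ^+ 2) <= M ->
    `|mean P F - mean P F'| <= A * lam.
  move=> fF fF' hb m1 m2; apply: (le_trans (mean_compare fF fF' mb lam0 hb)).
  apply: (@le_trans _ _ (lam * (M + M) + 2 * lam^-1 * (2 * lam ^+ 2))).
    apply: lerD; first by rewrite ler_wpM2l ?(ltW lam0)// lerD.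
    by rewrite ler_wpM2l// mulr_ge0// invr_ge0 ltW.
  by rewrite le_eqVlt; apply/orP; left; apply/eqP; rewrite /A; field; rewrite gt_eqF.
have sq i' n' z : valid_window n' -> mean P (fun om => sc i' n' z om ^+ 2) <= M.
  move=> vn; apply: le_trans (hM i' n' z vn); have fs := fmom_sc i' z vn; apply: mean_le; first exact: fmomX.
    by apply: fmomX; apply: fmomD; [exact: fmom_cst|exact: fmomX].
  move=> om; set u := sc _ _ _ _ ^+ 2; have u0 : 0 <= u by exact: sqr_ge0.
  by rewrite sqrrD expr1n mul1r; have := sqr_ge0 u; lra.
have sq2 i' j' n' z w : valid_window n' -> mean P (fun om => (sc i' n' z om * sc j' n' w om) ^+ 2) <= M.
  move=> vn; have fz := fmom_sc i' z vn; have fw := fmom_sc j' w vn.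
  apply: (@le_trans _ _ (mean P (fun om => 2^-1 * (1 + sc i' n' z om ^+ 2) ^+ 2 + 2^-1 * (1 + sc j' n' w om ^+ 2) ^+ 2))).
    apply: mean_le; first by apply: fmomX; exact: fmomM.
      by apply: fmomD; apply: fmomZ; apply: fmomX; apply: fmomD; (exact: fmom_cst || exact: fmomX).
    move=> om; rewrite exprMn; set u := sc i' _ _ _ ^+ 2; set v := sc j' _ _ _ ^+ 2.
    have u0 : 0 <= u by exact: sqr_ge0. have v0 : 0 <= v by exact: sqr_ge0.
    by have := sqr_ge0 (u - v); rewrite sqrrB !sqrrD; lra.
  rewrite meanD; [|by apply: fmomZ; apply: fmomX; apply: fmomD; (exact: fmom_cst || exact: fmomX)..].
  rewrite !meanZ; [|by apply: fmomX; apply: fmomD; (exact: fmom_cst || exact: fmomX)..].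
  by have := hM i' n' z vn; have := hM j' n' w vn; lra.
have fx := fmom_sc i x vN; have fy := fmom_sc j y vN; have gx := fmom_sc i x vI; have gy := fmom_sc j y vI.
have q1 : `|mean P (fun om => sc i (Some n) x om * sc j (Some n) y om) -
    mean P (fun om => sc i None x om * sc j None y om)| <= A * lam.
  apply: cmp; [exact: fmomM|exact: fmomM| |exact: sq2|exact: sq2].
  by move=> om bo; rewrite ex// ey.
have q2 : `|mean P (sc i (Some n) x) - mean P (sc i None x)| <= A * lam by apply: cmp => //; exact: sq.
have q3 : `|mean P (sc j (Some n) y) - mean P (sc j None y)| <= A * lam by apply: cmp => //; exact: sq.
have r1 := hMm i None x vI; have r2 := hMm j (Some n) y vN.
rewrite /cov; move: q1 q2 q3 r1 r2.
set e1 := mean P (fun om => _); set e2 := mean P (fun om => _).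
move: (mean P (sc i (Some n) x)) (mean P (sc i None x)) (mean P (sc j (Some n) y)) (mean P (sc j None y)).
move=> a1 a2 b1 b2 q1 q2 q3 r1 r2.
have -> : e1 - a1 * b1 - (e2 - a2 * b2) = (e1 - e2) - ((a1 - a2) * b1 + a2 * (b1 - b2)) by ring.
rewrite (le_trans (ler_normB _ _))//.
apply: (@le_trans _ _ (A * lam + (A * lam * Mm + Mm * (A * lam)))).
  apply: lerD => //; rewrite (le_trans (ler_normD _ _))// !normrM lerD// ler_pM//.
have -> : A * lam + (A * lam * Mm + Mm * (A * lam)) = (A + 2 * Mm * A) * lam by ring.
by rewrite -[leRHS]mulrA ler_wpM2l// addr_ge0// !mulr_ge0.
Qed.

Lemma mean_shift (g : config V -> R) y : measurable_fun setT g -> fmom P (fun om => g (X om)) ->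
  fmom P (fun om => g (Defs.shift y (X om))) ->
  mean P (fun om => g (Defs.shift y (X om))) = mean P (fun om => g (X om)).
Proof.
move=> mg f1 f2; have [[stat _] _ _ _ _] := clus.
have mX : measurable_fun setT X by exact: measurable_funPT.
have mY : measurable_fun setT (fun om => Defs.shift y (X om)).
  apply: measurable_config => x; rewrite /Defs.shift.
  exact: (measurableT_comp (measurable_coord _) mX).
have mgE : measurable_fun setT (EFin \o g) by exact/measurable_EFinP.
have e1 := integral_pushforward mX (D := setT) mgE (fmom_int f1) measurableT.
have e2 := integral_pushforward mY (D := setT) mgE (fmom_int f2) measurableT.
rewrite /mean /Rintegral; congr fine.
have e1' : (\int[P]_x (g (X x))%:E = \int[pushforward P X]_y (EFin \o g) y)%E by rewrite e1 preimage_setT.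
have e2' : (\int[P]_x (g (Defs.shift y (X x)))%:E =
   \int[pushforward P (fun om => Defs.shift y (X om))]_y (EFin \o g) y)%E by rewrite e2 preimage_setT.
rewrite e1' e2'; apply: eq_measure_integral => A mA _.
exact: stat.
Qed.

Lemma cov_stationary i j x y :
  cov P (sc i None x) (sc j None y) = cov P (sc i None 1%g) (sc j None (x^-1 * y)%g).
Proof.
have vI : valid_window None by [].
have e i' z : sc i' None z = (fun om => xi i' (x^-1 * z)%g (Defs.shift (x^-1)%g (X om))).
  apply/funext => om; rewrite /score_at win_None.
  have [_ tr _] := score_xi i'.
  exact: esym (tr (x^-1)%g z (X om)).
have e' i' z : sc i' None z = (fun om => xi i' z (X om)) by apply/funext => om; rewrite /score_at win_None.
have m i' z : measurable_fun setT (xi i' z) by have [] := score_xi i'.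
have ms g : measurable_fun setT g -> fmom P (fun om => g (X om)) ->
    fmom P (fun om => g (Defs.shift (x^-1)%g (X om))) ->
    mean P (fun om => g (Defs.shift (x^-1)%g (X om))) = mean P (fun om => g (X om)) by exact: mean_shift.
have fe i' z : fmom P (fun om => xi i' (x^-1 * z)%g (Defs.shift (x^-1)%g (X om))).
  by rewrite -e; exact: fmom_sc.
have fe' i' z : fmom P (fun om => xi i' z (X om)) by rewrite -e'; exact: fmom_sc.
rewrite /cov [in LHS](e i x) [in LHS](e j y) [in RHS](e' i) [in RHS](e' j) mulVg.
have fe1 i' : fmom P (fun om => xi i' 1%g (Defs.shift (x^-1)%g (X om))) by rewrite -(mulVg x).
congr (_ - _ * _).
- apply: (ms (fun mu => xi i 1%g mu * xi j (x^-1 * y)%g mu)).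
  + exact: measurable_funM.
  + exact: fmomM.
  + exact: fmomM.
- exact: ms.
- exact: ms.
Qed.

Definition covb i j z := cov P (sc i None 1%g) (sc j None z).

Lemma cov_density_hyps : exists2 D, 0 <= D & forall i j,
  [/\ (forall n x y, (0 < n)%N -> `|cov P (sc i (Some n) x) (sc j (Some n) y)| <= D / N (gdist S x y) ^+ 2),
      (forall n s x y, (0 < n)%N -> (0 < s)%N -> {subset nbh S x s <= ball S n} ->
        {subset nbh S y s <= ball S n} ->
        `|cov P (sc i (Some n) x) (sc j (Some n) y) - covb i j (x^-1 * y)%g| <= D / N s ^+ 2)
    & (forall z, `|covb i j z| <= D / N (len S z) ^+ 2)].
Proof.
have [D1 D10 h1] := sc_cov_decay 2; have [D2 D20 h2] := window_comparison 2.
have [M M0 hM] := square_moment 2.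
have [Mm Mm0 hMm] := mean_sc_bound.
have v0 : vol S 0 = 1%N by rewrite /vol cardfs1.
pose Mc := M + Mm * Mm; have Mc0 : 0 <= Mc by rewrite addr_ge0// mulr_ge0.
have cb i j n x y : valid_window n -> `|cov P (sc i n x) (sc j n y)| <= Mc.
  move=> vn; have fx := fmom_sc i x vn; have fy := fmom_sc j y vn.
  rewrite /cov (le_trans (ler_normB _ _))// lerD//; last by rewrite normrM ler_pM ?hMm.
  apply: (@le_trans _ _ (mean P (fun om => 2^-1 * (1 + sc i n x om ^+ 2) ^+ 2 + 2^-1 * (1 + sc j n y om ^+ 2) ^+ 2))).
    apply: mean_abs_le; first exact: fmomM.
      by apply: fmomD; apply: fmomZ; apply: fmomX; apply: fmomD; (exact: fmom_cst || exact: fmomX).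
    move=> om; rewrite ler_norml; set u := sc i n x om; set v := sc j n y om.
    have h3 := sqr_ge0 (u + v); have h4 := sqr_ge0 (u - v).
    have h5 := sqr_ge0 (u ^+ 2); have h6 := sqr_ge0 (v ^+ 2).
    rewrite sqrrD in h3; rewrite sqrrB in h4; rewrite !sqrrD.
    by apply/andP; split; lra.
  rewrite meanD; [|by apply: fmomZ; apply: fmomX; apply: fmomD; (exact: fmom_cst || exact: fmomX)..].
  rewrite !meanZ; [|by apply: fmomX; apply: fmomD; (exact: fmom_cst || exact: fmomX)..].
  by have := hM i n x vn; have := hM j n y vn; lra.
have D0 : 0 <= D1 + D2 + Mc by rewrite addr_ge0// addr_ge0.
exists (D1 + D2 + Mc) => //.
have dec i j n x y : valid_window n -> `|cov P (sc i n x) (sc j n y)| <= (D1 + D2 + Mc) / N (gdist S x y) ^+ 2.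
  move=> vn; have [xy|xy] := posnP (gdist S x y).
    rewrite xy v0 expr1n divr1 (le_trans (cb _ _ _ _ _ vn))// lerDr addr_ge0//.
  apply: (le_trans (h1 i j n x y _ vn xy (leqnn _))).
  by rewrite ler_wpM2r ?vol_inv_ge0// -addrA lerDl addr_ge0.
move=> i j; split => [n x y n0|n s x y n0 s0 xs ys|z].
- exact: dec.
- rewrite /covb -cov_stationary (le_trans (h2 i j n x y s n0 s0 xs ys))//.
  by rewrite ler_wpM2r ?vol_inv_ge0// -addrA addrCA lerDl addr_ge0.
- exact: dec.
Qed.


Lemma score_covE i j z : score_cov P X (xi i) (xi j) z = (covb i j z)%:E.
Proof.
have e' i' w : (fun om => xi i' w (X om)) = sc i' None w by apply/funext => om; rewrite /score_at win_None.
by rewrite /score_cov e' e' covarianceE_fmom//; exact: fmom_sc.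
Qed.

Lemma summable_score_cov i j : summable [set: V] (score_cov P X (xi i) (xi j)).
Proof.
have [D D0 h] := cov_density_hyps; have [_ _ hb] := h i j.
have -> : score_cov P X (xi i) (xi j) = fun z => (covb i j z)%:E by apply/funext => z; exact: score_covE.
exact: (summable_b cayleyS D0 hb).
Qed.

Lemma limit_covE i j : limit_cov P X xi i j = total_b (covb i j).
Proof.
rewrite mxE /total_b.
by have -> : score_cov P X (xi i) (xi j) = fun z => (covb i j z)%:E by apply/funext => z; exact: score_covE.
Qed.

Lemma cov_density i j :
  (\sum_(x <- ball S n) \sum_(y <- ball S n) cov P (sc i (Some n) x) (sc j (Some n) y)) / N n
    @[n --> \oo] --> limit_cov P X xi i j.
Proof.
have [D D0 h] := cov_density_hyps; have [ha hab hb] := h i j.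
rewrite limit_covE.
exact: (density_cvg cayleyS (a := fun n x y => cov P (sc i (Some n) x) (sc j (Some n) y)) D0 ha hab hb amen).
Qed.

(** The double sums over a window are symmetric in the two scores, and so are their limits. *)
Lemma limit_cov_sym : (limit_cov P X xi)^T = limit_cov P X xi.
Proof.
apply/matrixP => i j; rewrite mxE.
have h := @cov_density j i; have h' := @cov_density i j.
suff e : (fun n => (\sum_(x <- ball S n) \sum_(y <- ball S n) cov P (sc j (Some n) x) (sc i (Some n) y)) / N n) =
    (fun n => (\sum_(x <- ball S n) \sum_(y <- ball S n) cov P (sc i (Some n) x) (sc j (Some n) y)) / N n).
  by rewrite e in h; have := cvg_unique _ h h'; apply.
apply/funext => n; congr (_ / _); rewrite exchange_big /=.
by apply: eq_bigr => x _; apply: eq_bigr => y _; rewrite covC.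
Qed.

(** * Centred linear combinations of the scores *)

Section Field.
Variable t : 'rV[R]_k.

(** Means are taken inside the window and therefore vary with [x] near the boundary. *)
Definition field n x om : R := \sum_i t 0 i * (sc i (Some n) x om - mean P (sc i (Some n) x)).

Lemma fmom_field n x : (0 < n)%N -> fmom P (field n x).
Proof.
move=> n0; apply: fmom_sum => i _; apply: fmomZ; apply: fmomB; last exact: fmom_cst.
exact: fmom_sc.
Qed.

Lemma mean_field n x : (0 < n)%N -> mean P (field n x) = 0.
Proof.
move=> n0; have fc i : fmom P (fun om => sc i (Some n) x om - mean P (sc i (Some n) x)).
  by apply: fmomB; [exact: fmom_sc|exact: fmom_cst].
rewrite mean_sum => [|i _]; last exact: fmomZ.
apply: big1 => i _; rewrite meanZ// meanB; [|exact: fmom_sc|exact: fmom_cst].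
by rewrite mean_cst subrr mulr0.
Qed.

(** The good events of all scores are intersected: failures add up to [k * lam ^ 2], which
    [(k.+1 * lam) ^ 2] covers while the factor stays positive for every [k]. [A] absorbs the
    coefficients and the means. *)
Lemma field_localized : exists2 A, 1 <= A & forall s B lam n x, (0 < n)%N -> 1 <= B -> 0 < lam ->
  scores_localized S X xi s B lam ->
  localized S X (Some n) s (A * B) (k.+1%:R * lam) x (field n x).
Proof.
have [Mm Mm0 hMm] := mean_sc_bound.
pose A := 1 + \sum_i `|t 0 i| * (1 + Mm).
have A1 : 1 <= A by rewrite lerDl sumr_ge0// => i _; rewrite mulr_ge0// addr_ge0.
exists A => // s B lam n x n0 B1 lam0 [G hG].
have vn : valid_window (Some n) by [].
have B0 : 0 <= B by rewrite (le_trans ler01).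
have [xn|xn] := boolP (x \in ball S n); last first.
  exists (fun=> true), (fun=> 0); split => //.
  - apply/funext => om; apply: big1 => i _.
    have z : sc i (Some n) x = fun=> 0 by apply/funext => om'; exact: sc_outside.
    by rewrite z mean_cst subrr mulr0.
  - by move=> mu _; rewrite normr0 mulr_ge0// (le_trans ler01).
  - by rewrite mean_cst sqr_ge0.
pose m i := mean P (sc i (Some n) x).
exists (fun mu => [forall i, G i x mu]), (fun mu => \sum_i t 0 i * (xi i x mu - m i)).
have dG : depends_on (nbh S x s) (fun mu => [forall i, G i x mu]).
  by move=> mu mu' e; apply: eq_forallb => i; have [dG _ _ _] := hG i x; exact: dG.
split => //.
- move=> mu mu' e; rewrite -(dG _ _ e); case: ifP => // /forallP g.
  apply: eq_bigr => i _; congr (_ * (_ - _)); have [dGi dh _ _] := hG i x.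
  by have := dh _ _ e; rewrite -(dGi _ _ e) g.
- move=> mu /forallP g; rewrite (le_trans (ler_norm_sum _ _ _))//.
  apply: (@le_trans _ _ (\sum_i `|t 0 i| * (1 + Mm) * B)); last first.
    by rewrite -mulr_suml ler_wpM2r// lerDr.
  apply: ler_sum => i _; rewrite normrM -mulrA ler_wpM2l// mulrDl mul1r.
  rewrite (le_trans (ler_normB _ _))// lerD//; first by have [_ _ hB _] := hG i x; exact: hB.
  by rewrite (le_trans (hMm i (Some n) x vn))// ler_peMr.
- have mG i : measurable_fun setT (fun om => ~~ G i x (win S X (Some n) om)).
    apply: measurable_neg; apply: measurableT_comp (measurable_win _ _ _).
    by have [dGi _ _ _] := hG i x; exact: depends_on_measurable dGi.
  apply: (@le_trans _ _ (mean P (fun om => \sum_i (~~ G i x (win S X (Some n) om))%:R))).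
    apply: mean_le.
    + apply: fmom_bool; apply: measurable_neg.
      exact: (measurableT_comp (depends_on_measurable dG) (measurable_win S X (Some n))).
    + by apply: fmom_sum => i _; exact: fmom_bool.
    + move=> om; have [/forallP g|/forallPn[i gi]] := boolP [forall i, G i x (win S X (Some n) om)].
        by apply: sumr_ge0.
      by rewrite (bigD1 i)//= gi lerDl sumr_ge0.
  rewrite mean_sum => [|i _]; last exact: fmom_bool.
  apply: (@le_trans _ _ (\sum_(i < k) lam ^+ 2)).
    by apply: ler_sum => i _; have [_ _ _ h] := hG i x; exact: h.
  rewrite sumr_const card_ord -[leLHS]mulr_natl exprMn ler_wpM2r ?sqr_ge0//.
  by rewrite -natrX ler_nat -mulnn (leq_trans (leqnSn k))// leq_pmulr.
Qed.

Lemma field_moment p : exists2 M, 0 <= M & forall n x, (0 < n)%N ->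
  mean P (fun om => (1 + field n x om ^+ 2) ^+ p) <= M.
Proof.
have [Mm Mm0 hMm] := mean_sc_bound; have [M M0 hM] := abs_moment (2 * p).
pose A := 1 + \sum_i `|t 0 i| * (1 + Mm).
have A1 : 1 <= A by rewrite lerDl sumr_ge0// => i _; rewrite mulr_ge0// addr_ge0.
have A0 : 0 <= A by rewrite (le_trans ler01).
exists ((2 * A ^+ 2) ^+ p * (1 + k%:R * M)).
  by rewrite mulr_ge0 ?exprn_ge0 ?mulr_ge0// ?exprn_ge0// addr_ge0// mulr_ge0.
move=> n x n0; have vn : valid_window (Some n) by [].
have fsc i : fmom P (fun om => (1 + `|sc i (Some n) x om|) ^+ (2 * p)).
  by apply: fmomX; apply: fmomD; [exact: fmom_cst|exact/fmom_abs/fmom_sc].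
apply: (@le_trans _ _ (mean P (fun om => (2 * A ^+ 2) ^+ p * (1 + \sum_i (1 + `|sc i (Some n) x om|) ^+ (2 * p))))).
  apply: mean_le.
  - by apply: fmomX; apply: fmomD; [exact: fmom_cst|exact/fmomX/fmom_field].
  - by apply: fmomZ; apply: fmomD; [exact: fmom_cst|exact: fmom_sum].
  - move=> om; pose mx := \big[Num.max/1]_(i < k) (1 + `|sc i (Some n) x om|).
    have a1 (i : 'I_k) : 1 <= 1 + `|sc i (Some n) x om| by rewrite lerDl.
    have mx1 : 1 <= mx by rewrite /mx; elim/big_ind: _ => // u v u1 v1; rewrite le_max u1.
    have mxi i : 1 + `|sc i (Some n) x om| <= mx by rewrite /mx (bigD1 i)//= le_max lexx.
    have hY : `|field n x om| <= A * mx.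
      rewrite (le_trans (ler_norm_sum _ _ _))//.
      apply: (@le_trans _ _ (\sum_i `|t 0 i| * (1 + Mm) * mx)).
        apply: ler_sum => i _; rewrite normrM -mulrA ler_wpM2l//.
        rewrite (le_trans (ler_normB _ _))// mulrDl mul1r addrC.
        have := hMm i (Some n) x vn; have := mxi i; have : Mm <= Mm * mx by rewrite ler_peMr.
        by lra.
      by rewrite -mulr_suml ler_wpM2r ?(le_trans ler01)// lerDr.
    have h2 : 1 + field n x om ^+ 2 <= 2 * A ^+ 2 * mx ^+ 2.
      have : field n x om ^+ 2 <= (A * mx) ^+ 2.
        by rewrite -(real_normK (num_real (field n x om))) lerXn2r ?nnegrE ?normr_ge0 ?mulr_ge0 ?(le_trans ler01 mx1).
      have : 1 <= (A * mx) ^+ 2 by rewrite exprn_ege1// (le_trans A1)// ler_peMr.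
      by rewrite exprMn; lra.
    apply: (@le_trans _ _ ((2 * A ^+ 2 * mx ^+ 2) ^+ p)).
      have h0 : 0 <= 1 + field n x om ^+ 2 by rewrite addr_ge0 ?sqr_ge0.
      by rewrite lerXn2r ?nnegrE// (le_trans h0).
    rewrite exprMn -exprM ler_wpM2l ?exprn_ge0 ?mulr_ge0 ?exprn_ge0//.
    exact: bigmax_expr_le.
rewrite meanZ; last by apply: fmomD; [exact: fmom_cst|exact: fmom_sum].
rewrite ler_wpM2l ?exprn_ge0 ?mulr_ge0 ?exprn_ge0// meanD; [|exact: fmom_cst|exact: fmom_sum].
rewrite mean_cst lerD2l mean_sum//.
apply: (@le_trans _ _ (\sum_(i < k) M)); first by apply: ler_sum => i _; exact: hM.
by rewrite sumr_const card_ord mulr_natl.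
Qed.

Lemma field_prod_bound p : exists2 Q, 1 <= Q & forall n r, (0 < n)%N -> (size r <= p)%N ->
  {subset r <= ball S n} -> `|mean P (fun om => \prod_(x <- r) field n x om)| <= Q.
Proof.
have [M M0 hM] := field_moment p; exists (2 + p%:R * M).
  have := mulr_ge0 (ler0n R p) M0; lra.
move=> n r n0 rp _; have fY x := fmom_field x n0.
have fP : fmom P (fun om => \prod_(x <- r) field n x om) by apply: fmom_prod => x _.
have h := prod_second_moment fY (fun x => hM n x n0) rp.
apply: (@le_trans _ _ (mean P (fun om => 1 + (\prod_(x <- r) field n x om) ^+ 2))).
  apply: mean_abs_le => //; first by apply: fmomD; [exact: fmom_cst|exact: fmomX].
  move=> om; set u := \prod_(_ <- _) _; rewrite ler_norml.
  have h1 := sqr_ge0 (u + 1); have h2 := sqr_ge0 (u - 1); have h3 := sqr_ge0 u.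
  rewrite sqrrD in h1; rewrite sqrrB in h2.
  by apply/andP; split; lra.
rewrite meanD; [|exact: fmom_cst|exact: fmomX].
rewrite mean_cst; have : (size r)%:R * M <= p%:R * M by rewrite ler_wpM2r// ler_nat.
by lra.
Qed.

Lemma field_mixing p K : exists2 D, 0 <= D & forall n s xs ys, (0 < n)%N -> (0 < s)%N ->
  (size xs + size ys <= p)%N -> {subset xs <= ball S n} -> {subset ys <= ball S n} ->
  (forall x y, x \in xs -> y \in ys -> (s < gdist S x y)%N) ->
  `|cov P (fun om => \prod_(x <- xs) field n x om) (fun om => \prod_(y <- ys) field n y om)| <=
    D / N s ^+ K.
Proof.
have [A A1 hloc] := field_localized; have [C0 C00 h] := appr p K; have [M M0 hM] := field_moment p.
have A0 : 0 <= A by rewrite (le_trans ler01).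
have L0 : 0 <= loc_const p M.
  by rewrite /loc_const mulr_ge0 ?addr_ge0 ?mulr_ge0 ?addr_ge0 ?mulr_ge0.
exists (loc_const p M * (k.+1%:R * C0) + A ^+ p * C0).
  by apply: addr_ge0; [apply: mulr_ge0 => //; exact: mulr_ge0|apply: mulr_ge0 => //; exact: exprn_ge0].
move=> n s xs ys n0 s0 szp _ _ sep.
have [r [B [lam [rs B1 lam0 loc [h1 h2]]]]] := h s s0.
have AB1 : 1 <= A * B by rewrite (le_trans A1)// ler_peMr.
have lam0' : 0 < k.+1%:R * lam by rewrite mulr_gt0.
have := @localized_cov _ _ _ cayleyS _ _ P X V id (field n) (Some n) r p (A * B) (k.+1%:R * lam) M AB1 lam0'
  (fun x => hloc r B lam n x n0 B1 lam0 loc) (fun x => fmom_field x n0) (fun x => hM n x n0)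
  C c phi xs ys (s - 2 * r)%N clus.
rewrite subn_gt0 rs => /(_ isT M0 szp).
move=> hc; apply: le_trans (hc _) _.
  by move=> x y xxs yys; rewrite (subnKC (ltnW rs)) ltnW// sep.
rewrite mulrDl lerD//.
  by rewrite -[leRHS]mulrA ler_wpM2l// -[leRHS]mulrA ler_wpM2l.
rewrite exprMn -[leRHS]mulrA.
apply: (@le_trans _ _ (A ^+ p * error_bound S C c phi p r B (s - 2 * r))).
  by rewrite /error_bound le_eqVlt; apply/orP; left; apply/eqP; ring.
by rewrite ler_wpM2l// exprn_ge0.
Qed.

(** Expanding the square gives a finite combination, over pairs of scores, of the covariance
    densities of [cov_density]. *)
Lemma field_variance_cvg : nmoment S P field 2 n @[n --> \oo] -->
  (t *m limit_cov P X xi *m t^T) 0 0.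
Proof.
have -> : (t *m limit_cov P X xi *m t^T) 0 0 =
    \sum_i \sum_j t 0 i * t 0 j * limit_cov P X xi i j.
  rewrite mxE exchange_big /=; apply: eq_bigr => j _; rewrite !mxE mulr_suml.
  by apply: eq_bigr => i _; ring.
have : \sum_i \sum_j t 0 i * t 0 j *
    ((\sum_(x <- ball S n) \sum_(y <- ball S n) cov P (sc i (Some n) x) (sc j (Some n) y)) / N n)
    @[n --> \oo] --> \sum_i \sum_j t 0 i * t 0 j * limit_cov P X xi i j.
  by apply: cvgn_sum => i _; apply: cvgn_sum => j _; apply: cvgMl_tmp; exact: cov_density.
move=> /cvgn_distP h; apply/cvgn_distP => e e0; have [n0 hn0] := h e e0.
exists (maxn 1 n0) => n; rewrite geq_max => /andP[npos nn0].
suff -> : nmoment S P field 2 n = \sum_i \sum_j t 0 i * t 0 j *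
    ((\sum_(x <- ball S n) \sum_(y <- ball S n) cov P (sc i (Some n) x) (sc j (Some n) y)) / N n).
  exact: hn0.
rewrite /nmoment rootvol_sqr.
have fY x := fmom_field x npos.
have fs i x := fmom_sc i x (npos : valid_window (Some n)).
pose ce i x om := sc i (Some n) x om - mean P (sc i (Some n) x).
have fc i x : fmom P (ce i x) by apply: fmomB; [exact: fs|exact: fmom_cst].
have -> : mean P (fun om => total S (field n) n om ^+ 2) =
    \sum_(x <- ball S n) \sum_(y <- ball S n) \sum_i \sum_j t 0 i * t 0 j * cov P (sc i (Some n) x) (sc j (Some n) y).
  have -> : (fun om => total S (field n) n om ^+ 2) =
      (fun om => \sum_(x <- ball S n) \sum_(y <- ball S n) \sum_i \sum_j t 0 i * t 0 j * (ce i x om * ce j y om)).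
    apply/funext => om; rewrite expr2 /total mulr_suml; apply: eq_bigr => x _.
    rewrite mulr_sumr; apply: eq_bigr => y _; rewrite /field mulr_suml; apply: eq_bigr => i _.
    by rewrite mulr_sumr; apply: eq_bigr => j _; rewrite /ce; ring.
  have f4 x y i j : fmom P (fun om => t 0 i * t 0 j * (ce i x om * ce j y om)).
    by apply: fmomZ; exact: fmomM.
  rewrite mean_sum => [|x _]; last by do 3 (apply: fmom_sum => ? _).
  apply: eq_bigr => x _; rewrite mean_sum => [|y _]; last by do 2 (apply: fmom_sum => ? _).
  apply: eq_bigr => y _; rewrite mean_sum => [|i _]; last by apply: fmom_sum => ? _.
  apply: eq_bigr => i _; rewrite mean_sum => [|j _]; last by [].
  by apply: eq_bigr => j _; rewrite meanZ ?cov_center//; exact: fmomM.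
under eq_bigr => x _ do rewrite exchange_big.
rewrite exchange_big mulr_suml; apply: eq_bigr => i _ /=.
under eq_bigr => x _ do rewrite exchange_big.
rewrite exchange_big mulr_suml; apply: eq_bigr => j _ /=.
rewrite mulrA mulr_sumr; congr (_ / _); apply: eq_bigr => x _.
by rewrite mulr_sumr.
Qed.

Lemma limit_cov_psd : 0 <= (t *m limit_cov P X xi *m t^T) 0 0.
Proof.
have h := field_variance_cvg; rewrite -(cvg_lim _ h)//.
apply: limr_ge; first by apply/cvg_ex; eexists; exact: h.
exists 1%N => // n /= n1; rewrite divr_ge0 ?exprn_ge0 ?sqrtr_ge0// mean_ge0// => om.
exact: sqr_ge0.
Qed.

Lemma field_nmoment_cvg m : nmoment S P field m n @[n --> \oo] -->
  gauss_moment ((t *m limit_cov P X xi *m t^T) 0 0) m.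
Proof.
apply: (nmoment_cvg cayleyS) field_variance_cvg m.
- by move=> n x; exact: fmom_field.
- by move=> n x n0 _; exact: mean_field.
- exact: field_prod_bound.
- exact: field_mixing.
Qed.

End Field.
End Hub.

(** * The central limit theorem *)

Section Statistics.
Variables (R : realType) (V : groupType) (S : {fset V}).
Hypothesis cayleyS : cayley_graph S.
Variables (d : measure_display) (Omega : measurableType d).
Variables (P : probability Omega R) (X : {RV P >-> config V}).
Variables (k : nat) (xi : 'I_k -> V -> config V -> R).
Hypothesis score_xi : forall i, score_function (xi i).
Hypothesis bm : bounded_moments S X xi.

Local Notation sc := (score_at S X xi).

(** Scores vanish at empty sites, so the sum may run over the whole ball instead of a random set. *)
Lemma H_sum i n om : H S X (xi i) n om = \sum_(x <- ball S n) sc i (Some n) x om.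
Proof.
rewrite /H (fsbig_seq _ _ (fset_uniq (ball S n))) windowed_Some//.
apply: fsbig_widen => [x /= |x /= [xn]].
  by rewrite /win /inw => /andP[].
by move=> /negP nx; have [_ _ z] := score_xi i; exact: z.
Qed.

Lemma fmom_H i n : (0 < n)%N -> fmom P (H S X (xi i) n).
Proof.
move=> n0; have -> : H S X (xi i) n = fun om => \sum_(x <- ball S n) sc i (Some n) x om.
  by apply/funext => om; exact: H_sum.
by apply: fmom_sum => x _; case: bm => h _; exact: h.
Qed.

Lemma fmom_normalized_H n i : (0 < n)%N -> fmom P (fun om => normalized_H S P X xi n om 0 i).
Proof.
move=> n0; under eq_fun do rewrite mxE mulrC.
by apply: fmomZ; apply: fmomB; [exact: fmom_H|exact: fmom_cst].
Qed.

Lemma dotr_normalized_H (t : 'rV[R]_k) n om : (0 < n)%N ->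
  dotr t (normalized_H S P X xi n om) = total S (field S X xi t n) n om / rootvol R S n.
Proof.
move=> n0; rewrite dotrE /total /field exchange_big /= mulr_suml; apply: eq_bigr => i _.
have fs x : fmom P (sc i (Some n) x) by case: bm => h _; exact: h.
rewrite mxE wE// mulrAC; congr (_ / _); rewrite -mulr_sumr mulrC; congr (_ * _).
rewrite -meanE H_sum sumrB; congr (_ - _).
have -> : H S X (xi i) n = fun om => \sum_(x <- ball S n) sc i (Some n) x om.
  by apply/funext => om'; exact: H_sum.
by rewrite mean_sum.
Qed.

Lemma mean_normalized_H (t : 'rV[R]_k) n m : (0 < n)%N ->
  mean P (fun om => dotr t (normalized_H S P X xi n om) ^+ m) = nmoment S P (field S X xi t) m n.
Proof.
move=> n0; under eq_fun do rewrite dotr_normalized_H// expr_div_n mulrC.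
rewrite meanZ; first by rewrite mulrC.
apply: fmomX; apply: fmom_total => // x; exact: fmom_field.
Qed.

End Statistics.

Theorem theorem1p11 (R : realType) (V : groupType) (S : {fset V})
    (d : measure_display) (Omega : measurableType d) (P : probability Omega R)
    (X : {RV P >-> config V}) (k : nat) (xi : 'I_k -> V -> config V -> R)
    (k_gt0 : (0 < k)%N)
    (cayleyS : cayley_graph S)
    (score_xi : forall i, score_function (xi i))
    (conditions :
      [/\ b_amenable S R,
          (exists C c phi, clustering S P X C c phi /\ summable_in S phi)
        & (forall i, local_score S (xi i))]
      \/
      [/\ polynomial_growth S R,
          exponentially_clustering S P X
        & (forall i,
             [/\ exponentially_quasi_local S P X (xi i),
                 exponential_growth S (xi i)
               & forall p : R, 1 <= p -> moment_condition S P X (xi i) p])]) :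
  (forall i j, summable [set: V] (score_cov P X (xi i) (xi j))) /\
  exists nu : probability (borel_rV R k) R,
    is_gaussian (limit_cov P X xi) nu /\
    cvg_in_distribution P (normalized_H S P X xi) nu.
Proof.
(* Both conditions enter only through amenability, bounded moments and approximability; from here on
   they are treated alike. *)
have [amen bm [C [c [phi [clus appr]]]]] : [/\ b_amenable S R, bounded_moments S X xi &
    exists C c phi, clustering S P X C c phi /\ approximable S X xi C c phi].
  case: conditions => [[amen [C [c [phi [clus sphi]]]] loc]|[growth ec hxi]].
    split => //; first by apply: local_moments.
    by exists C, c, phi; split => //; exact: (local_approximable cayleyS score_xi loc).
  split; first exact: polynomial_growth_amenable.
    by apply: (quasi_local_moments cayleyS score_xi) => i; have [] := hxi i.
  have [C [c [phi [clus [c0 c00 cc] [a a01 hC] [b b0 hb]]]]] := ec.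
  have [C1 hC1] := exponential_clustering_constants clus a01 hC.
  exists C, c, phi; split => //.
  apply: (approximable_quasi_local cayleyS score_xi growth clus c00 cc hC1 b0 hb) => i.
    by have [] := hxi i.
  by have [] := hxi i.
split; first by move=> i j; exact: (summable_score_cov cayleyS score_xi clus appr bm).
have sym := limit_cov_sym cayleyS score_xi clus appr bm amen.
have psd := limit_cov_psd cayleyS score_xi clus appr bm amen.
have [nu [gnu fnu mnu]] := gaussian_exists sym psd.
exists nu; split => //; apply: cvg_in_distribution_moments => //.
- by move=> n i n0; exact: fmom_normalized_H.
- move=> t m; rewrite mnu.
  have /cvgn_distP h := @field_nmoment_cvg _ _ _ cayleyS _ _ _ _ _ _ score_xi _ _ _ clus appr bm amen t m.
  apply/cvgn_distP => e e0; have [n0 hn0] := h e e0.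
  (* The moments are identified for positive [n] only; the limit ignores the index 0. *)
  exists (maxn 1 n0) => n; rewrite geq_max => /andP[npos nn0].
  by rewrite mean_normalized_H//; exact: hn0.
- move=> t; under eq_fun do rewrite mnu.
  exact: gauss_moment_determined.
Qed.
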